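(* Let $G$ be a locally compact group. If $A$ is a $G$-algebra with the $G$-WEP, then $A\rtimes_{\mathrm{inj}}G=A\rtimes_{\max}G$, i.e. $\|\cdot\|_{\mathrm{inj}}=\|\cdot\|_{\max}$ on $C_c(G,A)$.
   Context: A $G$-algebra ($G$-$C^*$-algebra) is a $C^*$-algebra $A$ with a strongly continuous action $\alpha$ of $G$ by automorphisms. $C_c(G,A)$ carries its usual convolution $*$-algebra structure; $A\rtimes_{\max}G$ is its maximal $C^*$-completion. ''ccp'' means contractive completely positive. A $G$-algebra $A$ has the $G$-equivariant weak expectation property ($G$-WEP) if for every $G$-equivariant embedding (injective $*$-homomorphism) $\iota:A\to B$ into another $G$-algebra $B$ there is an equivariant ccp map $p:B\to A^{**}$ whose composition $p\circ\iota$ is the canonical inclusion $A\hookrightarrow A^{**}$. Here $A^{**}$ carries the (not necessarily norm-continuous) double dual action $\alpha^{**}$. For an equivariant injective $*$-homomorphism $\iota:A\to B$ of $G$-algebras, put $\|a\|_\iota:=\|(\iota\rtimes G)(a)\|_{B\rtimes_{\max}G}$ for $a\in C_c(G,A)$, where $(\iota\rtimes G)(f)=\iota\circ f$. The injective norm on $C_c(G,A)$ is $\|a\|_{\mathrm{inj}}:=\inf\{\|a\|_\iota : \iota:A\to B\text{ an equivariant injective }*\text{-homomorphism}\}$, and $A\rtimes_{\mathrm{inj}}G$ is the corresponding completion of $C_c(G,A)$. *)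

(* Defs.v *)
From HB Require Import structures.
From mathcomp Require Import all_boot all_order all_algebra.
From mathcomp Require Import all_classical all_reals all_analysis.
From mathcomp Require Export complex.

Set Implicit Arguments.
Unset Strict Implicit.
Unset Printing Implicit Defensive.

Import Order.TTheory GRing.Theory Num.Theory.
Import numFieldNormedType.Exports.

Local Open Scope classical_set_scope.
Local Open Scope ring_scope.

HB.mixin Record isTopologicalGroup G of Topological G & Group G := {
  mulg_continuous : continuous (fun x : G * G => (x.1 * x.2)%g);
  invg_continuous : continuous (fun x : G => (x^-1)%g)
}.

#[short(type="topologicalGroupType")]
HB.structure Definition TopologicalGroup :=
  {G of isTopologicalGroup G & Topological G & Group G}.

(* Complex C*-algebras, not assumed unital. *)
HB.mixin Record isCStarAlgebra (R : realType) A
    of CompleteNormedModule R[i] A := {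
  amul : A -> A -> A;
  astar : A -> A;
  amulA : associative amul;
  amul_linearl : forall b, linear (amul^~ b);
  amul_linearr : forall a, linear (amul a);
  astarK : involutive astar;
  astar_antilinear : forall (c : R[i]) a b,
    astar (c *: a + b) = c^* *: astar a + astar b;
  astarM : forall a b, astar (amul a b) = amul (astar b) (astar a);
  ler_norm_amul : forall a b, `|amul a b| <= `|a| * `|b|;
  cstar_identity : forall a, `|amul (astar a) a| = `|a| ^+ 2
}.

#[short(type="cstarAlgType")]
HB.structure Definition CStarAlgebra (R : realType) :=
  {A of isCStarAlgebra R A & CompleteNormedModule R[i] A}.

HB.mixin Record isGAlgebra (R : realType) (G : topologicalGroupType) A
    of CStarAlgebra R A := {
  gact : G -> A -> A;
  gact1 : forall a, gact 1%g a = a;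
  gactM : forall s t a, gact (s * t)%g a = gact s (gact t a);
  gact_linear : forall t, linear (gact t);
  gact_amul : forall t a b, gact t (amul a b) = amul (gact t a) (gact t b);
  gact_astar : forall t a, gact t (astar a) = astar (gact t a);
  gact_continuous : forall a, continuous (gact^~ a)
}.

#[short(type="galgType")]
HB.structure Definition GAlgebra (R : realType) (G : topologicalGroupType) :=
  {A of isGAlgebra R G A & CStarAlgebra R A}.

Definition star_homomorphism (R : realType) (A B : cstarAlgType R)
    (f : A -> B) : Prop :=
  [/\ linear f,
      forall a b, f (amul a b) = amul (f a) (f b) &
      forall a, f (astar a) = astar (f a)].

Definition equivariant_embedding (R : realType) (G : topologicalGroupType)
    (A B : galgType R G) (iota : A -> B) : Prop :=
  [/\ star_homomorphism iota,
      injective iota &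
      forall t a, iota (gact t a) = gact t (iota a)].

Section Bidual.
Context (R : realType) (A : cstarAlgType R).

Definition dual (phi : A -> R[i]) : Prop :=
  scalar phi /\ continuous (phi : A -> R[i]^o).

Definition dual_norm (phi : A -> R[i]) : R :=
  sup [set complex.Re `|phi a| | a in [set a : A | `|a| <= 1]].

(* Elements of A^** are represented by functions (A -> R[i]) -> R[i]; only
   their values on the set [dual] are meaningful, and equality in A^** is
   [bidual_eq]. *)
Definition functional : Type := (A -> R[i]) -> R[i].

Definition bidual_eq (Phi Psi : functional) : Prop :=
  forall phi, dual phi -> Phi phi = Psi phi.

Definition bidual (Phi : functional) : Prop :=
  (forall (c : R[i]) phi psi, dual phi -> dual psi ->
     Phi (fun a => c * phi a + psi a) = c * Phi phi + Phi psi) /\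
  (exists M : R, forall phi, dual phi ->
     complex.Re `|Phi phi| <= M * dual_norm phi).

Definition bidual_norm (Phi : functional) : R :=
  sup [set complex.Re `|Phi phi| |
       phi in [set phi | dual phi /\ dual_norm phi <= 1]].

(* The Arens product, (Phi Psi)(phi) = Phi (a |-> Psi (b |-> phi (a b))), and
   the involution Phi^*(phi) = conj (Phi (a |-> conj (phi (a^* )))): these are
   the operations of the C*-algebra A^**, C*-algebras being Arens regular. *)
Definition bidual_mul (Phi Psi : functional) : functional :=
  fun phi => Phi (fun a => Psi (fun b => phi (amul a b))).

Definition bidual_star (Phi : functional) : functional :=
  fun phi => (Phi (fun a => (phi (astar a))^*))^*.

Definition bidual_inj (a : A) : functional := fun phi => phi a.

(* Positivity in the *-algebras M_n(A) and M_n(A^** ). *)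
Definition mx_positive (n : nat) (x : 'M[A]_n) : Prop :=
  exists y : 'M[A]_n, forall i j,
    x i j = \sum_k amul (astar (y k i)) (y k j).

Definition bidual_mx_positive (n : nat) (x : 'M[functional]_n) : Prop :=
  exists y : 'M[functional]_n, (forall i j, bidual (y i j)) /\
    forall i j, bidual_eq (x i j)
      (fun phi => \sum_k bidual_mul (bidual_star (y k i)) (y k j) phi).

End Bidual.

Definition bidual_act (R : realType) (G : topologicalGroupType)
    (A : galgType R G) (t : G) (Phi : functional A) : functional A :=
  fun phi => Phi (phi \o gact t).

(* Contractive completely positive maps B -> A^**. *)
Definition ccp (R : realType) (A B : cstarAlgType R)
    (p : B -> functional A) : Prop :=
  [/\ forall b, bidual (p b),
      forall (c : R[i]) b b', bidual_eq (p (c *: b + b'))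
        (fun phi => c * p b phi + p b' phi),
      forall b, bidual_norm (p b) <= complex.Re `|b| &
      forall (n : nat) (x : 'M[B]_n),
        mx_positive x -> bidual_mx_positive (map_mx p x)].

Definition GWEP (R : realType) (G : topologicalGroupType)
    (A : galgType R G) : Prop :=
  forall (B : galgType R G) (iota : A -> B), equivariant_embedding iota ->
    exists p : B -> functional A,
      [/\ ccp p,
          forall t b, bidual_eq (p (gact t b)) (bidual_act t (p b)) &
          forall a, bidual_eq (p (iota a)) (bidual_inj a)].

Definition Cc (R : realType) (G : topologicalGroupType)
    (V : normedModType R[i]) (f : G -> V) : Prop :=
  continuous f /\ compact (closure [set t | f t != 0]).

(* I f = \int_G f(s) ds for a left Haar measure on G. *)
Definition haar_integral (R : realType) (G : topologicalGroupType)
    (I : (G -> R[i]) -> R[i]) : Prop :=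
  [/\ forall (c : R[i]) (f g : G -> R[i]^o), Cc f -> Cc g ->
        I (fun s => c * f s + g s) = c * I f + I g,
      forall f : G -> R[i]^o, Cc f -> (forall s, 0 <= f s) -> 0 <= I f,
      forall (t : G) (f : G -> R[i]^o), Cc f ->
        I (fun s => f (t * s)%g) = I f &
      exists2 f : G -> R[i]^o, Cc f & I f != 0].

(* The normalization is Delta(t) \int f(s t) ds = \int f(s) ds; it determines
   the modular function Delta. *)
Definition modular_function (R : realType) (G : topologicalGroupType)
    (I : (G -> R[i]) -> R[i]) (Delta : G -> R) : Prop :=
  forall (t : G) (f : G -> R[i]^o), Cc f ->
    (Delta t)%:C%C * I (fun s => f (s * t)%g) = I f.

Section CrossedProduct.
Context (R : realType) (G : topologicalGroupType).
Context (I : (G -> R[i]) -> R[i]) (Delta : G -> R).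

(* The integral of F in Cc(G, A) is the unique element of A whose image under
   every phi in A^* is \int phi(F(s)) ds. *)
Definition vector_integral (A : cstarAlgType R) (F : G -> A) : A :=
  xget 0 [set x : A | forall phi, dual phi -> phi x = I (phi \o F)].

Definition convolution (A : galgType R G) (f g : G -> A) : G -> A :=
  fun t => vector_integral (fun s => amul (f s) (gact s (g (s^-1 * t)%g))).

Definition cc_star (A : galgType R G) (f : G -> A) : G -> A :=
  fun t => (Delta (t^-1)%g)%:C%C *: gact t (astar (f (t^-1)%g)).

Definition L1_norm (A : galgType R G) (f : G -> A) : R :=
  complex.Re (I (fun s => `|f s|)).

(* As usual, representations of Cc(G, A) are required to be bounded for the
   L^1-norm, i.e. the maximal C*-completion is the enveloping C*-algebra of
   L^1(G, A). *)
Definition cstar_seminorm (A : galgType R G) (p : (G -> A) -> R) : Prop :=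
  [/\ forall f g, Cc f -> Cc g -> p (fun s => f s + g s) <= p f + p g,
      forall (c : R[i]) f, Cc f ->
        p (fun s => c *: f s) = complex.Re `|c| * p f,
      forall f g, Cc f -> Cc g -> p (convolution f g) <= p f * p g,
      forall f, Cc f -> p (convolution (cc_star f) f) = p f ^+ 2 &
      forall f, Cc f -> p f <= L1_norm f].

Definition max_norm (A : galgType R G) (f : G -> A) : R :=
  sup [set p f | p in [set p | cstar_seminorm p]].

Definition inj_norm (A : galgType R G) (f : G -> A) : R :=
  inf [set r : R | exists (B : galgType R G) (iota : A -> B),
    equivariant_embedding iota /\ r = max_norm (iota \o f)].

End CrossedProduct.

(* Main.v *)
From HB Require Import structures.
Require Import Defs.
From mathcomp Require Import all_boot all_order all_algebra.
From mathcomp Require Import all_classical all_reals all_analysis.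
From mathcomp Require Import ring lra.
Set Implicit Arguments.
Unset Strict Implicit.
Unset Printing Implicit Defensive.
Import Order.TTheory GRing.Theory Num.Theory.
Import numFieldNormedType.Exports.
Local Open Scope classical_set_scope.
Local Open Scope ring_scope.

(** Choosing the identity embedding shows that the injective norm is at most the
    maximal one. For the converse, every C*-seminorm [p] on Cc(G, A) and every
    embedding iota : A -> B must satisfy p f <= max_norm (iota \o f).

    In terms of Hilbert spaces the reason is this. A representation of the crossed
    product of [A] comes from a covariant pair, a representation pi of [A] and a
    unitary representation u of [G] on a space H. The weak expectation property gives
    an equivariant ccp map P : B -> A^**, and composing it with the normal extension
    of pi gives an equivariant ccp map from [B] to the operators on H. Its Stinespring
    dilation, the completion of B (x) H, carries a covariant pair of (B, G). Since P
    extends the inclusion of [A], the vectors iota a (x) h span a copy of H on which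
    iota(A) and [G] act by the original pair. Hence f acts on H with a norm at most
    that of iota f in the dilation, which is at most max_norm (iota \o f).

    The proof carries this out on dense subspaces, with forms and positive
    functionals in place of Hilbert spaces.
    - [exists_positive_functional] provides, for a C*-seminorm p and an element z, a
      positive functional om <= p with p(z)^2 <= 11 om (z^* z). The form om (f^* g) on
      Cc(G, A) plays the part of H; [A] acts on it by multiplication and [G] by
      translation ([fnorm_act], [form_u]), and these integrate to convolution
      ([form_conv]).
    - [ker] is the inner product of the dilation. It is positive because P is
      completely positive ([ker_pos]); the normal extension of pi is avoided by an
      approximate Riesz representation ([bidual_pos]).
    - [dil] is a vector functional of the integrated form of the dilation, and
      [dil_pos] its positivity: its value at F^* F is the double integral of a positive
      definite kernel, a limit of positive Riemann sums ([pd_integral]).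
    - [gns_seminorm] turns [dil] into a C*-seminorm on Cc(G, B), which bounds
      convolution by f on the copy of H ([left_conv_le]).
    The resulting inequality p f <= 4 max_norm (iota \o f) is then applied to powers of
    f^* f, which removes the constant ([dominated_le]).

    The preliminaries are proved in the weakest form that serves: the Gelfand-Naimark
    theorem holds up to a constant, from the positivity of y^* y ([nrg_star]), and
    integration is developed for compactly supported continuous functions from the
    Haar functional alone, by Riemann sums over partitions of unity. *)

(** * Real-valued moduli and norms *)

Section Modulus.
Context (R : realType).
Implicit Types (c d : R[i]) (r : R).

(** Norms take values in [R[i]]; their real parts are the same numbers in a type
    where suprema and real arithmetic are available. *)
Definition nrm (V : normedModType R[i]) (x : V) : R := complex.Re `|x|.
Definition cabs c : R := complex.Re `|c|.

Lemma ReC r : complex.Re (r%:C%C) = r. Proof. by []. Qed.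

Lemma ger0_complexE c : 0 <= c -> c = (complex.Re c)%:C%C.
Proof.
case: c => a b /=; rewrite lecE /= => /andP[/eqP -> _]; by [].
Qed.

Lemma nrmE (V : normedModType R[i]) (x : V) : `|x| = (nrm x)%:C%C.
Proof. exact: ger0_complexE. Qed.

Lemma cabsE c : `|c| = (cabs c)%:C%C.
Proof. exact: ger0_complexE. Qed.

Lemma lecRE r r' : (r%:C%C <= r'%:C%C :> R[i]) = (r <= r').
Proof. by rewrite lecE /= eqxx. Qed.

Lemma ltcRE r r' : (r%:C%C < r'%:C%C :> R[i]) = (r < r').
Proof. by rewrite ltcE /= eqxx. Qed.

Lemma realcI r r' : r%:C%C = r'%:C%C :> R[i] -> r = r'.
Proof. by move=> /(congr1 (@complex.Re R)). Qed.

Lemma cabs_ge0 c : 0 <= cabs c.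
Proof. by have := normr_ge0 c; rewrite cabsE -[0]/(0%:C%C) lecRE. Qed.

Lemma cabs0 : cabs 0 = 0. Proof. by apply: realcI; rewrite -cabsE normr0. Qed.
Lemma cabs1 : cabs 1 = 1. Proof. by apply: realcI; rewrite -cabsE normr1. Qed.

Lemma cabsD c d : cabs (c + d) <= cabs c + cabs d.
Proof. by rewrite -lecRE rmorphD /= -!cabsE ler_normD. Qed.

Lemma cabsB c d : cabs (c - d) <= cabs c + cabs d.
Proof. by rewrite -lecRE rmorphD /= -!cabsE ler_normB. Qed.

Lemma cabsN c : cabs (- c) = cabs c.
Proof. by apply: realcI; rewrite -!cabsE normrN. Qed.

Lemma cabsM c d : cabs (c * d) = cabs c * cabs d.
Proof. by apply: realcI; rewrite rmorphM /= -!cabsE normrM. Qed.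

Lemma cabsX c n : cabs (c ^+ n) = cabs c ^+ n.
Proof. by apply: realcI; rewrite rmorphXn /= -!cabsE normrX. Qed.

Lemma cabs_conj c : cabs (c^*) = cabs c.
Proof. by apply: realcI; rewrite -!cabsE norm_conjC. Qed.

Lemma invc_nat n : n%:R^-1 = (n%:R^-1)%:C%C :> R[i].
Proof. by rewrite -[RHS]/(real_complex R _) fmorphV rmorph_nat. Qed.
Lemma realcM r r' : (r * r')%:C%C = r%:C%C * r'%:C%C :> R[i].
Proof. exact: rmorphM. Qed.
Lemma realcX r n : (r ^+ n)%:C%C = r%:C%C ^+ n :> R[i].
Proof. exact: rmorphXn. Qed.
Lemma realcD r r' : (r + r')%:C%C = r%:C%C + r'%:C%C :> R[i].
Proof. exact: rmorphD. Qed.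
Lemma realcN r : (- r)%:C%C = - r%:C%C :> R[i].
Proof. exact: rmorphN. Qed.
Lemma realc_nat n : n%:R%:C%C = n%:R :> R[i].
Proof. exact: rmorph_nat. Qed.
Lemma conjcM c d : (c * d)^* = c^* * d^*. Proof. exact: rmorphM. Qed.
Lemma conjcD c d : (c + d)^* = c^* + d^*. Proof. exact: rmorphD. Qed.
Lemma conjcN c : (- c)^* = - c^*. Proof. exact: rmorphN. Qed.
Lemma conjc_sum (I : Type) (s : seq I) (P : pred I) (F : I -> R[i]) :
  (\sum_(i <- s | P i) F i)^* = \sum_(i <- s | P i) (F i)^*.
Proof. exact: rmorph_sum. Qed.

Lemma cabs_real r : cabs (r%:C%C) = `|r|.
Proof. by apply: realcI; rewrite -cabsE normc_def /= expr0n addr0 sqrtr_sqr. Qed.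

Lemma cabs_i : cabs 'i = 1.
Proof. by apply: realcI; rewrite -cabsE normCi. Qed.

Lemma cabs_ge0_id c : 0 <= c -> c = (cabs c)%:C%C.
Proof. by move=> c0; rewrite -cabsE ger0_norm. Qed.

Lemma cabs_eq0 c : (cabs c == 0) = (c == 0).
Proof. by rewrite -(normr_eq0 c) cabsE -[0 in RHS]/(0%:C%C) (inj_eq (@complexI _)). Qed.

Lemma cabsV c : cabs (c^-1) = (cabs c)^-1.
Proof.
apply: realcI; rewrite -cabsE normfV cabsE.
by rewrite -[(_ ^-1)%:C%C]/(real_complex R _) fmorphV.
Qed.

Lemma ReD c d : complex.Re (c + d) = complex.Re c + complex.Re d.
Proof. by case: c; case: d. Qed.
Lemma ReN c : complex.Re (- c) = - complex.Re c.
Proof. by case: c. Qed.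
Lemma ReB c d : complex.Re (c - d) = complex.Re c - complex.Re d.
Proof. by rewrite ReD ReN. Qed.
Lemma ReZ r c : complex.Re (r%:C%C * c) = r * complex.Re c.
Proof. by case: c => a b /=; rewrite mul0r subr0. Qed.

Lemma Re_le_cabs c : complex.Re c <= cabs c.
Proof.
case: c => a b; rewrite /cabs normc_def /=.
apply: le_trans (ler_norm _) _.
by rewrite -sqrtr_sqr ler_wsqrtr // lerDl sqr_ge0.
Qed.

Lemma conj_real r : (r%:C%C)^* = r%:C%C :> R[i].
Proof. by apply/conj_Creal; rewrite complex_real. Qed.

Lemma cabs_sqr c : (cabs c ^+ 2)%:C%C = c^* * c.
Proof. by rewrite rmorphXn /= -cabsE normCK mulrC. Qed.

Lemma cabs_sum (I : Type) (s : seq I) (P : pred I) (F : I -> R[i]) :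
  cabs (\sum_(i <- s | P i) F i) <= \sum_(i <- s | P i) cabs (F i).
Proof.
elim/big_ind2 : _ => //; first by rewrite cabs0.
by move=> x r y r' xr yr'; apply: (le_trans (cabsD _ _)); apply: lerD.
Qed.

Section Nrm.
Context (V : normedModType R[i]).
Implicit Types x y : V.
Lemma nrm_ge0 x : 0 <= nrm x. Proof. by have := normr_ge0 x; rewrite nrmE -[0]/(0%:C%C) lecRE. Qed.
Lemma nrm0 : nrm (0 : V) = 0. Proof. by rewrite /nrm normr0. Qed.
Lemma nrmD x y : nrm (x + y) <= nrm x + nrm y.
Proof. by rewrite -lecRE rmorphD /= -!nrmE ler_normD. Qed.
Lemma nrmN x : nrm (- x) = nrm x. Proof. by rewrite /nrm normrN. Qed.
Lemma nrmB x y : nrm (x - y) <= nrm x + nrm y.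
Proof. by rewrite -(nrmN y) nrmD. Qed.
Lemma nrmZ c x : nrm (c *: x) = cabs c * nrm x.
Proof. by apply: realcI; rewrite rmorphM /= -nrmE normrZ cabsE nrmE. Qed.
Lemma nrm_eq0 x : (nrm x == 0) = (x == 0).
Proof. by rewrite -(normr_eq0 x) nrmE -[0 in RHS]/(0%:C%C) (inj_eq (@complexI _)). Qed.
Lemma nrm_sum (I : Type) (s : seq I) (P : pred I) (F : I -> V) :
  nrm (\sum_(i <- s | P i) F i) <= \sum_(i <- s | P i) nrm (F i).
Proof.
elim/big_ind2 : _ => //; first by rewrite nrm0.
by move=> x r y r' xr yr'; apply: (le_trans (nrmD _ _)); apply: lerD.
Qed.
End Nrm.

Lemma nrmc c : nrm (c : R[i]^o) = cabs c. Proof. by []. Qed.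

End Modulus.

Definition lin (R : realType) (V : lmodType R[i]) (L : V -> R[i]) : Prop :=
  forall c x y, L (c *: x + y) = c * L x + L y.

Section Lin.
Context (R : realType) (V : lmodType R[i]) (L : V -> R[i]).
Hypothesis LL : lin L.
Lemma lin0 : L 0 = 0.
Proof.
by have := LL 1 0 0; rewrite scaler0 addr0 mul1r -{1}[L 0]addr0 => /addrI.
Qed.
Lemma linZ c x : L (c *: x) = c * L x.
Proof. by rewrite -[c *: x]addr0 LL lin0 addr0. Qed.
Lemma linD x y : L (x + y) = L x + L y.
Proof. by rewrite -[x]scale1r LL mul1r scale1r. Qed.
Lemma linN x : L (- x) = - L x.
Proof. by rewrite -scaleN1r linZ mulN1r. Qed.
Lemma linB x y : L (x - y) = L x - L y.
Proof. by rewrite linD linN. Qed.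
Lemma lin_sum (I : Type) (s : seq I) (P : pred I) (F : I -> V) :
  L (\sum_(i <- s | P i) F i) = \sum_(i <- s | P i) L (F i).
Proof. by elim/big_rec2 : _ => [|i x y _ <-]; rewrite ?lin0 ?linD. Qed.
End Lin.

(** * Positivity in unital algebras with a C*-seminorm *)

Record unital_cstar (R : realType) (U : algType R[i]) (st : U -> U)
    (nu : U -> R) : Prop := UnitalCstar {
  ust_K : involutive st;
  ust_anti : forall c x y, st (c *: x + y) = c^* *: st x + st y;
  ustM : forall x y, st (x * y) = st y * st x;
  unuD : forall x y, nu (x + y) <= nu x + nu y;
  unuZ : forall c x, nu (c *: x) = cabs c * nu x;
  unuM : forall x y, nu (x * y) <= nu x * nu y;
  unuC : forall x, nu (st x * x) = nu x ^+ 2;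
  unu1 : nu 1 = 1 }.

Section Unital.
Context (R : realType) (U : algType R[i]) (st : U -> U) (nu : U -> R).
Hypothesis H : unital_cstar st nu.
Implicit Types (x y h : U) (r c : R).

Let stK := ust_K H.
Let nuD := unuD H.
Let nuZ := unuZ H.
Let nuM := unuM H.
Let nuC := unuC H.
Let nu1 := unu1 H.

Definition rs r : U := (r%:C%C)%:A.

Lemma rsD r c : rs (r + c) = rs r + rs c.
Proof. by rewrite /rs rmorphD /= scalerDl. Qed.
Lemma rs1 : rs 1 = 1. Proof. by rewrite /rs scale1r. Qed.
Lemma rs0 : rs 0 = 0. Proof. by rewrite /rs scale0r. Qed.
Lemma rsZ r c : r%:C%C *: rs c = rs (r * c).
Proof. by rewrite /rs scalerA -rmorphM. Qed.

Lemma nuZr r x : 0 <= r -> nu (r%:C%C *: x) = r * nu x.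
Proof. by move=> r0; rewrite nuZ cabs_real ger0_norm. Qed.
Lemma nu_rs r : 0 <= r -> nu (rs r) = r.
Proof. by move=> r0; rewrite nuZr // nu1 mulr1. Qed.
Lemma nuN x : nu (- x) = nu x.
Proof. by rewrite -scaleN1r nuZ cabsN cabs1 mul1r. Qed.
Lemma nu0 : nu 0 = 0.
Proof. by rewrite -(scale0r 0) nuZ cabs0 mul0r. Qed.
Lemma nuB x y : nu (x - y) <= nu x + nu y.
Proof. by rewrite -(nuN y). Qed.
Lemma nu_ge0 x : 0 <= nu x.
Proof. by have := nuB x x; rewrite subrr nu0; lra. Qed.
Lemma nuX x n : nu (x ^+ n) <= nu x ^+ n.
Proof.
elim: n => [|n IHn]; first by rewrite !expr0 nu1.
by rewrite !exprS (le_trans (nuM _ _)) // ler_wpM2l // nu_ge0.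
Qed.
Lemma nu_sum (I : Type) (s : seq I) (P : pred I) (F : I -> U) :
  nu (\sum_(i <- s | P i) F i) <= \sum_(i <- s | P i) nu (F i).
Proof.
elim/big_ind2 : _ => //; first by rewrite nu0.
by move=> x r y r' xr yr'; apply: (le_trans (nuD _ _)); apply: lerD.
Qed.

Lemma st0 : st 0 = 0.
Proof.
have := ust_anti H 1 0 0; rewrite scaler0 addr0 conjC1 scale1r.
by rewrite -{1}[st 0]addr0 => /addrI.
Qed.
Lemma stZ (c : R[i]) x : st (c *: x) = c^* *: st x.
Proof. by rewrite -[c *: x]addr0 (ust_anti H) st0 addr0. Qed.
Lemma stD x y : st (x + y) = st x + st y.
Proof. by rewrite -[x]scale1r (ust_anti H) conjC1 !scale1r. Qed.
Lemma stN x : st (- x) = - st x.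
Proof. by rewrite -scaleN1r stZ rmorphN rmorph1 scaleN1r. Qed.
Lemma stB x y : st (x - y) = st x - st y.
Proof. by rewrite stD stN. Qed.
Lemma st1 : st 1 = 1.
Proof.
have := ustM H (st 1) 1; rewrite mulr1 stK => e; rewrite [RHS]e.
by rewrite mulr1.
Qed.
Lemma st_rs r : st (rs r) = rs r.
Proof. by rewrite /rs stZ st1 conj_real. Qed.

Lemma nu_st x : nu (st x) = nu x.
Proof.
have le y : nu y <= nu (st y).
  have := nuM (st y) y; rewrite nuC expr2 => le.
  have [y0|y0] := ltP 0 (nu y); last by rewrite (le_trans y0) // nu_ge0.
  by rewrite -(ler_pM2r y0).
by apply/eqP; rewrite eq_le le andbT -{2}[x]stK le.
Qed.

Lemma nu_sq h : st h = h -> nu (h * h) = nu h ^+ 2.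
Proof. by move=> hh; rewrite -{1}hh nuC. Qed.

Lemma nu_pow2 h k : st h = h -> nu (h ^+ (2 ^ k)) = nu h ^+ (2 ^ k).
Proof.
move=> hh; elim: k => [|k IHk]; first by rewrite expn0 !expr1.
have sk m : st (h ^+ m) = h ^+ m.
  elim: m => [|m IHm]; first by rewrite expr0 st1.
  by rewrite exprS (ustM H) IHm hh -exprSr exprS.
by rewrite expnS mulnC !exprM !expr2 nu_sq ?sk // IHk expr2.
Qed.

(** Evaluation of real polynomials at [h]: identities between commuting elements
    become identities in the commutative ring [{poly R}]. *)
Definition er h : {poly R} -> U := horner_alg h \o map_poly (real_complex R).

Lemma erD h p q : er h (p + q) = er h p + er h q.
Proof. by rewrite /er /= !rmorphD. Qed.
Lemma erN h p : er h (- p) = - er h p.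
Proof. by rewrite /er /= !rmorphN. Qed.
Lemma erB h p q : er h (p - q) = er h p - er h q.
Proof. by rewrite /er /= !rmorphB. Qed.
Lemma erM h p q : er h (p * q) = er h p * er h q.
Proof. by rewrite /er /= !rmorphM. Qed.
Lemma er1 h : er h 1 = 1.
Proof. by rewrite /er /= !rmorph1. Qed.
Lemma erX h : er h 'X = h.
Proof. by rewrite /er /= map_polyX horner_algX. Qed.
Lemma erXn h p n : er h (p ^+ n) = er h p ^+ n.
Proof. by rewrite /er /= !rmorphXn. Qed.
Lemma erC h r : er h r%:P = rs r.
Proof. by rewrite /er /= map_polyC horner_algC. Qed.
Lemma erZ h r p : er h (r *: p) = r%:C%C *: er h p.
Proof. by rewrite -mul_polyC erM erC /rs -scalerAl mul1r. Qed.

Lemma st_er h p : st h = h -> st (er h p) = er h p.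
Proof.
move=> hh; elim/poly_ind: p => [|p r IHp].
  by rewrite -[0]/(0%:P) erC st_rs.
rewrite erD erM erX erC stD st_rs (ustM H) IHp hh; congr (_ + _).
by rewrite -{1 4}(erX h) -!erM mulrC.
Qed.

(** For a self-adjoint element of a C*-algebra this is the supremum of its
    spectrum; being an infimum of norms it makes sense without any spectral
    theory, and [nrg (- x) <= 0] expresses that [x] is positive. *)
Definition nrg x : R := inf [set nu (rs r + x) - r | r in [set r : R | 0 <= r]].

Let nrg_has_lb x :
  has_lbound [set nu (rs r + x) - r | r in [set r : R | 0 <= r]].
Proof.
exists (- nu x) => _ [r /= r0 <-].
have := nuD (rs r + x) (- x); rewrite addrK nu_rs // nuN; lra.
Qed.

Lemma nrg_le1 x r c : 0 <= r -> nu (rs r + x) <= r + c -> nrg x <= c.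
Proof.
move=> r0 le; apply: (@le_trans _ _ (nu (rs r + x) - r)); last by lra.
by apply: inf_lbound => //; exists r.
Qed.

Lemma nrg_le x c : (forall e, 0 < e -> exists2 r, 0 <= r & nu (rs r + x) <= r + (c + e)) ->
  nrg x <= c.
Proof.
move=> P; apply/ler_addgt0Pr => e e0; have [r r0 le] := P _ e0.
exact: nrg_le1 le.
Qed.

Lemma nrg_lt x c : nrg x < c ->
  exists2 r0, 0 <= r0 & forall r, r0 <= r -> nu (rs r + x) <= r + c.
Proof.
move=> ltc.
have ne : [set nu (rs r + x) - r | r in [set r : R | 0 <= r]] !=set0.
  by exists (nu (rs 0 + x) - 0); exists 0 => //=.
have [_ [r0 /= r00 <-] lt] := inf_lt ne ltc.
exists r0 => // r r0r.
have := nuD (rs (r - r0)) (rs r0 + x).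
rewrite addrA -rsD subrK nu_rs ?subr_ge0 //; lra.
Qed.

Lemma nrgP x c : nrg x <= c -> forall e, 0 < e ->
  exists2 r0, 0 <= r0 & forall r, r0 <= r -> nu (rs r + x) <= r + (c + e).
Proof. by move=> le e e0; apply: nrg_lt; lra. Qed.

Lemma nrg_nu x : nrg x <= nu x.
Proof. by apply: (@nrg_le1 _ 0) => //; rewrite rs0 !add0r. Qed.

Lemma nrgD x y : nrg (x + y) <= nrg x + nrg y.
Proof.
apply: nrg_le => e e0; have e2 : 0 < e / 2 by lra.
have [r r0 /(_ r (lexx _)) lex] := nrgP (lexx (nrg x)) e2.
have [r' r'0 /(_ r' (lexx _)) ley] := nrgP (lexx (nrg y)) e2.
exists (r + r'); first by lra.
by rewrite rsD addrACA (le_trans (nuD _ _)) //; lra.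
Qed.

Lemma nrgDle x y c d : nrg x <= c -> nrg y <= d -> nrg (x + y) <= c + d.
Proof. by move=> ? ?; apply: (le_trans (nrgD _ _)); apply: lerD. Qed.

Lemma nrg_rs r : nrg (rs r) <= r.
Proof.
apply: (@nrg_le1 _ `|r|) => //; rewrite -rsD nu_rs //.
by rewrite -lerBlDr sub0r; have := ler_norm (- r); rewrite normrN.
Qed.

Lemma nrgZ r x c : 0 <= r -> nrg x <= c -> nrg (r%:C%C *: x) <= r * c.
Proof.
rewrite le_eqVlt => /predU1P[<- _|r0 lec].
  by rewrite scale0r mul0r -rs0 nrg_rs.
apply: nrg_le => e e0; have e2 : 0 < e / r by rewrite divr_gt0.
have [m m0 /(_ m (lexx _)) le] := nrgP lec e2.
exists (r * m); first by rewrite mulr_ge0 // ltW.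
rewrite -rsZ -scalerDr (nuZr _ (ltW r0)).
rewrite (le_trans (ler_wpM2l (ltW r0) le)) // !mulrDr mulrCA divff ?gt_eqF //.
by rewrite mulr1 addrA.
Qed.

Lemma nrg_shift x r c : nrg x <= c -> nrg (x + rs r) <= c + r.
Proof. by move=> le; apply: nrgDle le (nrg_rs _). Qed.

(** With [P] = 2 k^2 - b^2 and [Q] = 2 k b, the element [w] = P + i Q has
    w^* w = P^2 + Q^2 = 4 k^4 + b^4, and [P] is the real part of [w]. *)
Lemma nu_sub_sq b k : st b = b ->
  nu (rs (2 * k ^+ 2) - b ^+ 2) ^+ 2 <= 4 * k ^+ 4 + nu b ^+ 4.
Proof.
move=> bb; set P := er b ((2 * k ^+ 2)%:P - 'X ^+ 2).
set Q := er b ((2 * k) *: 'X); set w := P + 'i *: Q.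
have sP : st P = P by exact: st_er.
have sQ : st Q = Q by exact: st_er.
have Pw : P = 2^-1 *: (w + st w).
  rewrite /w stD sP stZ sQ conjCi scaleNr addrACA subrr addr0 -mulr2n.
  by rewrite -[P *+ 2](scaler_nat (R:=R[i])) scalerA mulVf ?scale1r // pnatr_eq0.
have ww' : st w * w = P * P + Q * Q.
  rewrite /w stD sP stZ sQ conjCi mulrDl !mulrDr -!scalerAl -!scalerAr.
  have ii : - 'i * 'i = 1 :> R[i] by rewrite mulNr -expr2 sqrCi opprK.
  rewrite (scalerA (- 'i) 'i) ii scale1r -[Q * P]erM mulrC erM -/P -/Q.
  by rewrite scaleNr addrA addrK.
have ww : st w * w = rs (4 * k ^+ 4) + b ^+ 4.
  rewrite ww' -!erM -erD.
  have -> : b ^+ 4 = er b ('X ^+ 4) by rewrite erXn erX.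
  rewrite -(erC b) -erD; congr (er b _).
  by rewrite -mul_polyC !(polyCM, polyC_exp, polyC_natr); ring.
have -> : rs (2 * k ^+ 2) - b ^+ 2 = P by rewrite /P erB erC erXn erX.
have le : nu P <= nu w.
  rewrite Pw nuZ invc_nat cabs_real ger0_norm; last by lra.
  by have := nuD w (st w); rewrite nu_st; lra.
have nP := nu_ge0 P.
apply: (@le_trans _ _ (nu w ^+ 2)); first by rewrite ler_pXn2r // nnegrE // nu_ge0.
rewrite -nuC ww (le_trans (nuD _ _)) // nu_rs; last first.
  by rewrite mulr_ge0 // exprn_even_ge0.
by rewrite lerD2l nuX.
Qed.

(** The square root of 4 k^4 + nu b^4 exceeds 2 k^2 by an amount that tends to 0
    as k grows, so [nu_sub_sq] makes the infimum defining [nrg] nonpositive. *)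
Lemma nrg_sq b : st b = b -> nrg (- b ^+ 2) <= 0.
Proof.
move=> bb; apply: nrg_le => e e0; rewrite add0r.
set d := e^-1; have ed : e * d = 1 by rewrite divff // gt_eqF.
have d0 : 0 < d by rewrite invr_gt0.
set k := nu b ^+ 2 * (d + 1).
have r0 : 0 <= 2 * k ^+ 2 by rewrite mulr_ge0 // sqr_ge0.
exists (2 * k ^+ 2) => //.
rewrite -(@ler_pXn2r _ 2) // ?nnegrE ?nu_ge0 //; last by rewrite addr_ge0 // ltW.
apply: (le_trans (nu_sub_sq k bb)).
have n0 : 0 <= nu b ^+ 4 by rewrite exprn_even_ge0.
suff : nu b ^+ 4 <= 4 * k ^+ 2 * e by nra.
have -> : 4 * k ^+ 2 * e = 4 * (nu b ^+ 4) * (d * (e * d) + 2 * (e * d) + e) by rewrite /k; ring.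
by rewrite ed; nra.
Qed.

Lemma nrg_sqr h p : st h = h -> nrg (er h (- p ^+ 2)) <= 0.
Proof. by move=> hh; rewrite erN erXn; apply: nrg_sq; apply: st_er. Qed.

Lemma expr1D_le (x : R) n : 0 <= x -> (1 + x) ^+ n * (1 - n%:R * x) <= 1.
Proof.
move=> x0; elim: n => [|n IHn]; first by rewrite expr0 mul0r subr0 mulr1.
apply: le_trans IHn; rewrite exprSr -mulrA ler_wpM2l //.
  by rewrite exprn_ge0 // addr_ge0.
have n0 : 0 <= n%:R :> R by [].
by rewrite -natr1; nra.
Qed.

(** Four times the indicator of k = 1 mod 4 (discrete Fourier inversion over the
    fourth roots of unity). Weighting the four powers (1 + i^j t h)^n by these
    roots extracts the part of degree 1, 5, 9, ... of (1 + t h)^n. *)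
Definition root_filter k : R[i] := 1 - 'i * 'i ^+ k - (-1) ^+ k + 'i * (- 'i) ^+ k.

Lemma root_filter_abs k : cabs (root_filter k) <= 4.
Proof.
rewrite /root_filter; have := @cabs_i R; move: ('i) => u u1.
have E (v : R[i]) l : cabs v = 1 -> cabs (v ^+ l) = 1 by move=> v1; rewrite cabsX v1 expr1n.
have uN : cabs (- u) = 1 by rewrite cabsN.
have m1 : cabs (-1 : R[i]) = 1 by rewrite cabsN cabs1.
have E1 : cabs (u * u ^+ k) = 1 by rewrite cabsM u1 E ?mulr1.
have E2 : cabs (u * (- u) ^+ k) = 1 by rewrite cabsM u1 E ?mulr1.
have E3 := E _ k m1; have E4 := @cabs1 R.
move: (u * u ^+ k) (u * (- u) ^+ k) ((-1) ^+ k) E1 E2 E3 => a b c E1 E2 E3.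
have := cabsD (1 - a - c) b; have := cabsB (1 - a) c; have := cabsB 1 a.
rewrite E1 E2 E3 E4; move: (cabs _) (cabs _) (cabs _) => x y z.
lra.
Qed.

Lemma root_filter_small : [/\ root_filter 0 = 0, root_filter 1 = 4, root_filter 2 = 0, root_filter 3 = 0 & root_filter 4 = 0].
Proof.
have i2 : 'i * 'i = -1 :> R[i] by rewrite -expr2 sqrCi.
have G (K : comNzRingType) (u : K) : u * u = -1 ->
    let f k := 1 - u * u ^+ k - (-1) ^+ k + u * (- u) ^+ k in
    [/\ f 0%N = 0, f 1%N = 4, f 2%N = 0, f 3%N = 0 & f 4%N = 0].
  by move=> e /=; split; ring: e.
exact: G i2.
Qed.

Definition binom_term n (t : R) k : R := 'C(n, k)%:R * t ^+ k.

Lemma binom_termS n t k : binom_term n t k.+1 * k.+1%:R = binom_term n t k * ((n - k)%N%:R * t).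
Proof.
rewrite /binom_term mulrAC -natrM mulnC mul_bin_left natrM exprSr; ring.
Qed.

(** For n t = 3/2 the binomial terms are dominated by those of exp(3/2), and from
    degree 5 on their ratio is at most 1/4. The induction carries the geometric
    tail 4/3 times the next term. *)
Lemma binom_tail n t m : (0 < n)%N -> t = 3 / 2 / n%:R ->
  \sum_(0 <= k < m) binom_term n t (k + 5) + 4 / 3 * binom_term n t (m + 5) <= 9 / 100 * (1 + 1/100).
Proof.
move=> n0 et; have nt : n%:R * t = 3 / 2.
  by rewrite et mulrCA divff ?mulr1 // pnatr_eq0 -lt0n.
have t0 : 0 <= t by rewrite et !divr_ge0.
have b0 k : 0 <= binom_term n t k by rewrite mulr_ge0 ?exprn_ge0.
have bS k : binom_term n t k.+1 * k.+1%:R <= binom_term n t k * (3 / 2).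
  by rewrite binom_termS ler_wpM2l // -nt ler_wpM2r // ler_nat leq_subr.
elim: m => [|m IHm].
  rewrite big_geq // add0r add0n.
  have := bS 0%N; have := bS 1%N; have := bS 2%N; have := bS 3%N; have := bS 4%N.
  have -> : binom_term n t 0 = 1 by rewrite /binom_term bin0 mul1r expr0.
  by have := b0 1%N; have := b0 2%N; have := b0 3%N; have := b0 4%N; have := b0 5%N; lra.
apply: le_trans IHm; rewrite big_nat_recr //= addSn.
have := bS (m + 5)%N; have := b0 (m + 5)%N; have := b0 (m + 5).+1.
have : 6 <= (m + 5).+1%:R :> R by rewrite ler_nat -addnS leq_addl.
set u := binom_term _ _ _; set v := binom_term _ _ _ => w6 u0 v0 le.
have : u * 6 <= u * (m + 5).+1%:R by rewrite ler_wpM2l.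
by lra.
Qed.

Lemma nu_pow_le x (a : R) n : 0 <= a -> nu x <= 1 + a -> n%:R * a <= 3/20 ->
  nu (x ^+ n) <= 6/5.
Proof.
move=> a0 le na; apply: (le_trans (nuX _ _)).
apply: (@le_trans _ _ ((1 + a) ^+ n)).
  by rewrite lerXn2r // nnegrE ?nu_ge0 // addr_ge0.
have := expr1D_le n a0; have : 0 <= (1 + a) ^+ n by rewrite exprn_ge0 // addr_ge0.
by move: (_ ^+ n) (_ * a) na => X y; nra.
Qed.

(** With n t = 3/2, each of the powers (1 + i^j t h)^n has norm at most 6/5: for
    j even because the numerical range of [h] is small, for j odd because
    1 + t^2 h^2 has norm at most 1 + t^2. The filtered sum of the four powers is
    4 n t h = 6 h up to a tail smaller than 1, which contradicts [nu h] = 1. *)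
Lemma nrg_normalized h : st h = h -> nu h = 1 -> nrg h < 1/10 -> nrg (- h) < 1/10 -> False.
Proof.
move=> hh h1 /nrg_lt[r1 r10 P1] /nrg_lt[r2 r20 P2].
pose n := (Num.truncn (2 * (r1 + r2 + 50))).+1.
have n_ge : 2 * (r1 + r2 + 50) <= n%:R by rewrite ltW // truncnS_gt.
have n0 : (0 < n)%N by [].
have n00 : 0 < n%:R :> R by rewrite ltr0n.
set t : R := 3 / 2 / n%:R.
have nt : n%:R * t = 3 / 2 by rewrite /t mulrCA divff ?mulr1 // gt_eqF.
have t0 : 0 <= t by rewrite /t !divr_ge0.
have tr : t^-1 = 2 / 3 * n%:R by rewrite /t !invfM !invrK; ring.
have t_gt0 : 0 < t by rewrite /t !divr_gt0.
have scl y : (forall r, t^-1 <= r -> nu (rs r + y) <= r + 1/10) ->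
    nu (1 + t%:C%C *: y) <= 1 + t / 10.
  move=> /(_ _ (lexx _)) le.
  have -> : 1 + t%:C%C *: y = t%:C%C *: (rs t^-1 + y).
    by rewrite scalerDr rsZ divff ?gt_eqF // rs1.
  rewrite (nuZr _ t0) (le_trans (ler_wpM2l t0 le)) // mulrDr divff ?gt_eqF //.
  by rewrite div1r.
have up : nu (1 + t%:C%C *: h) <= 1 + t / 10.
  by apply: scl => r ler; apply: P1; lra.
have um : nu (1 + (- t%:C%C) *: h) <= 1 + t / 10.
  by rewrite scaleNr -scalerN; apply: scl => r ler; apply: P2; lra.
have t2 : n%:R * t ^+ 2 <= 3 / 20.
  rewrite expr2 mulrA nt; suff : t <= 1/10 by lra.
  rewrite -[leLHS]invrK tr invf_ple ?posrE //; last by lra.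
  rewrite mul1r invrK.
  by lra.
have ui s : s = 'i \/ s = - 'i -> nu (1 + (s * t%:C%C) *: h) <= 1 + t ^+ 2.
  move=> si; rewrite -(@ler_pXn2r _ 2) // ?nnegrE ?nu_ge0 ?addr_ge0 ?sqr_ge0 //.
  have s1 : s^* = - s by case: si => ->; [exact: conjCi|by rewrite opprK -conjCi conjCK].
  have s2 : s * s = -1.
    by case: si => ->; [rewrite -expr2 sqrCi|rewrite mulrNN -expr2 sqrCi].
  rewrite -nuC stD st1 stZ hh conjcM s1 conj_real mulrDl !mulrDr mul1r mulr1.
  rewrite mul1r -scalerAl -scalerAr scalerA mulNr scaleNr addrA addrK.
  rewrite mulNr mulrACA s2 mulN1r opprK -rmorphM /=.
  apply: (le_trans (nuD _ _)); rewrite nu1 nuZr ?mulr_ge0 // nu_sq // h1.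
  by rewrite expr1n mulr1 -expr2; nra.
pose g k := ((root_filter k * (binom_term n t k)%:C%C) *: h ^+ k).
have sumE : \sum_(0 <= k < n.+1) g k =
   (1 + t%:C%C *: h) ^+ n - 'i *: (1 + ('i * t%:C%C) *: h) ^+ n
   - (1 + (- t%:C%C) *: h) ^+ n + 'i *: (1 + (- 'i * t%:C%C) *: h) ^+ n.
  have E (c : R[i]) : (1 + (c * t%:C%C) *: h) ^+ n =
      \sum_(0 <= k < n.+1) (c ^+ k * (binom_term n t k)%:C%C) *: h ^+ k.
    rewrite big_mkord exprDn_comm; last exact: commr_sym (commr1 _).
    apply: eq_bigr => k _; rewrite expr1n mul1r exprZn -scaler_nat scalerA.
    congr (_ *: _); rewrite /binom_term exprMn mulrCA; congr (_ * _).
    by rewrite realcM realcX realc_nat.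
  have := E 1; have := E (-1); rewrite mul1r mulN1r => -> ->.
  rewrite (E 'i) (E (- 'i)) !scaler_sumr -!sumrB -big_split /=.
  apply: eq_bigr => k _; rewrite /g /root_filter !scalerA -!scalerBl -scalerDl expr1n.
  by congr (_ *: _); ring.
have nuS : nu (\sum_(0 <= k < n.+1) g k) <= 24 / 5.
  have t10 : 0 <= t / 10 by lra.
  have A := nu_pow_le t10 up; have B := nu_pow_le t10 um.
  have C := nu_pow_le (sqr_ge0 t) (ui 'i (or_introl erefl)) t2.
  have D := nu_pow_le (sqr_ge0 t) (ui (- 'i) (or_intror erefl)) t2.
  have nt10 : n%:R * (t / 10) <= 3 / 20 by rewrite mulrA nt; lra.
  rewrite sumE (le_trans (nuD _ _)) // nuZ cabs_i mul1r.
  have := nuB ((1 + t%:C%C *: h) ^+ n - 'i *: (1 + ('i * t%:C%C) *: h) ^+ n)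
     ((1 + (- t%:C%C) *: h) ^+ n).
  have := nuB ((1 + t%:C%C *: h) ^+ n) ('i *: (1 + ('i * t%:C%C) *: h) ^+ n).
  rewrite nuZ cabs_i mul1r; have := A n nt10; have := B n nt10.
  by move: C D; move: (nu _) (nu _) (nu _) (nu _) (nu _) (nu _) => *; lra.
have n5 : (5 <= n)%N.
  by rewrite -(ler_nat R) (le_trans _ n_ge) //; lra.
have [f0 f1 f2 f3 f4] := root_filter_small.
have S5 m : \sum_(0 <= k < m + 5) g k = (6%:R)%:C%C *: h + \sum_(0 <= k < m) g (k + 5)%N.
  elim: m => [|m IHm].
    rewrite [in RHS]big_geq // addr0 add0n !big_nat_recr //= big_geq // add0r.
    rewrite /g f0 f1 f2 f3 f4 !mul0r !scale0r !add0r !addr0 expr1; congr (_ *: _).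
    rewrite /binom_term bin1 expr1 nt -[4]/(4%:R) -(rmorph_nat (real_complex R)) -rmorphM /=.
    by congr (_%:C)%C; lra.
  by rewrite addSn big_nat_recr //= IHm big_nat_recr //= addrA.
have nn : (n.+1 = (n - 4) + 5)%N by rewrite addnS subnK // ltnW.
have := binom_tail (n - 4) n0 erefl; rewrite -/t.
have b0 : 0 <= binom_term n t (n - 4 + 5) by rewrite mulr_ge0 ?exprn_ge0.
have : nu (\sum_(0 <= k < n - 4) g (k + 5)%N) <= 4 * \sum_(0 <= k < n - 4) binom_term n t (k + 5).
  apply: (le_trans (nu_sum _ _ _)); rewrite mulr_sumr; apply: ler_sum => k _.
  have bk : 0 <= binom_term n t (k + 5) by rewrite mulr_ge0 ?exprn_ge0.
  rewrite nuZ cabsM cabs_real ger0_norm // -mulrA ler_pM ?cabs_ge0 ?root_filter_abs //.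
    by rewrite mulr_ge0 // nu_ge0.
  by rewrite ler_piMr // (le_trans (nuX _ _)) // h1 expr1n.
have := nuB (\sum_(0 <= k < n.+1) g k) (\sum_(0 <= k < n - 4) g (k + 5)%N).
rewrite nn S5 addrK (nuZr _ (ler0n _ _)) h1 mulr1; move: nuS; rewrite nn S5.
by move: b0; clear; move=> *; lra.
Qed.

(** The numerical range controls the norm of a self-adjoint element. The optimal
    constant is 1; any constant is enough, because every use is followed by a
    passage to powers. *)
Lemma nu_le_nrg h c : st h = h -> 0 <= c -> nrg h <= c -> nrg (- h) <= c -> nu h <= 11 * c.
Proof.
move=> hh c0 le1 le2; rewrite leNgt; apply/negP => lt.
have a0 : 0 < nu h by lra.
set a := nu h in lt a0.
have ia : 0 <= a^-1 by rewrite invr_ge0 ltW.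
have ca : a^-1 * c < 1/10 by rewrite mulrC ltr_pdivrMr //; lra.
apply: (@nrg_normalized (a^-1%:C%C *: h)).
- by rewrite stZ conj_real hh.
- by rewrite nuZr // mulVf // gt_eqF.
- by rewrite (le_lt_trans (nrgZ ia le1)).
- by rewrite -scalerN (le_lt_trans (nrgZ ia le2)).
Qed.

Lemma exprS_conj x y n : (1 + x * y) ^+ n * x = x * (1 + y * x) ^+ n.
Proof.
elim: n => [|n IHn]; first by rewrite !expr0 mul1r mulr1.
have e : (1 + x * y) * x = x * (1 + y * x) by rewrite mulrDl mulrDr mul1r mulr1 mulrA.
by rewrite exprSr -mulrA e mulrA IHn -mulrA -exprSr.
Qed.

Lemma expr_swap x y n :
  (1 + x * y) ^+ n = 1 + x * (\sum_(0 <= k < n) (1 + y * x) ^+ k) * y.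
Proof.
elim: n => [|n IHn]; first by rewrite big_geq // mulr0 mul0r addr0 expr0.
rewrite exprSr mulrDr mulr1 {1}IHn big_nat_recr //= mulrDr mulrDl addrA.
by rewrite mulrA exprS_conj.
Qed.

(** The principle behind every removal of a constant: a number whose powers grow
    at most linearly is at most 1, by the inequality of Bernoulli. *)
Lemma pow2_le1 (a K : R) : (forall k : nat, a ^+ (2 ^ k) <= 1 + (2 ^ k)%:R * K) -> a <= 1.
Proof.
move=> P; rewrite leNgt; apply/negP => a1; pose d := a - 1.
have d0 : 0 < d by rewrite subr_gt0.
have bern n : 1 + n%:R * d <= a ^+ n.
  elim: n => [|n IHn]; first by rewrite mul0r addr0 expr0.
  rewrite exprS (_ : a = 1 + d); last by rewrite /d addrC subrK.
  have : 0 <= n%:R :> R by [].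
  move: IHn; rewrite (_ : a = 1 + d); last by rewrite /d addrC subrK.
  by rewrite -natr1; move: (_ ^+ n) n%:R => X Y; nra.
pose k := (Num.truncn ((1 + `|K|) * 4 / (d ^+ 2))).+1.
have kK : (1 + `|K|) * 4 < k%:R * d ^+ 2.
  by rewrite -ltr_pdivrMr ?exprn_gt0 // truncnS_gt.
have := P k.+1; rewrite expnS mulnC exprM expr2.
have := bern (2 ^ k)%N; have k2 : k%:R <= (2 ^ k)%:R :> R.
  by rewrite ler_nat ltnW // ltn_expl.
have k1 : 1 <= (2 ^ k)%:R :> R by rewrite ler1n expn_gt0.
rewrite natrM; move: ((2 ^ k)%:R) (a ^+ _) k1 k2 => N X N1 kN b1 b2.
have L0 := normr_ge0 K.
have := ler_norm K; move: L0 kK; set L := `|K| => L0 kK KL.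
have Nd0 : 0 <= N * d by rewrite mulr_ge0 //; lra.
have h1 : (N * d) ^+ 2 <= X * X by rewrite expr2 ler_pM //; lra.
have h2 : (1 + L) * 4 < N * d ^+ 2.
  apply: lt_le_trans kK _; rewrite ler_wpM2r // exprn_ge0 ?ltW //.
have h3 : N * ((1 + L) * 4) < N * (N * d ^+ 2) by rewrite ltr_pM2l //; lra.
have h4 : N * K <= N * L by rewrite ler_wpM2l //; lra.
have h5 : N * (N * d ^+ 2) = (N * d) ^+ 2 by ring.
have h6 : 0 <= N * L by rewrite mulr_ge0 //; lra.
lra.
Qed.

(** 1 + t y y^* and 1 + t y^* y have powers that differ by a factor polynomial in
    the exponent ([expr_swap]), hence the same norm as soon as it is at least 1. *)
Lemma nu_swap y (t : R) :
  nu (1 + t%:C%C *: (y * st y)) <= Num.max 1 (nu (1 + t%:C%C *: (st y * y))).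
Proof.
set c := Num.max _ _; have c1 : 1 <= c by rewrite le_max lexx.
have cc : nu (1 + t%:C%C *: (st y * y)) <= c by rewrite le_max lexx orbT.
have c0 : 0 < c by lra.
have sy : st (1 + t%:C%C *: (y * st y)) = 1 + t%:C%C *: (y * st y).
  by rewrite stD st1 stZ conj_real (ustM H) stK.
rewrite -[leRHS]mul1r -ler_pdivrMr //.
apply: (@pow2_le1 _ (`|t| * nu y * nu y)) => k; rewrite expr_div_n -nu_pow2 //.
rewrite ler_pdivrMr ?exprn_gt0 // scalerAr expr_swap.
set n := (2 ^ k)%N.
have -> : t%:C%C *: st y * y = t%:C%C *: (st y * y) by rewrite -scalerAl.
apply: (le_trans (nuD _ _)); rewrite nu1 mulrDl mul1r.
apply: lerD; first by rewrite exprn_ege1.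
apply: (le_trans (nuM _ _)); rewrite nuZ cabs_real nu_st.
have S : nu (\sum_(0 <= i < n) (1 + t%:C%C *: (st y * y)) ^+ i) <= n%:R * c ^+ n.
  apply: (le_trans (nu_sum _ _ _)).
  apply: (@le_trans _ _ (\sum_(0 <= i < n) c ^+ n)); last first.
    by rewrite sumr_const_nat subn0 -[X in X <= _]mulr_natl.
  rewrite big_nat_cond [leRHS]big_nat_cond; apply: ler_sum => i /andP[/andP[_ ilt] _].
  apply: (le_trans (nuX _ _)); apply: (@le_trans _ _ (c ^+ i)).
    by rewrite lerXn2r // nnegrE ?nu_ge0 // ltW.
  by rewrite ler_weXn2l // ltnW.
have := nuM y (\sum_(0 <= i < n) (1 + t%:C%C *: (st y * y)) ^+ i).
move: S; set S := nu (\sum_(0 <= i < n) _); set T := nu (y * _) => Sle Tle.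
have y0 := nu_ge0 y; have t0 : 0 <= `|t| by [].
rewrite -!mulrA mulrA; have -> : n%:R * (`|t| * (nu y * (nu y * c ^+ n))) = nu y * (n%:R * c ^+ n) * (`|t| * nu y) by ring.
by rewrite -mulrA ler_wpM2r ?mulr_ge0 // (le_trans Tle) // ler_wpM2l.
Qed.

(** Positivity of y y^* and of y^* y are equivalent, since both are read off the
    norms of 1 - t y y^* and 1 - t y^* y. *)
Lemma nrg_swap y c : 0 <= c -> nrg (- (y * st y)) <= c -> nrg (- (st y * y)) <= c.
Proof.
move=> c0 le; apply: nrg_le => e e0.
have [r0 r00 /(_ _ (lexx _))] := nrgP le e0; rewrite /= => P.
set r := r0 + 1; have r1 : 0 < r by rewrite /r; lra.
have {}P : nu (rs r - y * st y) <= r + (c + e).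
  rewrite /r addrC rsD addrA; apply: (le_trans (nuD _ _)).
  by rewrite (nu_rs (_ : 0 <= 1)) // addrC; lra.
have scl z : rs r - z = r%:C%C *: (1 + (- r^-1)%:C%C *: z).
  rewrite scalerDr scalerA -rmorphM mulrN divff ?gt_eqF // rmorphN scaleN1r.
  by rewrite -rs1 rsZ mulr1.
exists r; first exact: ltW.
rewrite scl (nuZr _ (ltW r1)).
have := @nu_swap (st y) (- r^-1); rewrite stK => le2.
apply: (le_trans (ler_wpM2l (ltW r1) le2)).
rewrite (maxr_pMr _ _ (ltW r1)) ge_max mulr1; apply/andP; split; first lra.
by rewrite -(nuZr _ (ltW r1)) -scl.
Qed.

(** y y^* + y^* y is half the sum of the squares of y + y^* and i (y - y^* ), which
    are positive; so - y y^* is at most y^* y, and [nrg_swap] applies. *)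
Lemma nrg_star_le y : nrg (- (st y * y)) <= Num.max 0 (nrg (st y * y)).
Proof.
set c := Num.max _ _; have c0 : 0 <= c by rewrite le_max lexx.
apply: nrg_swap => //.
pose a := y + st y; pose b := 'i *: (y - st y).
have sa : st a = a by rewrite stD stK addrC.
have ci : - 'i * 'i = 1 :> R[i] by rewrite mulNr -expr2 sqrCi opprK.
have sb : st b = b by rewrite stZ stB stK conjCi scaleNr -scalerN opprB.
have E : - (y * st y) = st y * y + ((2^-1)%:C%C *: (- a ^+ 2) + (2^-1)%:C%C *: (- b ^+ 2)).
  rewrite -scalerDr -opprD.
  have -> : a ^+ 2 + b ^+ 2 = 2 *: (y * st y + st y * y).
    rewrite !expr2 /a /b -scalerAl -scalerAr scalerA.
    have -> : 'i * 'i = -1 :> R[i] by rewrite -expr2 sqrCi.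
    rewrite scaleN1r mulrDl mulrBl !mulrDr !mulrN (scaler_nat (R := R[i])) mulr2n.
    move: (y * y) (y * st y) (st y * y) (st y * st y) => u v w z.
    rewrite opprB opprB [w - z + _]addrC addrACA [u + v]addrC (addrACA v) subrr addr0.
    by rewrite (addrACA w) subrr addr0 addrACA.
  rewrite scalerN scalerA -invc_nat mulVf ?pnatr_eq0 // scale1r opprD addrCA subrr.
  by rewrite addr0.
have h0 : 0 <= 2^-1 :> R by lra.
rewrite E -[c]addr0; apply: nrgDle; first by rewrite le_max lexx orbT.
rewrite -[0]addr0; apply: nrgDle; rewrite -(mulr0 2^-1); apply: nrgZ => //; exact: nrg_sq.
Qed.

(** w^2 - w^4 is the sum of the squares (w^k - w^(k+2))^2 and of a remainder
    w^2k - w^(2k+2), which is small in norm when [nu w] <= 1/2. *)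
Lemma nrg_sub4 w : st w = w -> nu w <= 1/2 -> nrg (- (w ^+ 2 - w ^+ 4)) <= 0.
Proof.
move=> ww wn; apply/ler_addgt0Pr => e e0; rewrite add0r.
have step k : nrg (- (w ^+ 2 - w ^+ 4)) <= nrg (er w (- ('X ^+ (k.+1).*2 - 'X ^+ (k.+2).*2))).
  elim: k => [|k IHk]; first by rewrite erN erB !erXn erX.
  apply: (le_trans IHk).
  have -> : - ('X ^+ k.+1.*2 - 'X ^+ k.+2.*2) =
     - ('X ^+ k.+1 - 'X ^+ k.+3) ^+ 2 + - ('X ^+ k.+2.*2 - 'X ^+ k.+3.*2) :> {poly R}.
    rewrite -!muln2 !exprM; set A := 'X ^+ k.+1.
    have -> : 'X ^+ k.+2 = A * 'X :> {poly R} by rewrite exprSr.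
    have -> : 'X ^+ k.+3 = A * 'X * 'X :> {poly R} by rewrite 2!exprSr.
    by ring.
  by rewrite erD (le_trans (nrgD _ _)) // gerDr nrg_sqr.
have [k ke] : exists k : nat, e^-1 < k%:R.
  by exists (Num.truncn e^-1).+1; rewrite truncnS_gt.
apply: (le_trans (step k)); apply: (le_trans (nrg_nu _)).
rewrite erN nuN erB !erXn erX; apply: (le_trans (nuB _ _)).
have half n : nu (w ^+ n.*2) <= (2 ^+ n)^-1 / 2 ^+ n.
  apply: (le_trans (nuX _ _)); rewrite -addnn exprD -!exprVn.
  by rewrite ler_pM ?exprn_ge0 ?nu_ge0 // lerXn2r // ?nnegrE ?nu_ge0 // -div1r.
have H1 := half k.+1; have H2 := half k.+2.
have k2 : k%:R <= 2 ^+ k :> R by rewrite -natrX ler_nat ltnW // ltn_expl.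
have p1 : 1 <= 2 ^+ k :> R by rewrite exprn_ege1 // ler1n.
have p0 : 0 < 2 ^+ k :> R by lra.
have ip : (2 ^+ k)^-1 <= e.
  by rewrite -[leRHS]invrK lef_pV2 ?posrE ?invr_gt0 //; lra.
have ip1 : (2 ^+ k)^-1 <= 1 :> R by rewrite invf_le1.
have ip0 : 0 < (2 ^+ k)^-1 :> R by rewrite invr_gt0.
move: H1 H2; rewrite !exprS !invfM.
move: (nu _) (nu _) ((2 ^+ k)^-1) ip ip0 ip1 => N1 N2 z ze z0 z1 H1 H2.
have zz : z * z <= z by rewrite ler_piMr // ltW.
by nra.
Qed.

(** Replacing y by y (1 - a z), with z = y^* y, replaces z by z (1 - a z)^2. This
    leaves the negative part of z in place, or increases it, while it lowers the
    upper end of the numerical range by a fixed factor. Iterating, the bound of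
    [nrg_star_le] on the negative part tends to 0. *)
Lemma nrg_star_iter n y : nrg (- (st y * y)) <= (1 - 1/2000) ^+ n * Num.max 0 (nrg (st y * y)).
Proof.
elim: n y => [|n IHn] y; first by rewrite expr0 mul1r nrg_star_le.
have ss : st (st y * y) = st y * y by rewrite (ustM H) stK.
have q0 : 0 <= (1 - 1/2000 : R) by lra.
set z := st y * y in ss *.
have := nrg_star_le y; rewrite -/z; set M := Num.max _ _.
have M0 : 0 <= M by rewrite le_max lexx.
have zM : nrg z <= M by rewrite le_max lexx orbT.
move=> zM'.
move: M0; rewrite le_eqVlt => /predU1P[M0|M0]; first by rewrite -M0 mulr0 M0.
have nz : nu z <= 11 * M by apply: nu_le_nrg => //; apply: ltW.
(* with this size the cubic error term, of order (a * M) ^ 2, is beaten by the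
   linear gain a * M *)
pose a := (2000 * M)^-1.
have a0 : 0 < a by rewrite invr_gt0; lra.
have aM : a * M = 1 / 2000 by rewrite /a invfM -mulrA mulVf ?gt_eqF // mulr1 div1r.
pose p : {poly R} := 'X - a *: 'X ^+ 2.
pose y' := y * (1 - a%:C%C *: z).
have ez : er z (1 - a *: 'X) = 1 - a%:C%C *: z by rewrite erB er1 erZ erX.
have zz' : st y' * y' = er z ('X - (2 * a) *: 'X ^+ 2 + a ^+ 2 *: 'X ^+ 3).
  rewrite /y' -ez (ustM H) st_er // mulrA -[X in X * _]mulrA -/z -[X in _ * X * _](erX z) -!erM.
  by congr (er z _); rewrite -!mul_polyC !(polyCM, polyC_exp, polyC_natr); ring.
have le1 : nrg (st y' * y') <= (1 - 1/2000) * M.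
  have -> : st y' * y' = (1 - 4 * (a * M))%:C%C *: z
      + (er z ((- (2 * a)) *: ('X - M%:P) ^+ 2) + rs (2 * a * M ^+ 2))
      + (a ^+ 2)%:C%C *: z ^+ 3.
    rewrite zz' -(erC z) -erD -[z ^+ 3](congr1 (fun u => u ^+ 3) (erX z)) -erXn.
    rewrite -[X in _ *: X + _ + _](erX z) -!erZ -!erD; congr (er z _).
    by rewrite -!mul_polyC !(polyCM, polyC_exp, polyC_natr, polyCB, polyCD, polyCN); ring.
  have A : nrg ((1 - 4 * (a * M))%:C%C *: z) <= (1 - 4 * (a * M)) * M.
    by apply: nrgZ => //; rewrite aM; lra.
  have B : nrg (er z (- (2 * a) *: ('X - M%:P) ^+ 2)) <= (2 * a) * 0.
    rewrite scaleNr -scalerN erZ; apply: nrgZ; first by lra.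
    exact: nrg_sqr.
  have C : nrg ((a ^+ 2)%:C%C *: z ^+ 3) <= (a ^+ 2) * (11 * M) ^+ 3.
    apply: nrgZ; first exact: sqr_ge0.
    apply: (le_trans (nrg_nu _)); apply: (le_trans (nuX _ _)).
    by rewrite lerXn2r // nnegrE ?nu_ge0 //; lra.
  apply: (le_trans (nrgDle (nrgDle A (nrg_shift (2 * a * M ^+ 2) B)) C)).
  have -> : 2 * a * M ^+ 2 = 2 * (a * M) * M by ring.
  have -> : a ^+ 2 * (11 * M) ^+ 3 = 11 ^+ 3 * (a * M) ^+ 2 * M by ring.
  by rewrite aM; lra.
have le2 : nrg (- z) <= nrg (- (st y' * y')).
  pose w := (a / 2)%:C%C *: z.
  have sw : st w = w by rewrite stZ conj_real ss.
  have nw : nu w <= 1 / 2 by rewrite nuZr; nra.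
  have -> : - z = - (st y' * y') + (a%:C%C *: er z (- ('X - (a / 2) *: 'X ^+ 2) ^+ 2)
      + (4 / a)%:C%C *: (- (w ^+ 2 - w ^+ 4))).
    have -> : w = er z ((a / 2) *: 'X) by rewrite erZ erX.
    rewrite zz' -!erXn -erB -!erN -!erZ -!erD -[X in - X](erX z) -erN; congr (er z _).
    rewrite -!mul_polyC; have : (4 / a)%:P * (a / 2)%:P = 2 :> {poly R}.
      rewrite -polyCM -polyC_natr; congr _%:P; field.
      by rewrite gt_eqF.
    have : 2 * (a / 2)%:P = a%:P :> {poly R}.
      by rewrite -polyC_natr -polyCM mulrC divfK.
    have -> : (2 * a)%:P = 2 * a%:P :> {poly R} by rewrite polyCM polyC_natr.
    rewrite [(a ^+ 2)%:P]polyC_exp.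
    by move: (4 / a)%:P (a / 2)%:P => u v <- e; ring: e.
  apply: (le_trans (nrgD _ _)); rewrite gerDl -[0](addr0).
  apply: nrgDle.
    by rewrite -(mulr0 a); apply: nrgZ; [exact: ltW|exact: nrg_sqr].
  rewrite -(mulr0 (4 / a)); apply: nrgZ; last exact: nrg_sub4.
  by rewrite divr_ge0 // ltW.
apply: (le_trans le2); apply: (le_trans (IHn y')).
rewrite exprSr -mulrA ler_wpM2l ?exprn_ge0 // ge_max le1 andbT mulr_ge0 // ltW //.
Qed.

(** The theorem of Fukamiya and Kelley-Vaught that y^* y is positive, the fact
    on which the existence of positive functionals rests. *)
Theorem nrg_star y : nrg (- (st y * y)) <= 0.
Proof.
apply/ler_addgt0Pr => e e0; rewrite add0r.
set M := Num.max 0 (nrg (st y * y)).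
have M0 : 0 <= M by rewrite le_max lexx.
have [q [q0 q1 qP]] : exists q : R, [/\ 0 <= q, q < 1 &
    forall n, nrg (- (st y * y)) <= q ^+ n * M].
  exists (1 - 1 / 2000); split; [lra|lra|move=> n; exact: nrg_star_iter].
have : (fun n => q ^+ n) @ \oo --> (0 : R).
  by apply: cvg_expr; rewrite ger0_norm.
move=> /cvgrPdist_lt /(_ (e / (M + 1))) []; first by rewrite divr_gt0 //; lra.
move=> n _ /(_ n (leqnn _)); rewrite /= sub0r normrN ger0_norm ?exprn_ge0 // => lt.
apply: (le_trans (qP n)).
apply: (@le_trans _ _ (e / (M + 1) * M)); first by rewrite ler_wpM2r // ltW.
rewrite mulrAC ler_pdivrMr; last by lra.
by rewrite ler_wpM2l //; lra.
Qed.

End Unital.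

(** * Hahn-Banach and states *)

Section HahnBanach.
Context (R : realType) (V : lmodType R[i]).
Implicit Types (q : V -> R) (x y a : V) (r t : R).

Definition sublinear q := (forall x y, q (x + y) <= q x + q y) /\
  (forall r x, 0 <= r -> q (r%:C%C *: x) <= r * q x).

Lemma sublinear0 q : sublinear q -> q 0 = 0.
Proof.
move=> [qD qZ]; apply/eqP; rewrite eq_le; apply/andP; split.
  by have := qZ 0 0 (lexx _); rewrite scaler0 mul0r.
by have := qD 0 0; rewrite addr0; lra.
Qed.

Lemma sublinearN q x : sublinear q -> - q (- x) <= q x.
Proof.
move=> qs; have := (qs.1 x (- x)); rewrite subrr sublinear0 //; lra.
Qed.

Lemma sublinear_scale q r x : sublinear q -> 0 <= r -> q (r%:C%C *: x) = r * q x.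
Proof.
move=> qs; rewrite le_eqVlt => /predU1P[<-|r0].
  by rewrite scale0r mul0r sublinear0.
apply/eqP; rewrite eq_le (qs.2 _ _ (ltW r0)) /=.
have ir : 0 <= r^-1 by rewrite invr_ge0 ltW.
have := qs.2 r^-1 (r%:C%C *: x) ir.
rewrite scalerA -realcM mulVf ?gt_eqF // scale1r mulrC.
by rewrite ler_pdivlMr // mulrC.
Qed.

(** The largest sublinear functional below [q] whose value at [- a] is at most
    [- q a]. A minimal sublinear functional equals its tilts, which makes it
    linear. *)
Definition tilt q a x : R := inf [set q (x + t%:C%C *: a) - t * q a | t in [set t : R | 0 <= t]].

Section Tilt.
Variables (q : V -> R) (a : V).
Hypothesis qs : sublinear q.

Let lb x : has_lbound [set q (x + t%:C%C *: a) - t * q a | t in [set t : R | 0 <= t]].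
Proof.
exists (- q (- x)) => _ [t /= t0 <-].
have := qs.1 (x + t%:C%C *: a) (- x).
by rewrite addrAC subrr add0r sublinear_scale //; lra.
Qed.

Lemma tilt_le x t : 0 <= t -> tilt q a x <= q (x + t%:C%C *: a) - t * q a.
Proof. by move=> t0; apply: inf_lbound => //; exists t. Qed.

Lemma tilt_le_id x : tilt q a x <= q x.
Proof. by have := tilt_le x (lexx 0); rewrite scale0r addr0 mul0r subr0. Qed.

Lemma tiltN : tilt q a (- a) <= - q a.
Proof.
have := tilt_le (- a) ler01; rewrite scale1r addNr sublinear0 // mul1r; lra.
Qed.

Lemma tilt_adherent x e : 0 < e ->
  exists2 t, 0 <= t & q (x + t%:C%C *: a) - t * q a <= tilt q a x + e.
Proof.
move=> e0.
have [] := @inf_lt R [set q (x + t%:C%C *: a) - t * q a | t in [set t : R | 0 <= t]]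
   (tilt q a x + e) _ _.
- by exists (q (x + 0%:C%C *: a) - 0 * q a); exists 0 => /=.
- by rewrite ltrDl.
by move=> _ [t /= t0 <-] lt; exists t => //; exact: ltW.
Qed.

Lemma tilt_sublinear : sublinear (tilt q a).
Proof.
split=> [x y|r x].
  apply/ler_addgt0Pr => e e0; have e2 : 0 < e / 2 by lra.
  have [t t0 le1] := tilt_adherent x e2; have [s s0 le2] := tilt_adherent y e2.
  have ts : 0 <= t + s by lra.
  apply: (le_trans (tilt_le _ ts)).
  rewrite realcD scalerDl addrACA.
  have := qs.1 (x + t%:C%C *: a) (y + s%:C%C *: a); lra.
rewrite le_eqVlt => /predU1P[<-|r0].
  by rewrite scale0r mul0r (le_trans (tilt_le_id _)) // sublinear0.
apply/ler_addgt0Pr => e e0; have e2 : 0 < e / r by rewrite divr_gt0.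
have [t t0 le1] := tilt_adherent x e2.
have rt : 0 <= r * t by rewrite mulr_ge0 // ltW.
apply: (le_trans (tilt_le _ rt)).
rewrite realcM -scalerA -scalerDr (sublinear_scale _ qs (ltW r0)) -mulrA -mulrBr.
apply: (le_trans (ler_wpM2l (ltW r0) le1)).
by rewrite mulrDr mulrCA divff ?gt_eqF // mulr1.
Qed.

End Tilt.

Lemma minimal_sublinear q0 : sublinear q0 ->
  exists q, [/\ sublinear q, (forall x, q x <= q0 x) &
    forall p, sublinear p -> (forall x, p x <= q x) -> p = q].
Proof.
move=> s0; pose T := {q : V -> R | sublinear q /\ forall x, q x <= q0 x}.
pose ord (p q : T) := `[< forall x, sval q x <= sval p x >].
have lbT (q : T) x : - q0 (- x) <= sval q x.
  case: q => q [qs qq0] /=; apply: (le_trans _ (sublinearN x qs)).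
  by rewrite lerN2.
have [] := @Zorn T ord.
- by move=> q; apply/asboolP.
- move=> p q r /asboolP pq /asboolP qr; apply/asboolP => x.
  exact: le_trans (qr x) (pq x).
- move=> [p Pp] [q Pq] /asboolP /= pq /asboolP /= qp; apply: eq_exist; apply/funext => x.
  by apply/eqP; rewrite eq_le pq qp.
- move=> F Ftot; have [[p0 Fp0]|F0] := pselect (exists p, F p); last first.
    exists (exist _ q0 (conj s0 (fun x => lexx (q0 x)))) => p Fp.
    by exfalso; apply: F0; exists p.
  pose m x := inf [set sval p x | p in F].
  have ne x : [set sval p x | p in F] !=set0 by exists (sval p0 x); exists p0.
  have lb x : has_lbound [set sval p x | p in F].
    by exists (- q0 (- x)) => _ [p Fp <-].
  have mle p x : F p -> m x <= sval p x.
    by move=> Fp; apply: inf_lbound => //; exists p.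
  have ms : sublinear m.
    split=> [x y|r x r0].
      apply/ler_addgt0Pr => e e0; have e2 : 0 < e / 2 by lra.
      have [||_ [p Fp <-] lt1] := @inf_lt R [set sval p x | p in F] (m x + e / 2).
      - exact: ne.
      - by rewrite ltrDl.
      have [||_ [p' Fp' <-] lt2] := @inf_lt R [set sval p y | p in F] (m y + e / 2).
      - exact: ne.
      - by rewrite ltrDl.
      have [/asboolP le|/asboolP le] := Ftot _ _ Fp Fp'.
        have := (svalP p').1.1 x y; have := mle p' (x + y) Fp'; have := le x.
        lra.
      have := (svalP p).1.1 x y; have := mle p (x + y) Fp; have := le y.
      lra.
    move: r0; rewrite le_eqVlt => /predU1P[<-|r0].
      rewrite scale0r mul0r; apply: (le_trans (mle p0 0 Fp0)).
      by rewrite (sublinear0 (svalP p0).1).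
    apply/ler_addgt0Pr => e e0; have e2 : 0 < e / r by rewrite divr_gt0.
    have [||_ [p Fp <-] lt1] := @inf_lt R [set sval p x | p in F] (m x + e / r).
    - exact: ne.
    - by rewrite ltrDl.
    apply: (le_trans (mle p _ Fp)).
    rewrite (sublinear_scale _ (svalP p).1 (ltW r0)).
    apply: (le_trans (ler_wpM2l (ltW r0) (ltW lt1))).
    by rewrite mulrDr mulrCA divff ?gt_eqF // mulr1.
  have mq0 x : m x <= q0 x by apply: (le_trans (mle p0 x Fp0)); exact: (svalP p0).2.
  exists (exist _ m (conj ms mq0)) => p Fp; apply/asboolP => x /=.
  exact: mle.
move=> [q [qs qq0]] qmin; exists q; split=> // p ps pq.
have pq0 x : p x <= q0 x by apply: le_trans (pq x) (qq0 x).
have := qmin (exist _ p (conj ps pq0)); rewrite /ord /= => E.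
by have := E (asboolT pq) => -[].
Qed.

(** Tilting [q0] along [h] first forces every minimal functional below it to take
    the value [q0 h] at [h]. *)
Theorem hahn_banach q0 h : sublinear q0 ->
  exists L : V -> R, [/\ (forall x y, L (x + y) = L x + L y),
    (forall r x, L (r%:C%C *: x) = r * L x),
    (forall x, L x <= q0 x) & L h = q0 h].
Proof.
move=> s0; have [q [qs qle qmin]] := minimal_sublinear (tilt_sublinear h s0).
have qN x : q (- x) = - q x.
  have := qmin _ (tilt_sublinear x qs) (tilt_le_id x qs).
  move=> E; have := tiltN x qs; rewrite E => le.
  by apply/eqP; rewrite eq_le le /= lerNl sublinearN.
have le0 x : q x <= q0 x := le_trans (qle x) (tilt_le_id h s0 x).
exists q; split=> // [x y|r x|].
- apply/eqP; rewrite eq_le qs.1 /= -lerN2 -qN opprD (le_trans (qs.1 _ _)) //.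
  by rewrite !qN opprD.
- have [r0|r0] := leP 0 r; first exact: sublinear_scale.
  rewrite -[r]opprK realcN scaleNr qN sublinear_scale ?mulNr ?mulNr ?opprK //.
  by rewrite oppr_ge0 ltW.
apply/eqP; rewrite eq_le le0 /= -lerN2 -qN (le_trans (qle _)) //.
exact: tiltN.
Qed.

End HahnBanach.

Section State.
Context (R : realType) (U : algType R[i]) (st : U -> U) (nu : U -> R).
Hypothesis H : unital_cstar st nu.

(** A real functional dominated by the numerical range of the real part is
    positive because of [nrg_star]. Choosing it to attain the numerical range at
    z0^* z0 gives the lower bound, by [nu_le_nrg]. *)
Theorem exists_state z0 : exists om : U -> R[i],
  [/\ (forall c x y, om (c *: x + y) = c * om x + om y),
      (forall x, cabs (om x) <= nu x),
      (forall x, 0 <= om (st x * x)) &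
      nu (st z0 * z0) <= 11 * cabs (om (st z0 * z0))].
Proof.
pose re y := (2^-1)%:C%C *: (y + st y).
have h0 : 0 <= 2^-1 :> R by lra.
have half2 (y : U) : (2^-1)%:C%C *: (y + y) = y.
  by rewrite -mulr2n -[y *+ 2](scaler_nat (R := R[i])) scalerA -invc_nat mulVf ?scale1r // pnatr_eq0.
have re_sa y : st y = y -> re y = y by move=> e; rewrite /re e half2.
have re_skew y : st y = - y -> re y = 0 by move=> e; rewrite /re e subrr scaler0.
have nu_re y : nu (re y) <= nu y.
  rewrite (nuZr H _ h0) (le_trans (ler_wpM2l h0 (unuD H _ _))) //.
  by rewrite (nu_st H); lra.
pose S y := nrg nu (re y).
have Ss : sublinear S.
  split=> [x y|r x r0].
    by rewrite /S /re (stD H) addrACA scalerDr; exact: (nrgD H).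
  rewrite /S; have -> : re (r%:C%C *: x) = r%:C%C *: re x.
    by rewrite /re (stZ H) conj_real -scalerDr !scalerA mulrC.
  exact: (nrgZ H).
have ssx (x : U) : st (st x * x) = st x * x by rewrite (ustM H) (ust_K H).
set z := st z0 * z0; have sz : st z = z := ssx z0.
have [L [LD LZ LS Lz]] := hahn_banach z Ss.
have LN x : L (- x) = - L x.
  by have := LZ (-1) x; rewrite realcN scaleN1r mulN1r.
have Lsa x : st x = x -> L x <= nrg nu x by move=> e; rewrite -{2}(re_sa _ e); exact: LS.
have L0 : nrg nu (0 : U) <= 0 by rewrite -(rs0 U); exact: (nrg_rs H).
have Lskew x : st x = - x -> L x = 0.
  move=> e; apply/eqP; rewrite eq_le -oppr_le0 -LN; apply/andP; split.
    by rewrite (le_trans (LS _)) // /S re_skew.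
  by rewrite (le_trans (LS _)) // /S re_skew // (stN H) e.
pose om x : R[i] := (L x)%:C%C - 'i * (L ('i *: x))%:C%C.
have ii : 'i * 'i = -1 :> R[i] by rewrite -expr2 sqrCi.
have omD x y : om (x + y) = om x + om y.
  by rewrite /om scalerDr !LD !realcD mulrDr opprD addrACA.
have omr r x : om (r%:C%C *: x) = r%:C%C * om x.
  rewrite /om scalerA [_ * r%:C%C]mulrC -scalerA !LZ !realcM mulrBr.
  by congr (_ - _); rewrite mulrCA.
have omi x : om ('i *: x) = 'i * om x.
  rewrite /om scalerA ii scaleN1r LN realcN mulrN opprK mulrBr mulrA ii mulN1r.
  by rewrite opprK addrC.
have omZ (c : R[i]) x : om (c *: x) = c * om x.
  have -> : c = (complex.Re c)%:C%C + 'i * (complex.Im c)%:C%C.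
    by rewrite {1}[c]complexE -complexiE.
  by rewrite scalerDl omD omr mulrDl -scalerA omi omr mulrA.
have Reom x : complex.Re (om x) = L x.
  by rewrite /om -complexiE /= mul0r mul1r !subr0 ?subr0.
have ompos x : om (st x * x) = (L (st x * x))%:C%C.
  rewrite /om (Lskew ('i *: _)) ?mulr0 ?subr0 //.
  by rewrite (stZ H) conjCi ssx scaleNr.
have Lpos x : 0 <= L (st x * x).
  rewrite -oppr_le0 -LN; apply: le_trans (nrg_star H x); apply: Lsa.
  by rewrite (stN H) ssx.
exists om; split.
- by move=> c x y; rewrite omD omZ.
- move=> x; have [e|ne] := eqVneq (cabs (om x)) 0.
    by rewrite e (nu_ge0 H).
  pose c := (cabs (om x))%:C%C / om x.
  have o0 : om x != 0 by rewrite -cabs_eq0.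
  have e : om (c *: x) = (cabs (om x))%:C%C by rewrite omZ divfK.
  have c1 : cabs c = 1.
    by rewrite cabsM cabsV cabs_real ger0_norm ?cabs_ge0 // divff.
  rewrite -[leLHS](ReC (cabs (om x))) -e Reom (le_trans (LS _)) //.
  rewrite /S (le_trans (nrg_nu H _)) // (le_trans (nu_re _)) // (unuZ H) c1 mul1r //.
- by move=> x; rewrite ompos -[0]/(0%:C%C) lecRE.
rewrite ompos cabs_real ger0_norm // Lz.
have Sz : S z = nrg nu z by rewrite /S re_sa.
have S0 : 0 <= S z by rewrite -Lz Lpos.
apply: (nu_le_nrg H sz S0); first by rewrite Sz.
by apply: (le_trans (nrg_star H _)).
Qed.
End State.

(** * C*-seminorms on *-algebras *)

(** The operations are a record and not a structure on the carrier: the carriers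
    [A] and [ccT G A] below need not have a unit, and the operations of the second
    one depend on the Haar functional. *)
Record staralg (R : realType) (X : lmodType R[i]) := StarAlg {
  smul : X -> X -> X;
  sstar : X -> X;
  smulA : associative smul;
  smulDl : forall c x y z, smul (c *: x + y) z = c *: smul x z + smul y z;
  smulDr : forall c x y z, smul z (c *: x + y) = c *: smul z x + smul z y;
  sstarK : involutive sstar;
  sstar_anti : forall c x y, sstar (c *: x + y) = c^* *: sstar x + sstar y;
  sstarM : forall x y, sstar (smul x y) = smul (sstar y) (sstar x) }.

Section StarAlg.
Context (R : realType) (X : lmodType R[i]) (S : staralg X).
Implicit Types (x y z : X) (c : R[i]).
Lemma smul0l z : smul S 0 z = 0.
Proof.
have := smulDl S 1 0 0 z; rewrite scaler0 addr0 scale1r.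
by rewrite -{1}[smul S 0 z]addr0 => /addrI.
Qed.
Lemma smul0r z : smul S z 0 = 0.
Proof.
have := smulDr S 1 0 0 z; rewrite scaler0 addr0 scale1r.
by rewrite -{1}[smul S z 0]addr0 => /addrI.
Qed.
Lemma smulZl c x z : smul S (c *: x) z = c *: smul S x z.
Proof. by rewrite -[c *: x]addr0 smulDl smul0l addr0. Qed.
Lemma smulZr c x z : smul S z (c *: x) = c *: smul S z x.
Proof. by rewrite -[c *: x]addr0 smulDr smul0r addr0. Qed.
Lemma smulAl x y z : smul S (x + y) z = smul S x z + smul S y z.
Proof. by rewrite -[x]scale1r smulDl !scale1r. Qed.
Lemma smulAr x y z : smul S z (x + y) = smul S z x + smul S z y.
Proof. by rewrite -[x]scale1r smulDr !scale1r. Qed.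
Lemma smulBl x y z : smul S (x - y) z = smul S x z - smul S y z.
Proof. by rewrite smulAl -scaleN1r smulZl scaleN1r. Qed.
Lemma smulBr x y z : smul S z (x - y) = smul S z x - smul S z y.
Proof. by rewrite smulAr -scaleN1r smulZr scaleN1r. Qed.
Lemma sstar0 : sstar S 0 = 0.
Proof.
have := sstar_anti S 1 0 0; rewrite scaler0 addr0 conjC1 scale1r.
by rewrite -{1}[sstar S 0]addr0 => /addrI.
Qed.
Lemma sstarZ c x : sstar S (c *: x) = c^* *: sstar S x.
Proof. by rewrite -[c *: x]addr0 sstar_anti sstar0 addr0. Qed.
Lemma sstarD x y : sstar S (x + y) = sstar S x + sstar S y.
Proof. by rewrite -[x]scale1r sstar_anti conjC1 !scale1r. Qed.
Lemma sstarB x y : sstar S (x - y) = sstar S x - sstar S y.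
Proof. by rewrite sstarD -scaleN1r sstarZ conjcN conjC1 scaleN1r. Qed.

Record cseminorm (p : X -> R) : Prop := CSemi {
  csD : forall x y, p (x + y) <= p x + p y;
  csZ : forall c x, p (c *: x) = cabs c * p x;
  csM : forall x y, p (smul S x y) <= p x * p y;
  csC : forall x, p (smul S (sstar S x) x) = p x ^+ 2 }.

Section CSeminorm.
Variable (p : X -> R).
Hypothesis P : cseminorm p.
Lemma cs0 : p 0 = 0. Proof. by rewrite -(scale0r 0) (csZ P) cabs0 mul0r. Qed.
Lemma csN x : p (- x) = p x.
Proof. by rewrite -scaleN1r (csZ P) cabsN cabs1 mul1r. Qed.
Lemma csB x y : p (x - y) <= p x + p y.
Proof. by rewrite -(csN y) (csD P). Qed.
Lemma cs_ge0 x : 0 <= p x.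
Proof. by have := csB x x; rewrite subrr cs0; lra. Qed.
Lemma cs_star x : p (sstar S x) = p x.
Proof.
have le y : p y <= p (sstar S y).
  have := csM P (sstar S y) y; rewrite (csC P) expr2 => le.
  have [y0|y0] := ltP 0 (p y); last by rewrite (le_trans y0) // cs_ge0.
  by rewrite -(ler_pM2r y0).
by apply/eqP; rewrite eq_le le andbT -{2}[x](sstarK S) le.
Qed.
End CSeminorm.
End StarAlg.

Section Unitization.
Context (R : realType) (X : lmodType R[i]) (S : staralg X).

(** The unitization, normed below by left multiplication on [X]. *)
Definition unitz of staralg X := (R[i]^o * X)%type.
HB.instance Definition _ := GRing.Lmodule.on (unitz S).

Definition umul (x y : unitz S) : unitz S :=
  (x.1 * y.1, x.1 *: y.2 + y.1 *: x.2 + smul S x.2 y.2).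
Definition uone : unitz S := (1, 0).

Lemma umulA : associative umul.
Proof.
move=> [a x] [b y] [c z]; rewrite /umul /=; congr pair; first by rewrite mulrA.
rewrite !scalerDr !scalerA !smulAl !smulAr !smulZl !smulZr smulA !addrA.
rewrite [b * c]mulrC [a * c]mulrC.
move: (smul S y z) (smul S x z) (smul S x y) (smul S _ z) => u v w t.
congr (_ + _); rewrite -!addrA; congr (_ + _); congr (_ + _).
by rewrite addrCA; congr (_ + _); rewrite addrA addrC.
Qed.
Lemma umul1r : left_id uone umul.
Proof. by move=> [a x]; rewrite /umul /= mul1r smul0l scale1r scaler0 !addr0. Qed.
Lemma umulr1 : right_id uone umul.
Proof. by move=> [a x]; rewrite /umul /= mulr1 smul0r scale1r scaler0 addr0 add0r. Qed.
Lemma umulDl : left_distributive umul +%R.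
Proof.
move=> [a x] [b y] [c z]; rewrite /umul /=; congr pair; first by rewrite mulrDl.
rewrite /= scalerDl scalerDr smulAl.
move: (a *: z) (b *: z) (c *: x) (c *: y) (smul S x z) (smul S y z) => u v w t k l.
by rewrite (addrACA u v) (addrACA (u + w)).
Qed.
Lemma umulDr : right_distributive umul +%R.
Proof.
move=> [a x] [b y] [c z]; rewrite /umul /=; congr pair; first by rewrite mulrDr.
rewrite /= scalerDl scalerDr smulAr.
move: (a *: y) (a *: z) (b *: x) (c *: x) (smul S x y) (smul S x z) => u v w t k l.
by rewrite (addrACA u v) (addrACA (u + w)).
Qed.
Lemma uone_neq0 : uone != 0.
Proof. by apply/eqP => -[] /eqP; rewrite oner_eq0. Qed.

HB.instance Definition _ := GRing.Zmodule_isNzRing.Build (unitz S)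
  umulA umul1r umulr1 umulDl umulDr uone_neq0.

Lemma uscalerAl (c : R[i]) (x y : unitz S) : c *: (x * y) = (c *: x) * y.
Proof.
case: x y => [a x] [b y]; congr pair; first by rewrite /= -mulrA.
by rewrite /= !scalerDr !scalerA smulZl [b * c]mulrC.
Qed.
HB.instance Definition _ := GRing.Lmodule_isLalgebra.Build R[i] (unitz S) uscalerAl.
Lemma uscalerAr (c : R[i]) (x y : unitz S) : c *: (x * y) = x * (c *: y).
Proof.
case: x y => [a x] [b y]; congr pair; first by rewrite /= mulrCA.
by rewrite /= !scalerDr !scalerA smulZr [a * c]mulrC.
Qed.
HB.instance Definition _ := GRing.Lalgebra_isAlgebra.Build R[i] (unitz S) uscalerAr.

Definition ust (x : unitz S) : unitz S := (x.1^*, sstar S x.2).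

Section UNorm.
Variable (p : X -> R).
Hypothesis P : cseminorm S p.
Implicit Types (x : unitz S) (y z : X).
Hypothesis pn0 : exists y, p y != 0.

Definition uact x y : X := x.1 *: y + smul S x.2 y.
Definition unorm (x : unitz S) : R := sup [set p (uact x y) | y in [set y | p y <= 1]].

Let ub x : ubound [set p (uact x y) | y in [set y | p y <= 1]] (cabs x.1 + p x.2).
Proof.
move=> _ [y /= y1 <-]; apply: (le_trans (csD P _ _)).
have c0 := cabs_ge0 x.1; have p0 := cs_ge0 P x.2.
apply: lerD; first by rewrite (csZ P) ler_piMr.
by apply: (le_trans (csM P _ _)); rewrite ler_piMr.
Qed.

Let hs x : has_sup [set p (uact x y) | y in [set y | p y <= 1]].
Proof.
split; first by exists (p (uact x 0)); exists 0 => //=; rewrite (cs0 P).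
by exists (cabs x.1 + p x.2); exact: ub.
Qed.

Lemma uactM (x y : unitz S) z : uact (x * y) z = uact x (uact y z).
Proof.
rewrite /uact /= scalerDr !scalerA smulAr smulZr !smulAl !smulZl smulA -!addrA.
by congr (_ + _).
Qed.
Lemma uactZ (c : R[i]) x z : uact x (c *: z) = c *: uact x z.
Proof. by rewrite /uact smulZr scalerDr !scalerA mulrC. Qed.

Lemma unorm_act x y : p (uact x y) <= unorm x * p y.
Proof.
have [y0|y0] := ltP 0 (p y); last first.
  have e : p y = 0 by apply/eqP; rewrite eq_le y0 (cs_ge0 P).
  rewrite e mulr0; apply: (le_trans (csD P _ _)); rewrite (csZ P) e mulr0 add0r.
  by rewrite (le_trans (csM P _ _)) // e mulr0.
rewrite -ler_pdivrMr //.
have i0 : 0 <= (p y)^-1 by rewrite invr_ge0 ltW.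
have E z : p ((p y)^-1%:C%C *: z) = p z / p y.
  by rewrite (csZ P) cabs_real ger0_norm // mulrC.
rewrite -E -uactZ; apply: ub_le_sup; first exact: (hs x).2.
by exists ((p y)^-1%:C%C *: y) => //=; rewrite E divff // gt_eqF.
Qed.

Lemma unorm_le x (c : R) : (forall y, p (uact x y) <= c * p y) -> 0 <= c -> unorm x <= c.
Proof.
move=> le c0; apply: sup_le_ub; first exact: (hs x).1.
move=> _ [y /= y1 <-]; apply: (le_trans (le y)).
by rewrite ler_piMr.
Qed.

Lemma unorm_ge0 x : 0 <= unorm x.
Proof.
have [y py] := pn0; have y0 : 0 < p y by rewrite lt_neqAle eq_sym py (cs_ge0 P).
by rewrite -(pmulr_lge0 _ y0) (le_trans _ (unorm_act x y)) // (cs_ge0 P).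
Qed.

(** The C*-identity makes the left regular representation isometric. *)
Lemma unorm_in (x : X) : unorm (0, x) = p x.
Proof.
apply/eqP; rewrite eq_le; apply/andP; split.
  apply: unorm_le (cs_ge0 P x) => y.
  by rewrite /uact /= scale0r add0r (csM P).
have := unorm_act (0, sstar S x) x.
rewrite /uact /= scale0r add0r (csC P) expr2.
have H y : unorm (0, sstar S y) <= p y.
  apply: unorm_le (cs_ge0 P _) => z.
  by rewrite /uact /= scale0r add0r (le_trans (csM P _ _)) // (cs_star P).
have := unorm_act (0, x) (sstar S x).
rewrite /uact /= scale0r add0r -{1}[x](sstarK S) (csC P) (cs_star P) expr2 => le _.
have [y0|y0] := ltP 0 (p x); last by rewrite (le_trans y0) // unorm_ge0.
by rewrite -(ler_pM2r y0).
Qed.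

Lemma ust_act x y z : smul S (sstar S (uact x y)) z = smul S (sstar S y) (uact (ust x) z).
Proof.
by rewrite /uact /ust /= sstarD sstarZ sstarM smulAl smulZl smulAr smulZr smulA.
Qed.

Lemma unital_cstar_unorm : unital_cstar ust unorm.
Proof.
have unM (x y : unitz S) : unorm (x * y) <= unorm x * unorm y.
  apply: unorm_le => [z|]; last by rewrite mulr_ge0 // unorm_ge0.
  rewrite uactM (le_trans (unorm_act _ _)) // -mulrA ler_wpM2l ?unorm_ge0 //.
  exact: unorm_act.
have ustK' : involutive ust.
  by move=> [a x]; rewrite /ust /= conjCK sstarK.
have unC1 x : unorm x ^+ 2 <= unorm (ust x * x).
  have U0 := unorm_ge0 (ust x * x).
  suff : unorm x <= Num.sqrt (unorm (ust x * x)).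
    move=> le; rewrite -[leRHS]sqr_sqrtr // lerXn2r // nnegrE ?unorm_ge0 //.
  apply: unorm_le (sqrtr_ge0 _) => y.
  have py := cs_ge0 P y.
  rewrite -(@ler_pXn2r _ 2) // ?nnegrE ?(cs_ge0 P) ?mulr_ge0 ?sqrtr_ge0 //.
  rewrite exprMn sqr_sqrtr // -(csC P) ust_act -uactM.
  apply: (le_trans (csM P _ _)); rewrite (cs_star P) mulrC expr2 mulrA.
  by rewrite ler_wpM2r // unorm_act.
have ust_le x : unorm x <= unorm (ust x).
  have := le_trans (unC1 x) (unM _ _); rewrite expr2 => le.
  have [y0|y0] := ltP 0 (unorm x); last by rewrite (le_trans y0) // unorm_ge0.
  by rewrite -(ler_pM2r y0).
split => //.
- by move=> c [a x] [b y]; rewrite /ust /= conjcD conjcM sstar_anti.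
- move=> [a x] [b y]; rewrite /ust; congr pair; first by rewrite /= conjcM mulrC.
  by rewrite /= !sstarD !sstarZ sstarM [_ *: _ + _]addrC.
- move=> x y; apply: unorm_le => [z|]; last by rewrite addr_ge0 // unorm_ge0.
  have -> : uact (x + y) z = uact x z + uact y z.
    by rewrite /uact /= scalerDl smulAl addrACA.
  by rewrite mulrDl (le_trans (csD P _ _)) // lerD // unorm_act.
- have le (c : R[i]) x : unorm (c *: x) <= cabs c * unorm x.
    apply: unorm_le => [z|]; last by rewrite mulr_ge0 ?cabs_ge0 ?unorm_ge0.
    have -> : uact (c *: x) z = c *: uact x z.
      by rewrite /uact /= smulZl scalerDr scalerA.
    by rewrite (csZ P) -mulrA ler_wpM2l ?cabs_ge0 ?unorm_act.
  move=> c x; apply/eqP; rewrite eq_le le /=.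
  have [->|c0] := eqVneq c 0; first by rewrite cabs0 mul0r unorm_ge0.
  have := le c^-1 (c *: x); rewrite scalerA mulVf // scale1r cabsV.
  by rewrite mulrC ler_pdivlMr ?lt_neqAle ?cabs_ge0 1?eq_sym ?cabs_eq0 ?c0 // mulrC.
- move=> x; apply/eqP; rewrite eq_le unC1 andbT (le_trans (unM _ _)) // expr2.
  by rewrite ler_wpM2r ?unorm_ge0 // -{2}[x]ustK' ust_le.
- have [y py] := pn0; have y0 : 0 < p y by rewrite lt_neqAle eq_sym py (cs_ge0 P).
  have E z : uact 1 z = z by rewrite /uact /= scale1r smul0l addr0.
  apply/eqP; rewrite eq_le; apply/andP; split.
    by apply: unorm_le => // z; rewrite E mul1r.
  by rewrite -(ler_pM2r y0) mul1r -{1}(E y) unorm_act.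
Qed.

End UNorm.

(** The Gelfand-Naimark theorem up to a constant: C*-seminorms are determined,
    within a factor, by the positive functionals that they dominate. *)
Theorem exists_positive_functional (p : X -> R) z0 : cseminorm S p ->
  exists om : X -> R[i],
  [/\ (forall c x y, om (c *: x + y) = c * om x + om y),
      (forall x, cabs (om x) <= p x),
      (forall x, 0 <= om (smul S (sstar S x) x)) &
      p z0 ^+ 2 <= 11 * cabs (om (smul S (sstar S z0) z0))].
Proof.
move=> P; have [p0|pn0] := pselect (p z0 = 0).
  exists (fun=> 0); split=> // [c x y||].
  - by rewrite mulr0 addr0.
  - by move=> x; rewrite cabs0 (cs_ge0 P).
  by rewrite p0 expr0n /= cabs0 mulr0.
have pn : exists y, p y != 0 by exists z0; apply/eqP.
have H := unital_cstar_unorm P pn.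
have [om [oml omn omp omz]] := exists_state H (0, z0).
have E x : ust (0, x) * (0, x) = (0, smul S (sstar S x) x).
  congr pair; rewrite /= ?mulr0 //.
  by rewrite conjC0 !scale0r !add0r.
exists (fun x => om (0, x)); split.
- move=> c x y; rewrite -oml; congr om.
  by congr pair; rewrite -[RHS]/(c * 0 + 0) mulr0 addr0.
- by move=> x; rewrite -(unorm_in P pn) omn.
- by move=> x; rewrite -E omp.
by move: omz; rewrite E unorm_in // (csC P).
Qed.

End Unitization.

(** * Homomorphisms and duals of C*-algebras *)

Lemma complete_seq (R : realType) (V : completeNormedModType R[i]) (u : nat -> V) :
  (forall e : R, 0 < e -> exists N, forall n m, (N <= n)%N -> (N <= m)%N ->
     nrm (u n - u m) < e) ->
  exists l, forall e : R, 0 < e -> exists N, forall n, (N <= n)%N -> nrm (u n - l) < e.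
Proof.
move=> P; have cvu : cvgn u.
  apply/cauchy_cvgP; apply/cauchy_ballP => e e0; near_simpl.
  have eE : e = (cabs e)%:C%C by apply: cabs_ge0_id; exact: ltW.
  have e0' : 0 < cabs e by rewrite -ltcRE -eE.
  have [N PN] := P _ e0'; near=> x => /=; rewrite -ball_normE /= nrmE eE ltcRE.
  by apply: PN; near: x; [exists ([set n | N <= n]%N, [set n | N <= n]%N) => //=; [split; exists N|move=> ? []]|exists ([set n | N <= n]%N, [set n | N <= n]%N) => //=; [split; exists N|move=> ? []]].
exists (limn u) => e e0.
have e0' : 0 < e%:C%C :> R[i] by rewrite -[0]/(0%:C%C) ltcRE.
have /cvgrPdist_lt/(_ _ e0')[N _ PN] := cvu; exists N => n Nn.
by have := PN n Nn; rewrite distrC nrmE ltcRE.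
Unshelve. all: end_near. Qed.

Lemma quasi_step (R : realType) (x z Y W : R) : Y <= 1/2 -> x <= 1/2 -> 0 <= x ->
  z <= x * x -> W <= Y + z -> 2^-1 * W <= 1/2.
Proof. by nra. Qed.

Lemma quasi_lip (R : realType) (x y d u v W : R) : x <= 1/2 -> y <= 1/2 -> 0 <= d ->
  u <= d * x -> v <= y * d -> W <= u + v -> W <= d.
Proof. by nra. Qed.

Section CStar.
Context (R : realType) (A : cstarAlgType R).
Implicit Types (a b : A).

Lemma amulDl c a b z : amul (c *: a + b) z = c *: amul a z + amul b z :> A.
Proof. exact: amul_linearl. Qed.
Lemma amulDr c a b z : amul z (c *: a + b) = c *: amul z a + amul z b :> A.
Proof. exact: amul_linearr. Qed.

Definition cstar_staralg : staralg A :=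
  StarAlg (@amulA R A) amulDl amulDr (@astarK R A) (@astar_antilinear R A) (@astarM R A).

Lemma astar0 : astar (0 : A) = 0. Proof. exact: (sstar0 cstar_staralg). Qed.
Lemma astarZ c a : astar (c *: a) = c^* *: astar a. Proof. exact: (sstarZ cstar_staralg). Qed.
Lemma astarD a b : astar (a + b) = astar a + astar b. Proof. exact: (sstarD cstar_staralg). Qed.
Lemma astarB a b : astar (a - b) = astar a - astar b. Proof. exact: (sstarB cstar_staralg). Qed.
Lemma astarN a : astar (- a) = - astar a. Proof. by rewrite -[- a]sub0r astarB astar0 sub0r. Qed.
Lemma amul0l a : amul 0 a = 0. Proof. exact: (smul0l cstar_staralg). Qed.
Lemma amul0r a : amul a 0 = 0. Proof. exact: (smul0r cstar_staralg). Qed.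
Lemma amulZl c a b : amul (c *: a) b = c *: amul a b. Proof. exact: (smulZl cstar_staralg). Qed.
Lemma amulZr c a b : amul b (c *: a) = c *: amul b a. Proof. exact: (smulZr cstar_staralg). Qed.
Lemma amulAr a b z : amul z (a + b) = amul z a + amul z b.
Proof. exact: (smulAr cstar_staralg). Qed.
Lemma amulBl a b z : amul (a - b) z = amul a z - amul b z.
Proof. exact: (smulBl cstar_staralg). Qed.
Lemma amulBr a b z : amul z (a - b) = amul z a - amul z b.
Proof. exact: (smulBr cstar_staralg). Qed.
Lemma amulNl a b : amul (- a) b = - amul a b.
Proof. by rewrite -[- a]sub0r amulBl amul0l sub0r. Qed.
Lemma amulNr a b : amul a (- b) = - amul a b.
Proof. by rewrite -[- b]sub0r amulBr amul0r sub0r. Qed.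

Lemma nrm_amul a b : nrm (amul a b) <= nrm a * nrm b.
Proof. by rewrite -lecRE realcM -!nrmE ler_norm_amul. Qed.

Lemma nrm_cstar a : nrm (amul (astar a) a) = nrm a ^+ 2.
Proof. by apply: realcI; rewrite realcX -!nrmE cstar_identity. Qed.

Lemma cseminorm_nrm : cseminorm cstar_staralg (@nrm R A).
Proof. by split; [exact: nrmD|exact: nrmZ|exact: nrm_amul|exact: nrm_cstar]. Qed.

Lemma nrm_astar a : nrm (astar a) = nrm a.
Proof. exact: (cs_star cseminorm_nrm). Qed.

(** 1 - h = (1 - y)^2: a square root of 1 - h, found as the fixed point of the
    contraction y |-> (h + y^2) / 2 of the ball of radius 1/2. *)
Lemma quasi_sqrt (h : A) : astar h = h -> nrm h <= 1/2 ->
  exists2 y : A, astar y = y & h = 2 *: y - amul y y.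
Proof.
move=> hh hn; pose F (y : A) := 2^-1 *: (h + amul y y).
pose u n := iter n F 0.
have half : cabs (2^-1) = 2^-1 :> R by rewrite invc_nat cabs_real ger0_norm.
have [uN uS] : (forall n, nrm (u n) <= 1/2) /\ (forall n, astar (u n) = u n).
  suff P n : nrm (u n) <= 1/2 /\ astar (u n) = u n by split=> n; case: (P n).
  elim: n => [|n [IH1 IH2]]; first by rewrite /u /= nrm0 astar0; split=> //; lra.
  rewrite /u /= -/(u n) /F nrmZ half; split; last first.
    rewrite astarZ astarD /= astarM IH2 hh.
    by rewrite invc_nat conj_real.
  exact: (quasi_step hn IH1 (nrm_ge0 _) (nrm_amul _ _) (nrmD _ _)).
have lip (x y : A) : nrm x <= 1/2 -> nrm y <= 1/2 -> nrm (F x - F y) <= 2^-1 * nrm (x - y).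
  move=> xn yn; rewrite /F -scalerBr nrmZ half opprD addrACA subrr add0r.
  rewrite ler_pM2l //.
  have -> : amul x x - amul y y = amul (x - y) x + amul y (x - y).
    rewrite amulBl amulBr /= addrA subrK //.
  exact: (quasi_lip xn yn (nrm_ge0 _) (nrm_amul _ _) (nrm_amul _ _) (nrmD _ _)).
have step n : nrm (u n.+1 - u n) <= (2 ^+ n)^-1.
  elim: n => [|n IHn].
    rewrite expr0 invr1; have := nrmB (u 1%N) (u 0%N); have := uN 1%N; have := uN 0%N.
    by lra.
  apply: (le_trans (lip _ _ (uN n.+1) (uN n))); rewrite exprS invfM ler_pM2l //.
have far n k : nrm (u (n + k)%N - u n) <= 2 * (2 ^+ n)^-1 - 2 * (2 ^+ (n + k))^-1.
  elim: k => [|k IHk]; first by rewrite addn0 !subrr nrm0.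
  have := nrmD (u (n + k).+1 - u (n + k)%N) (u (n + k)%N - u n).
  rewrite addrA subrK addnS; have := step (n + k)%N.
  by rewrite exprS invfM; move: IHk; move: (nrm _) (nrm _) (nrm _) ((2 ^+ (n + k))^-1) ((2 ^+ n)^-1) => *; lra.
have small e : 0 < e -> exists N : nat, (2 ^+ N)^-1 < e :> R.
  move=> e0; exists (Num.truncn e^-1).+1.
  rewrite -[ltRHS]invrK ltf_pV2 ?posrE ?invr_gt0 ?exprn_gt0 //.
  apply: (lt_le_trans (truncnS_gt _)).
  by rewrite -natrX ler_nat ltnW // ltn_expl.
have [|y Py] := @complete_seq R A u.
  move=> e e0; have e4 : 0 < e / 4 by lra.
  have [N lt] := small _ e4; exists N => n m Nn Nm.
  have := far N (n - N)%N; have := far N (m - N)%N; rewrite !subnKC //.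
  have := nrmB (u n - u N) (u m - u N); rewrite opprB addrA subrK.
  have p0 k : 0 <= (2 ^+ k)^-1 :> R by rewrite invr_ge0 exprn_ge0.
  by have := p0 n; have := p0 m; lra.
have lim_small (x : A) : (forall e, 0 < e -> nrm x <= e) -> x = 0.
  move=> le; apply/eqP; rewrite -nrm_eq0 eq_le nrm_ge0 andbT.
  by apply/ler_addgt0Pr => e e0; rewrite add0r le.
have sy : astar y = y.
  apply/eqP; rewrite -subr_eq0; apply/eqP; apply: lim_small => e e0.
  have e2 : 0 < e / 2 by lra.
  have [N /(_ N (leqnn _)) lt] := Py _ e2.
  have := nrmB (u N - y) (astar (u N - y)); rewrite nrm_astar.
  rewrite astarB uS opprB addrC addrA subrK; lra.
have yn : nrm y <= 1/2.
  apply/ler_addgt0Pr => e e0; have [N /(_ N (leqnn _)) lt] := Py _ e0.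
  have := nrmB (u N) (u N - y); rewrite opprB addrC subrK; have := uN N; lra.
exists y => //.
have Fy : F y = y.
  apply/eqP; rewrite -subr_eq0; apply/eqP; apply: lim_small => e e0.
  have e2 : 0 < e / 2 by lra.
  have [N PN] := Py _ e2.
  have := PN N (leqnn _); have := PN N.+1 (leqnSn _).
  have := lip _ _ (uN N) yn; rewrite -/(u N.+1).
  have := nrmB (u N.+1 - y) (F (u N) - F y).
  have -> : (u N.+1 - y) - (F (u N) - F y) = F y - y.
    by rewrite -[F (u N)]/(u N.+1) opprB addrC addrA subrK.
  rewrite -[F (u N)]/(u N.+1); lra.
by rewrite -{1}Fy /F scalerA divff ?pnatr_eq0 // scale1r addrK.
Qed.

End CStar.

Section Contractive.
Context (R : realType) (A B : cstarAlgType R) (f : A -> B).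
Hypothesis ff : star_homomorphism f.

Let fZ c a b : f (c *: a + b) = c *: f a + f b.
Proof. by case: ff => fl _ _; exact: fl. Qed.
Let fM a b : f (amul a b) = amul (f a) (f b).
Proof. by case: ff. Qed.
Let fS a : f (astar a) = astar (f a).
Proof. by case: ff. Qed.

Lemma star_hom0 : f 0 = 0.
Proof.
have := fZ 1 0 0; rewrite scaler0 addr0 scale1r.
by rewrite -{1}[f 0]addr0 => /addrI.
Qed.
Lemma star_homZ c a : f (c *: a) = c *: f a.
Proof. by rewrite -[c *: a]addr0 fZ star_hom0 addr0. Qed.
Lemma star_homB a b : f (a - b) = f a - f b.
Proof. by rewrite -scaleN1r addrC fZ scaleN1r addrC. Qed.

(** Since 1 - h is the square of a self-adjoint element, so is its image 1 - f h,
    and the numerical range of f h stays in [-1, 1]. *)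
Lemma star_hom_bound h : astar h = h -> nrm h <= 1/2 -> nrm (f h) <= 11.
Proof.
move=> hh hn; pose S := cstar_staralg B; have P := cseminorm_nrm B.
have [f0|/eqP fn0] := pselect (f h = 0); first by rewrite f0 nrm0.
have H : unital_cstar (@ust _ _ S) (unorm (@nrm R B)).
  by apply: unital_cstar_unorm => //; exists (f h); rewrite nrm_eq0.
have main k : astar k = k -> nrm k <= 1/2 -> nrg (unorm (@nrm R B)) ((0, f k) : unitz S) <= 1.
  move=> kk kn; have [y yy e] := quasi_sqrt kk kn.
  have := nrg_sq H (b := (1, - f y) : unitz S).
  have sy : ust ((1, - f y) : unitz S) = (1, - f y).
    by rewrite /ust /= conjC1 astarN -fS yy.
  move=> /(_ sy); have -> : - ((1, - f y) : unitz S) ^+ 2 = (0, f k) - rs (unitz S) 1.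
    rewrite rs1 expr2 e star_homB star_homZ fM.
    congr pair; rewrite /= ?mulr1 ?sub0r //.
    rewrite !scale1r amulNl amulNr opprK subr0 !opprD !opprK.
    by rewrite -mulr2n -[f y *+ 2](scaler_nat (R := R[i])).
  move=> le; have := nrg_shift H 1 le; rewrite subrK add0r //.
rewrite -(unorm_in P); last by exists (f h); rewrite nrm_eq0.
have -> : 11 = 11 * 1 :> R by rewrite mulr1.
apply: (nu_le_nrg H) => //.
- by rewrite /ust /= conjC0 -fS hh.
- exact: main.
have -> : - ((0, f h) : unitz S) = (0, f (- h)).
  by congr pair; rewrite ?oppr0 //= -[- h]scaleN1r star_homZ scaleN1r.
by apply: main; rewrite ?nrmN // -scaleN1r astarZ /= hh conjcN conjC1.
Qed.

(** The bound with a constant is applied to the powers of a self-adjoint element,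
    whose norms are powers of its norm. *)
Theorem star_hom_contractive a : nrm (f a) <= nrm a.
Proof.
have lin h : astar h = h -> nrm (f h) <= 22 * nrm h.
  move=> hh; have [->|h0] := eqVneq h 0; first by rewrite star_hom0 !nrm0 mulr0.
  have hn : 0 < nrm h by rewrite lt_neqAle eq_sym nrm_eq0 h0 nrm_ge0.
  have r0 : 0 <= (2 * nrm h)^-1 by rewrite invr_ge0; lra.
  have := @star_hom_bound (((2 * nrm h)^-1)%:C%C *: h).
  rewrite star_homZ !nrmZ cabs_real ger0_norm // astarZ /=.
  rewrite conj_real hh invfM -mulrA mulVf ?gt_eqF // => /(_ erefl).
  move=> le; have {le} : 2^-1 * (nrm h)^-1 * nrm (f h) <= 11 by apply: le; lra.
  rewrite -mulrA mulrC [_^-1 * _]mulrC => le.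
  have : nrm (f h) / nrm h <= 22 by lra.
  by rewrite ler_pdivrMr.
have pw h k : astar h = h -> nrm (f h) ^+ (2 ^ k) <= 22 * nrm h ^+ (2 ^ k).
  elim: k h => [|k IHk] h hh; first by rewrite !expr1 lin.
  have sq : astar (amul h h) = amul h h by rewrite astarM hh.
  have := IHk (amul h h) sq; have -> : nrm (amul h h) = nrm h ^+ 2 by rewrite -{1}hh nrm_cstar.
  have -> : nrm (f (amul h h)) = nrm (f h) ^+ 2 by rewrite fM -{1}hh fS nrm_cstar.
  by rewrite -!exprM -!expnS.
have sa h : astar h = h -> nrm (f h) <= nrm h.
  move=> hh; have [->|h0] := eqVneq h 0; first by rewrite star_hom0 !nrm0.
  have hn : 0 < nrm h by rewrite lt_neqAle eq_sym nrm_eq0 h0 nrm_ge0.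
  rewrite -[leRHS]mul1r -ler_pdivrMr //.
  apply: (@pow2_le1 R _ 22) => k; rewrite expr_div_n ler_pdivrMr ?exprn_gt0 //.
  apply: (le_trans (pw h k hh)); rewrite ler_wpM2r ?exprn_ge0 ?nrm_ge0 //.
  have : 1 <= (2 ^ k)%:R :> R by rewrite ler1n expn_gt0.
  by lra.
rewrite -(@ler_pXn2r _ 2) // ?nnegrE ?nrm_ge0 // -!nrm_cstar -fS -fM.
by apply: sa; rewrite astarM astarK.
Qed.

End Contractive.

Lemma dual_bounded (R : realType) (A : cstarAlgType R) (om : A -> R[i]) (M : R) :
  (forall c x y, om (c *: x + y) = c * om x + om y) ->
  (forall x, cabs (om x) <= M * nrm x) -> dual om.
Proof.
move=> oml omM; split; first by move=> c x y; rewrite oml.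
have om0 : om 0 = 0 by have := oml 1 0 0; rewrite scaler0 addr0 mul1r -{1}[om 0]addr0 => /addrI.
have omB x y : om (x - y) = om x - om y.
  by rewrite addrC -scaleN1r oml mulN1r addrC.
have M1 : 0 < `|M| + 1 by rewrite ltr_wpDl.
move=> x; apply/(@cvgrPdist_lt _ R[i]^o) => e e0.
have eE : e = (cabs e)%:C%C by apply: cabs_ge0_id; exact: ltW.
have e0' : 0 < cabs e by rewrite -ltcRE -eE.
have d0 : 0 < (cabs e / (`|M| + 1))%:C%C :> R[i].
  by rewrite -[0]/(0%:C%C) ltcRE divr_gt0.
near=> y; rewrite -omB -[`|_|]/(`|_ : R[i]|) cabsE eE ltcRE.
apply: (le_lt_trans (omM _)); apply: (@le_lt_trans _ _ ((`|M| + 1) * nrm (x - y))).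
  by rewrite ler_wpM2r ?nrm_ge0 // (le_trans (ler_norm _)) // lerDl.
rewrite mulrC -ltr_pdivlMr // -ltcRE -nrmE; near: y.
have /cvgrPdist_lt/(_ _ d0) : x0 @[x0 --> x] --> x by [].
exact.
Unshelve. all: end_near. Qed.

Lemma dual_separates (R : realType) (A : cstarAlgType R) (x y : A) :
  (forall phi, dual phi -> phi x = phi y) -> x = y.
Proof.
move=> E; apply/eqP; rewrite -subr_eq0; set z := x - y.
have [om [oml omn _ omz]] := exists_positive_functional z (cseminorm_nrm A).
pose phi a := om (amul (astar z) a).
have dphi : dual phi.
  apply: (@dual_bounded _ _ _ (nrm z)) => [c a b|a].
    by rewrite /phi amulDr oml.
  by rewrite (le_trans (omn _)) // (le_trans (nrm_amul _ _)) // nrm_astar.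
have : phi z = 0.
  have := E phi dphi; rewrite /phi /z amulBr /=.
  by move=> e; rewrite (linB oml) e subrr.
rewrite /phi /= => e; move: omz; rewrite /= e cabs0 mulr0 => le.
by rewrite -nrm_eq0 -sqrf_eq0 eq_le le sqr_ge0.
Qed.

(** * Continuity and compactly supported functions *)

Section ContNrm.
Context (R : realType) (T : topologicalType).

Lemma contP (V : normedModType R[i]) (f : T -> V) :
  continuous f <-> forall x e, 0 < e -> \forall y \near x, nrm (f y - f x) < e.
Proof.
split=> [cf x e e0|P x].
  have e0' : 0 < e%:C%C :> R[i] by rewrite -[0]/(0%:C%C) ltcRE.
  have /cvgrPdist_lt/(_ _ e0') := cf x; apply: filterS => y.
  by rewrite distrC nrmE ltcRE.
apply/cvgrPdist_lt => e e0.
have eE : e = (cabs e)%:C%C by apply: cabs_ge0_id; exact: ltW.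
have e0' : 0 < cabs e by rewrite -ltcRE -eE.
by apply: filterS (P x _ e0') => y lt; rewrite distrC nrmE eE ltcRE.
Qed.

Lemma contrP (f : T -> R) :
  continuous f <-> forall x e, 0 < e -> \forall y \near x, `|f y - f x| < e.
Proof.
split=> [cf x e e0|P x].
  by have /cvgrPdist_lt/(_ _ e0) := cf x; apply: filterS => y; rewrite distrC.
by apply/cvgrPdist_lt => e e0; apply: filterS (P x _ e0) => y; rewrite distrC.
Qed.

Lemma cont_nrm (V : normedModType R[i]) (f : T -> V) : continuous f -> continuous (fun t => nrm (f t)).
Proof.
move=> /contP cf; apply/contrP => x e e0; apply: filterS (cf x e e0) => y.
apply: le_lt_trans; rewrite ler_norml; apply/andP; split.
  have := nrmB (f y) (f y - f x); rewrite opprB addrC subrK; lra.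
have := nrmD (f y - f x) (f x); rewrite subrK; lra.
Qed.

Lemma cont_real (f : T -> R) : continuous f -> continuous (fun t => (f t)%:C%C : R[i]^o).
Proof.
move=> /contrP cf; apply/contP => x e e0; apply: filterS (cf x e e0) => y.
by rewrite nrmc -realcN -realcD cabs_real.
Qed.

Lemma cont_add (V : normedModType R[i]) (f g : T -> V) :
  continuous f -> continuous g -> continuous (fun t => f t + g t).
Proof. by move=> cf cg x; apply: cvgD; [exact: cf|exact: cg]. Qed.

Lemma cont_scale (V : normedModType R[i]) (c : T -> R[i]^o) (f : T -> V) :
  continuous c -> continuous f -> continuous (fun t => (c t : R[i]) *: f t).
Proof. by move=> cf cg x; apply: (@cvgZ _ V _ _ _ c f); [exact: cf|exact: cg]. Qed.

Lemma cont_scalec (V : normedModType R[i]) (c : R[i]) (f : T -> V) :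
  continuous f -> continuous (fun t => c *: f t).
Proof. by move=> cf; apply: cont_scale => // x; exact: cvg_cst. Qed.

Lemma cont_lip (V W : normedModType R[i]) (L : V -> W) (M : R) (f : T -> V) :
  (forall x y, nrm (L x - L y) <= M * nrm (x - y)) ->
  continuous f -> continuous (fun t => L (f t)).
Proof.
move=> lip /contP cf; apply/contP => x e e0.
have M1 : 0 < `|M| + 1 by rewrite ltr_wpDl.
have d0 : 0 < e / (`|M| + 1) by rewrite divr_gt0.
apply: filterS (cf x _ d0) => y; rewrite ltr_pdivlMr // => lt.
apply: (le_lt_trans (lip _ _)); apply: le_lt_trans lt; rewrite mulrC ler_wpM2l ?nrm_ge0 //.
by rewrite (le_trans (ler_norm _)) // lerDl.
Qed.

Lemma cont_amul (A : cstarAlgType R) (f g : T -> A) :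
  continuous f -> continuous g -> continuous (fun t => amul (f t) (g t)).
Proof.
move=> /contP cf /contP cg; apply/contP => x e e0.
have F0 := nrm_ge0 (f x); have G0 := nrm_ge0 (g x).
have d0 : 0 < e / 4 / (nrm (f x) + nrm (g x) + 1).
  by rewrite !divr_gt0 //; lra.
pose d := Num.min 1 (e / 4 / (nrm (f x) + nrm (g x) + 1)).
have dd0 : 0 < d by rewrite lt_min d0 ltr01.
near=> y.
have fy : nrm (f y - f x) < d by near: y; exact: cf.
have gy : nrm (g y - g x) < d by near: y; exact: cg.
have -> : amul (f y) (g y) - amul (f x) (g x) =
    amul (f y - f x) (g y - g x) + (amul (f y - f x) (g x) + amul (f x) (g y - g x)).
  by rewrite addrA -amulAr subrK amulBl amulBr addrA subrK.
have := nrmD (amul (f y - f x) (g y - g x)) (amul (f y - f x) (g x) + amul (f x) (g y - g x)).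
have := nrmD (amul (f y - f x) (g x)) (amul (f x) (g y - g x)).
have := nrm_amul (f y - f x) (g y - g x).
have := nrm_amul (f y - f x) (g x); have := nrm_amul (f x) (g y - g x).
have d1 : d <= 1 by rewrite ge_min lexx.
have d2 : d * (nrm (f x) + nrm (g x) + 1) <= e / 4.
  by rewrite -ler_pdivlMr ?ge_min ?lexx ?orbT //; lra.
have := nrm_ge0 (f y - f x); have := nrm_ge0 (g y - g x).
move: fy gy; move: (nrm (f y - f x)) (nrm (g y - g x)) d2 F0 G0.
move: (nrm (f x)) (nrm (g x)) => Fx Gx a b d2 F0 G0 ad bd b0 a0 h1 h2 h3 h4 h5.
have k1 : Fx * b <= Fx * d by rewrite ler_wpM2l // ltW.
have k2 : a * Gx <= d * Gx by rewrite ler_wpM2r // ltW.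
have k3 : a * b <= d * 1 by rewrite ler_pM // ltW // (lt_le_trans bd).
lra.
Unshelve. all: end_near. Qed.

End ContNrm.

Lemma cont_comp (S T U : topologicalType) (f : S -> T) (g : T -> U) :
  continuous f -> continuous g -> continuous (fun x => g (f x)).
Proof. by move=> cf cg x; apply: continuous_comp; [exact: cf|exact: cg]. Qed.

Lemma cont_pair (S T U : topologicalType) (f : S -> T) (g : S -> U) :
  continuous f -> continuous g -> continuous (fun x => (f x, g x)).
Proof. by move=> cf cg x; apply: cvg_pair; [exact: cf|exact: cg]. Qed.

Lemma cont_cst (S T : topologicalType) (c : T) : continuous (fun _ : S => c).
Proof. by move=> x; exact: cvg_cst. Qed.

Lemma cont_id (T : topologicalType) : continuous (fun x : T => x).
Proof. by move=> x; exact: cvg_id. Qed.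

Lemma cont_fst (S T : topologicalType) : continuous (fun z : S * T => z.1).
Proof. by move=> x; exact: cvg_fst. Qed.
Lemma cont_snd (S T : topologicalType) : continuous (fun z : S * T => z.2).
Proof. by move=> x; exact: cvg_snd. Qed.

Section ContGroup.
Context (G : topologicalGroupType) (T : topologicalType).
Lemma cont_mulg (f g : T -> G) : continuous f -> continuous g ->
  continuous (fun t => (f t * g t)%g).
Proof.
move=> cf cg; apply: (cont_comp (cont_pair cf cg) (@mulg_continuous G)).
Qed.
Lemma cont_invg (f : T -> G) : continuous f -> continuous (fun t => (f t)^-1%g).
Proof. by move=> cf; apply: (cont_comp cf (@invg_continuous G)). Qed.
End ContGroup.

Section ContAct.
Context (R : realType) (G : topologicalGroupType) (A : galgType R G).

Lemma gact_hom t : star_homomorphism (gact t : A -> A).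
Proof.
split; first exact: gact_linear.
  exact: gact_amul.
exact: gact_astar.
Qed.

Lemma gactZD t c a b : gact t (c *: a + b) = c *: gact t a + gact t b :> A.
Proof. exact: gact_linear. Qed.
Lemma gact0 t : gact t 0 = 0 :> A. Proof. exact: star_hom0 (gact_hom t). Qed.
Lemma gactZ t c a : gact t (c *: a) = c *: gact t a :> A. Proof. exact: star_homZ (gact_hom t) _ _. Qed.
Lemma gactB t a b : gact t (a - b) = gact t a - gact t b :> A. Proof. exact: star_homB (gact_hom t) _ _. Qed.

Lemma gactVK t (a : A) : gact t^-1%g (gact t a) = a.
Proof. by rewrite -gactM mulVg gact1. Qed.
Lemma gactKV t (a : A) : gact t (gact t^-1%g a) = a.
Proof. by rewrite -gactM mulgV gact1. Qed.

Lemma nrm_gact t (a : A) : nrm (gact t a) = nrm a.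
Proof.
apply/eqP; rewrite eq_le (star_hom_contractive (gact_hom t)) /=.
by rewrite -{1}(gactVK t a) (star_hom_contractive (gact_hom _)).
Qed.

Lemma cont_gact (T : topologicalType) (u : T -> G) (f : T -> A) :
  continuous u -> continuous f -> continuous (fun t => gact (u t) (f t)).
Proof.
move=> cu /contP cf; apply/contP => x e e0; have e2 : 0 < e / 2 by lra.
have /contP/(_ x _ e2) c2 := cont_comp cu (@gact_continuous R G A (f x)).
near=> y.
have -> : gact (u y) (f y) - gact (u x) (f x) =
    gact (u y) (f y - f x) + (gact (u y) (f x) - gact (u x) (f x)).
  by rewrite gactB addrA subrK.
apply: (le_lt_trans (nrmD _ _)); rewrite nrm_gact.
have h1 : nrm (f y - f x) < e / 2 by near: y; exact: cf.
have h2 : nrm (gact (u y) (f x) - gact (u x) (f x)) < e / 2 by near: y.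
lra.
Unshelve. all: end_near. Qed.

Lemma cont_astar (T : topologicalType) (f : T -> A) :
  continuous f -> continuous (fun t => astar (f t)).
Proof.
apply: (@cont_lip _ _ _ _ _ 1) => x y; rewrite mul1r -astarB nrm_astar //.
Qed.
End ContAct.

Section Cc.
Context (R : realType) (G : topologicalGroupType).
Hypotheses (hausG : hausdorff_space G) (lcG : locally_compact [set: G]).

Lemma Cc_intro (V : normedModType R[i]) (f : G -> V) K : continuous f -> compact K ->
  (forall t, ~ K t -> f t = 0) -> Cc f.
Proof.
move=> cf cK fK; split => //; apply: (subclosed_compact _ cK).
  exact: closed_closure.
have clK : closed K by apply: compact_closed.
rewrite [X in _ `<=` X](closure_id K).1 //; apply: closure_subset => t /= ft.
by apply: contrapT => /fK e; rewrite e eqxx in ft.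
Qed.

Lemma Cc_elim (V : normedModType R[i]) (f : G -> V) : Cc f ->
  exists K, compact K /\ forall t, ~ K t -> f t = 0.
Proof.
move=> [cf cK]; exists (closure [set t | f t != 0]); split=> // t nt.
apply: contrapT => /eqP ft; apply: nt; exact: subset_closure.
Qed.

Lemma bump (x : G) (U : set G) : nbhs x U -> exists g : G -> R,
  [/\ continuous g, forall t, 0 <= g t <= 1, g x = 1 &
    exists K, compact K /\ forall t, g t != 0 -> K t /\ U t].
Proof.
move=> xU; have [W xW cW] : exists2 W, nbhs x W & compact (closure W).
  have := @lcG x Logic.I; rewrite withinET.
  move=> [W xW [cW clW]]; exists W => //.
  by rewrite -(closure_id W).1.
have cr := @locally_compact_completely_regular G R lcG hausG.
pose O := (U `&` W)^°%classic.
have oO : open O by exact: open_interior.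
have xO : O x by rewrite /O /interior /=; exact: filterI.
have sep : uniform_separator [set x] (~` O).
  by apply: cr; [exact: open_closedC|move=> /(_ xO)].
pose f : G -> R := Urysohn [set x] (~` O).
have fx : f x = 0 by apply: (Urysohn_sub0 sep); exists x.
have fO t : ~ O t -> f t = 1 by move=> nO; apply: (Urysohn_sub1 sep); exists t.
exists (fun t => 1 - f t); split.
- move=> t; apply: cvgB; [exact: cvg_cst|exact: Urysohn_continuous].
- move=> t; have : f t \in `[0, 1] by apply: (@Urysohn_range G R [set x] (~` O)); exists t.
  by rewrite in_itv /= => /andP[? ?]; apply/andP; split; lra.
- by rewrite fx subr0.
exists (closure W); split=> // t; rewrite subr_eq0 => ft.
have Ot : O t by apply: contrapT => /fO e; rewrite e eqxx in ft.
by have [Ut Wt] := interior_subset Ot; split => //; exact: subset_closure.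
Qed.

Lemma finite_cover (K : set G) (U : G -> set G) : (forall x, nbhs x (U x)) ->
  compact K -> exists s : seq G, (forall x, x \in s -> K x) /\
    forall t, K t -> exists2 x, x \in s & U x t.
Proof.
move=> xU; rewrite compact_near_coveringP => nc.
pose F : set_system (seq G) := fun S => exists s : seq G, forall s', {subset s <= s'} -> S s'.
have FF : Filter F.
  split; first by exists [::].
    move=> S S' [s sS] [s' s'S]; exists (s ++ s') => r sr; split.
      by apply: sS => x xs; apply: sr; rewrite mem_cat xs.
    by apply: s'S => x xs; apply: sr; rewrite mem_cat xs orbT.
  by move=> S S' SS' [s sS]; exists s => r /sS /SS'.
have [x Kx|s sP] := nc (seq G) F (fun s t => exists x, [/\ x \in s, K x & U x t]) FF.
  exists (U x, [set s : seq G | x \in s]); first split => //=.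
    by exists [:: x] => s; apply; rewrite mem_head.
  by move=> [t s] /= [Uxt xs]; exists x.
exists [seq x <- s | `[<K x>]]; split=> [x|t Kt].
  by rewrite mem_filter => /andP[/asboolP].
have [x [xs Kx Uxt]] := sP s (fun _ h => h) t Kt.
by exists x => //; rewrite mem_filter xs andbT; apply/asboolP.
Qed.

Lemma bump_finite (K : set G) (P : G -> set G) : compact K ->
  (forall x, K x -> nbhs x (P x)) ->
  exists (s : seq G) (g : G -> G -> R), [/\
    (forall x, x \in s -> K x),
    (forall x, continuous (g x)),
    (forall x t, 0 <= g x t),
    (forall x, exists K', compact K' /\ forall t, g x t != 0 -> K' t /\ (K x -> P x t)) &
    (forall t, K t -> 1 / 2 < \sum_(x <- s) g x t)].
Proof.
move=> cK KP.
have H x : exists g : G -> R, [/\ continuous g, forall t, 0 <= g t, g x = 1 &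
    exists K', compact K' /\ forall t, g t != 0 -> K' t /\ (K x -> P x t)].
  have [Kx|nKx] := pselect (K x).
    have [g [cg g01 gx [K' [cK' K'P]]]] := bump (KP x Kx).
    exists g; split=> // [t|]; first by case/andP: (g01 t).
    by exists K'; split=> // t /K'P[].
  have [g [cg g01 gx [K' [cK' K'P]]]] := bump (filterT : nbhs x [set: G]).
  exists g; split=> // [t|]; first by case/andP: (g01 t).
  by exists K'; split=> // t /K'P[].
have [g gP] := choice H.
pose U x := [set t | 1 / 2 < g x t].
have oU x : open (U x).
  have [cg _ _ _] := gP x.
  rewrite (_ : U x = g x @^-1` [set r | 1 / 2 < r]) //.
  by apply: open_comp; [move=> t _; exact: cg|exact: open_gt].
have xU x : nbhs x (U x).
  by apply: open_nbhs_nbhs; split; [exact: oU|have [_ _ e _] := gP x; rewrite /U /= e; lra].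
have [D [DK Dcov]] := finite_cover xU cK.
exists D, g; split.
- by move=> x xD; exact: DK.
- by move=> x; case: (gP x).
- by move=> x; case: (gP x).
- by move=> x; case: (gP x).
move=> t Kt; have [x xD Uxt] := Dcov t Kt.
apply: (lt_le_trans Uxt); rewrite (big_rem x) //= lerDl.
by apply: sumr_ge0 => y _; case: (gP y).
Qed.

Definition Ccr (f : G -> R) := Cc (fun t => (f t)%:C%C : R[i]^o).

Lemma Ccr_intro (f : G -> R) K : continuous f -> compact K ->
  (forall t, ~ K t -> f t = 0) -> Ccr f.
Proof.
move=> cf cK fK; apply: (Cc_intro (K := K)) => // [|t /fK ->//].
exact: cont_real.
Qed.

Lemma contr_sum (s : seq G) (g : G -> G -> R) : (forall x, continuous (g x)) ->
  continuous (fun t => \sum_(x <- s) g x t).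
Proof.
move=> cg; elim: s => [|x s IHs].
  by rewrite (_ : (fun t => _) = fun=> 0); [exact: cont_cst|apply/funext => t; rewrite big_nil].
rewrite (_ : (fun t => _) = fun t => g x t + \sum_(x <- s) g x t); last first.
  by apply/funext => t; rewrite big_cons.
by move=> t; apply: cvgD; [exact: cg|exact: IHs].
Qed.

Lemma partition_unity0 (K : set G) (P : G -> set G) : compact K ->
  (forall x, K x -> nbhs x (P x)) ->
  exists (s : seq G) (g : G -> G -> R), [/\
    (forall x, x \in s -> K x),
    (forall x, Ccr (g x)) /\ (forall x, continuous (g x)),
    (forall x t, 0 <= g x t),
    (forall x t, K x -> g x t != 0 -> P x t) &
    (forall t, \sum_(x <- s) g x t <= 1) /\
    (forall t, K t -> \sum_(x <- s) g x t = 1)].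
Proof.
move=> cK KP; have [s [g [sK cg g0 gP gS]]] := bump_finite cK KP.
(* the maximum with 1/2 allows to divide where the sum of the bumps vanishes *)
pose S t := \sum_(x <- s) g x t; pose m t := Num.max (1 / 2) (S t).
have m0 t : 0 < m t by rewrite lt_max; apply/orP; left; lra.
have cm : continuous m.
  move=> t; apply: (@continuous_max R G (fun=> 1 / 2) S t); first exact: cvg_cst.
  exact: contr_sum.
have ch x : continuous (fun t => g x t / m t).
  move=> t; apply: cvgM; first exact: cg.
  by apply: cvgV; [rewrite gt_eqF|exact: cm].
exists s, (fun x t => g x t / m t); split=> //.
- split=> // x; have [K' [cK' K'P]] := gP x.
  apply: (@Ccr_intro _ K') => // t nt.
  have [->|gt] := eqVneq (g x t) 0; first by rewrite mul0r.
  by have [] := K'P t gt.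
- by move=> x t; rewrite divr_ge0 // ltW.
- move=> x t Kx; rewrite mulf_eq0 negb_or => /andP[gt _].
  by have [K' [_ /(_ t gt)[_ ]]] := gP x; exact.
split=> [t|t Kt]; rewrite -mulr_suml -/(S t).
  by rewrite ler_pdivrMr // mul1r le_max lexx orbT.
have -> : m t = S t by rewrite /m max_r // ltW // gS.
by rewrite divff // gt_eqF // (lt_trans _ (gS t Kt)).
Qed.

Lemma Urysohn_Cc (K : set G) : compact K -> exists k : G -> R,
  [/\ Ccr k, continuous k, forall t, 0 <= k t <= 1 & forall t, K t -> k t = 1].
Proof.
move=> cK; have [|s [g [sK [Cg cg] g0 gP [gS1 gS]]]] := @partition_unity0 K (fun=> setT) cK.
  by move=> x _; exact: filterT.
exists (fun t => \sum_(x <- s) g x t); split=> //.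
  have [K' [cK' K'P]] : exists K', compact K' /\ forall x t, x \in s -> ~ K' t -> g x t = 0.
    elim: (s) => [|x s' [K' [cK' K'P]]]; first by exists set0; split => //; exact: compact0.
    have [K'' [cK'' K''P]] := Cc_elim (Cg x).
    exists (K' `|` K''); split; first exact: compactU.
    move=> y t; rewrite inE => /predU1P[->|ys] /not_orP[n1 n2]; last exact: K'P.
    by apply: realcI; exact: K''P.
  have cS : continuous (fun t => \sum_(x <- s) g x t) by exact: contr_sum.
  apply: (Ccr_intro cS cK') => // t nt.
  by rewrite big_seq big1 // => x xs; exact: K'P.
  exact: contr_sum.
by move=> t; rewrite gS1 andbT; apply: sumr_ge0.
Qed.

(** The bound [k] is chosen before the neighborhoods [P]: it serves for all
    partitions as these shrink, so that errors can be integrated uniformly. *)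
Lemma partition_unity (K : set G) : compact K -> exists k : G -> R,
  [/\ Ccr k, (forall t, 0 <= k t) & forall P, (forall x, K x -> nbhs x (P x)) ->
  exists (s : seq G) (g : G -> G -> R), [/\
    (forall x, x \in s -> K x),
    (forall x, Ccr (g x)),
    (forall x t, 0 <= g x t),
    (forall x t, K x -> g x t != 0 -> P x t) &
    (forall t, \sum_(x <- s) g x t <= k t) /\
    (forall t, K t -> \sum_(x <- s) g x t = 1)]].
Proof.
move=> cK; have [k [Ck ck k01 kK]] := Urysohn_Cc cK.
exists k; split=> // [t|P KP]; first by case/andP: (k01 t).
have [s [g [sK [Cg cg] g0 gP [gS1 gS]]]] := partition_unity0 cK KP.
exists s, (fun x t => k t * g x t); split=> //.
- move=> x; have [K' [cK' K'P]] := Cc_elim Ck.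
  apply: (@Ccr_intro _ K') => // [t|t /K'P /realcI ->]; last by rewrite mul0r.
  by apply: cvgM; [exact: ck|exact: cg].
- by move=> x t; rewrite mulr_ge0 //; case/andP: (k01 t).
- move=> x t Kx; rewrite mulf_eq0 negb_or => /andP[_]; exact: gP.
split=> [t|t Kt]; rewrite -mulr_sumr; last by rewrite gS // kK // mulr1.
by rewrite ler_piMr //; case/andP: (k01 t).
Qed.

(** Uniform continuity in the compact variable, by the tube lemma. *)
Lemma tube (T : topologicalType) (V : normedModType R[i]) (H : G -> T -> V) K t0 e :
  compact K -> continuous (fun z : G * T => H z.1 z.2) ->
  (forall s t, ~ K s -> H s t = 0) -> 0 < e ->
  \forall t \near t0, forall s, nrm (H s t - H s t0) < e.
Proof.
move=> cK cH HK e0.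
have := cK; rewrite compact_near_coveringP => nc.
have e2 : 0 < e / 2 by lra.
have cH0 : continuous (fun z : G * T => H z.1 t0).
  exact: (cont_comp (cont_pair (@cont_fst _ _) (@cont_cst _ _ t0)) cH).
have nn s : K s -> \forall s' \near s & t \near t0, nrm (H s' t - H s' t0) < e.
  move=> Ks; have /contP /(_ (s, t0) _ e2) n1 := cH.
  have /contP /(_ (s, t0) _ e2) n2 := cH0.
  apply: filterS (filterI n1 n2) => -[s' t] /= [h1 h2].
  have := nrmB (H s' t - H s t0) (H s' t0 - H s t0).
  rewrite opprB addrA subrK; lra.
apply: filterS (nc T (nbhs t0) (fun t s => nrm (H s t - H s t0) < e) _ nn) => t Ut s.
have [Ks|nKs] := pselect (K s); first exact: Ut.
by rewrite !HK // subrr nrm0.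
Qed.

End Cc.

(** * Integration of compactly supported functions *)

Section Haar.
Context (R : realType) (G : topologicalGroupType).
Hypotheses (hausG : hausdorff_space G) (lcG : locally_compact [set: G]).
Context (I : (G -> R[i]) -> R[i]) (haarI : haar_integral I).

Let Ccr := @Ccr R G.

Lemma Cc0 (V : normedModType R[i]) : Cc (fun _ : G => 0 : V).
Proof.
apply: (Cc_intro hausG (K := set0)) => //; first exact: cont_cst.
exact: compact0.
Qed.

Lemma Cc_lin (V : normedModType R[i]) (c : R[i]) (f g : G -> V) :
  Cc f -> Cc g -> Cc (fun t => c *: f t + g t).
Proof.
move=> Cf Cg; have [K [cK KP]] := Cc_elim Cf; have [K' [cK' KP']] := Cc_elim Cg.
apply: (Cc_intro hausG (K := K `|` K')); last first.
- by move=> t /not_orP[n1 n2]; rewrite KP // KP' // scaler0 addr0.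
- exact: compactU.
apply: cont_add; last by case: Cg.
by apply: cont_scalec; case: Cf.
Qed.

Lemma CcD (V : normedModType R[i]) (f g : G -> V) :
  Cc f -> Cc g -> Cc (fun t => f t + g t).
Proof.
move=> Cf Cg; have := Cc_lin 1 Cf Cg.
by congr Cc; apply/funext => t; rewrite scale1r.
Qed.

Lemma CcZ (V : normedModType R[i]) (c : R[i]) (f : G -> V) : Cc f -> Cc (fun t => c *: f t).
Proof.
move=> Cf; have := Cc_lin c Cf (@Cc0 V).
by congr Cc; apply/funext => t; rewrite addr0.
Qed.

Lemma CcB (V : normedModType R[i]) (f g : G -> V) :
  Cc f -> Cc g -> Cc (fun t => f t - g t).
Proof.
move=> Cf Cg; have := Cc_lin (-1) Cg Cf.
by congr Cc; apply/funext => t; rewrite scaleN1r addrC.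
Qed.

Lemma Cc_sum (V : normedModType R[i]) (T : eqType) (s : seq T) (f : T -> G -> V) :
  (forall x, x \in s -> Cc (f x)) -> Cc (fun t => \sum_(x <- s) f x t).
Proof.
elim: s => [|x s IHs] P.
  have := @Cc0 V; congr Cc; apply/funext => t; by rewrite big_nil.
have := CcD (P x (mem_head _ _)) (IHs (fun y ys => P y (mem_behead (s := x :: s) ys))).
by congr Cc; apply/funext => t; rewrite big_cons.
Qed.

Lemma Cc_comp (V W : normedModType R[i]) (L : V -> W) (f : G -> V) :
  L 0 = 0 -> continuous (fun t => L (f t)) -> Cc f -> Cc (fun t => L (f t)).
Proof.
move=> L0 cL Cf; have [K [cK KP]] := Cc_elim Cf.
by apply: (Cc_intro hausG (K := K)) => // t /KP ->.
Qed.

Lemma Ccr_nrm (V : normedModType R[i]) (f : G -> V) : Cc f -> Ccr (fun t => nrm (f t)).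
Proof.
move=> Cf; apply: (@Cc_comp V R[i]^o (fun v => (nrm v)%:C%C)) => //; first by rewrite nrm0.
by apply/cont_real/cont_nrm; case: Cf.
Qed.

Lemma Cc_scale (V : normedModType R[i]) (h : G -> R) (v : V) :
  Ccr h -> Cc (fun t => (h t)%:C%C *: v).
Proof.
move=> Ch; apply: (@Cc_comp R[i]^o V (fun c : R[i] => c *: v)) => //.
  by rewrite scale0r.
by apply: cont_scale; [case: Ch|exact: cont_cst].
Qed.

Definition J (f : G -> R) : R := complex.Re (I (fun t => (f t)%:C%C)).

Lemma I_lin (c : R[i]) (f g : G -> R[i]^o) : Cc f -> Cc g ->
  I (fun t => c * f t + g t) = c * I f + I g.
Proof. by case: haarI => H _ _ _; exact: H. Qed.

Lemma I0 : I (fun=> 0) = 0.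
Proof.
have : I (fun=> 0) = I (fun=> 0) + I (fun=> 0).
  rewrite -{2}[I _]mul1r -(I_lin 1 (@Cc0 R[i]^o) (@Cc0 R[i]^o)).
  by congr I; apply/funext => t; rewrite mulr0 addr0.
by rewrite -{1}[I _]addr0 => /addrI.
Qed.
Lemma I_Z (c : R[i]) (f : G -> R[i]^o) : Cc f -> I (fun t => c * f t) = c * I f.
Proof.
move=> Cf; have := I_lin c Cf (@Cc0 R[i]^o); rewrite I0 addr0 => <-.
by congr I; apply/funext => t; rewrite addr0.
Qed.
Lemma I_Zr (c : R[i]) (f : G -> R[i]^o) : Cc f -> I (fun t => f t * c) = I f * c.
Proof.
move=> Cf; rewrite mulrC -I_Z //; congr I; apply/funext => t; exact: mulrC.
Qed.
Lemma I_D (f g : G -> R[i]^o) : Cc f -> Cc g -> I (fun t => f t + g t) = I f + I g.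
Proof.
move=> Cf Cg; have := I_lin 1 Cf Cg; rewrite mul1r => <-.
by congr I; apply/funext => t; rewrite mul1r.
Qed.
Lemma I_B (f g : G -> R[i]^o) : Cc f -> Cc g -> I (fun t => f t - g t) = I f - I g.
Proof.
move=> Cf Cg; have := I_lin (-1) Cg Cf; rewrite mulN1r addrC => <-.
by congr I; apply/funext => t; rewrite mulN1r addrC.
Qed.
Lemma I_sum (T : eqType) (s : seq T) (f : T -> G -> R[i]^o) :
  (forall x, x \in s -> Cc (f x)) ->
  I (fun t => \sum_(x <- s) f x t) = \sum_(x <- s) I (f x).
Proof.
elim: s => [|x s IHs] P.
  transitivity (I (fun=> 0)); last by rewrite big_nil I0.
  by congr I; apply/funext => t; rewrite big_nil.
have P' y : y \in s -> Cc (f y) by move=> ys; apply: P; rewrite inE ys orbT.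
rewrite big_cons -IHs // -I_D; [|exact: (P x (mem_head _ _))|exact: (@Cc_sum R[i]^o)].
by congr I; apply/funext => t; rewrite big_cons.
Qed.

Lemma I_ge0 (f : G -> R[i]^o) : Cc f -> (forall s, 0 <= (f s : R[i])) -> 0 <= I f.
Proof. by case: haarI => _ H _ _; exact: H. Qed.

Lemma I_left t (f : G -> R[i]^o) : Cc f -> I (fun s => f (t * s)%g) = I f.
Proof. by case: haarI => _ _ H _; exact: H. Qed.

(** [I] is only assumed to be positive on nonnegative functions; a real function is
    the difference of two of them. *)
Lemma J_real f : Ccr f -> I (fun t => (f t)%:C%C) = (J f)%:C%C.
Proof.
move=> Cf.
have Ca : Ccr (fun t => `|f t|).
  have := Ccr_nrm Cf; congr Ccr; apply/funext => t; exact: cabs_real.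
have Cd : Ccr (fun t => `|f t| - f t).
  have := CcB Ca Cf; congr Cc; apply/funext => t; by rewrite realcD realcN.
have Ra : I (fun t => (`|f t|)%:C%C) = (complex.Re (I (fun t => (`|f t|)%:C%C)))%:C%C.
  by apply: ger0_complexE; apply: I_ge0 => // s; rewrite -[0]/(0%:C%C) lecRE.
have Rd : I (fun t => (`|f t| - f t)%:C%C) = (complex.Re (I (fun t => (`|f t| - f t)%:C%C)))%:C%C.
  apply: ger0_complexE; apply: I_ge0 => // s.
  by rewrite -[0]/(0%:C%C) lecRE subr_ge0 ler_norm.
have E : I (fun t => (f t)%:C%C) = I (fun t => (`|f t|)%:C%C) - I (fun t => (`|f t| - f t)%:C%C).
  rewrite -I_B //; congr I; apply/funext => t.
  by rewrite -realcN -realcD opprB addrC subrK.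
by rewrite /J E Ra Rd -realcN -realcD.
Qed.

Lemma CcrD f g : Ccr f -> Ccr g -> Ccr (fun t => f t + g t).
Proof. by move=> Cf Cg; have := CcD Cf Cg; congr Cc; apply/funext => t; rewrite realcD. Qed.
Lemma CcrB f g : Ccr f -> Ccr g -> Ccr (fun t => f t - g t).
Proof.
by move=> Cf Cg; have := CcB Cf Cg; congr Cc; apply/funext => t; rewrite realcD realcN.
Qed.
Lemma CcrZ c f : Ccr f -> Ccr (fun t => c * f t).
Proof. by move=> Cf; have := CcZ c%:C%C Cf; congr Cc; apply/funext => t; rewrite realcM. Qed.

Lemma JD f g : Ccr f -> Ccr g -> J (fun t => f t + g t) = J f + J g.
Proof.
move=> Cf Cg; rewrite /J -ReD -I_D //; congr (complex.Re (I _)).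
by apply/funext => t; rewrite realcD.
Qed.
Lemma JB f g : Ccr f -> Ccr g -> J (fun t => f t - g t) = J f - J g.
Proof.
move=> Cf Cg; rewrite /J -ReB -I_B //; congr (complex.Re (I _)).
by apply/funext => t; rewrite realcD realcN.
Qed.
Lemma JZ c f : Ccr f -> J (fun t => c * f t) = c * J f.
Proof.
move=> Cf; rewrite /J -ReZ -I_Z //; congr (complex.Re (I _)).
by apply/funext => t; rewrite realcM.
Qed.

Lemma J_ge0 f : Ccr f -> (forall t, 0 <= f t) -> 0 <= J f.
Proof.
move=> Cf f0; rewrite -lecRE -J_real //; apply: I_ge0 => // s.
by rewrite -[0]/(0%:C%C) lecRE.
Qed.

Lemma J_mono f g : Ccr f -> Ccr g -> (forall t, f t <= g t) -> J f <= J g.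
Proof.
move=> Cf Cg fg; rewrite -subr_ge0 -JB //; apply: J_ge0; first exact: CcrB.
by move=> t; rewrite subr_ge0.
Qed.

Definition L1 (V : normedModType R[i]) (f : G -> V) : R := J (fun t => nrm (f t)).

Lemma Ccr_Re (f : G -> R[i]^o) : Cc f -> Ccr (fun t => complex.Re (f t)).
Proof.
move=> Cf; have [K [cK KP]] := Cc_elim Cf; have [cf _] := Cf.
apply: (Ccr_intro hausG _ cK) => [|t nt]; last by rewrite KP.
apply/contrP => x e e0; have /contP/(_ x e e0) := cf; apply: filterS => y.
apply: le_lt_trans; rewrite nrmc -ReB ler_norml Re_le_cabs andbT.
by rewrite lerNl -ReN -[leRHS]cabsN Re_le_cabs.
Qed.

(** Rotating [f] so that its integral is nonnegative reduces the estimate to the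
    real part. *)
Lemma I_abs (f : G -> R[i]^o) : Cc f -> cabs (I f) <= L1 f.
Proof.
move=> Cf; have [e|ne] := eqVneq (cabs (I f)) 0.
  by rewrite e; apply: J_ge0; [exact: Ccr_nrm|move=> t; exact: nrm_ge0].
have o0 : I f != 0 by rewrite -cabs_eq0.
pose c := (cabs (I f))%:C%C / I f.
have c1 : cabs c = 1 by rewrite cabsM cabsV cabs_real ger0_norm ?cabs_ge0 // divff.
have e : I (fun t => c * f t) = (cabs (I f))%:C%C by rewrite I_Z // divfK.
pose u t := complex.Re (c * f t); pose v t := complex.Im (c * f t).
have Ccf : Cc (fun t => c * f t : R[i]^o) by exact: (@CcZ R[i]^o).
have Cu : Ccr u by exact: Ccr_Re Ccf.
have Cv : Ccr v.
  have Ci : Cc (fun t => (- 'i) * (c * f t) : R[i]^o) by exact: (@CcZ R[i]^o).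
  have := Ccr_Re Ci; congr Ccr; apply/funext => t; rewrite /v.
  by case: (c * f t) => a b; rewrite -complexiE /= oppr0 mul0r sub0r mulN1r opprK.
have Iv : Cc (fun t => 'i * (v t)%:C%C : R[i]^o) by exact: (@CcZ R[i]^o 'i _ Cv).
have E : I (fun t => c * f t) = (J u)%:C%C + 'i * (J v)%:C%C.
  rewrite -!J_real // -I_Z // -I_D //; congr I; apply/funext => t.
  by rewrite {1}[c * f t]complexE -complexiE.
have -> : cabs (I f) = J u.
  have := congr1 (@complex.Re R) (esym e); rewrite ReC E => ->.
  by rewrite -complexiE /= mul0r mul1r subr0 addr0.
apply: J_mono => //; first exact: Ccr_nrm.
move=> t; rewrite /u (le_trans (Re_le_cabs _)) // cabsM c1 mul1r //.
Qed.

Lemma L1E (V : normedModType R[i]) (f : G -> V) : L1 f = complex.Re (I (fun s => `|f s|)).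
Proof. by rewrite /L1 /J; congr (complex.Re (I _)); apply/funext => t; rewrite nrmE. Qed.

Lemma L1_ge0 (V : normedModType R[i]) (f : G -> V) : Cc f -> 0 <= L1 f.
Proof. by move=> Cf; apply: J_ge0; [exact: Ccr_nrm|move=> t; exact: nrm_ge0]. Qed.

Lemma L1_le (V : normedModType R[i]) (f : G -> V) (g : G -> R) :
  Cc f -> Ccr g -> (forall t, nrm (f t) <= g t) -> L1 f <= J g.
Proof. by move=> Cf Cg; apply: J_mono => //; exact: Ccr_nrm. Qed.

Lemma Cc_trans (V : normedModType R[i]) (f : G -> V) (u v : G -> G) :
  continuous u -> continuous v -> cancel u v -> Cc f -> Cc (fun s => f (u s)).
Proof.
move=> cu cv uv Cf; have [K [cK KP]] := Cc_elim Cf.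
apply: (Cc_intro hausG (K := v @` K)).
- by apply: (cont_comp cu); case: Cf.
- by apply: continuous_compact => //; exact: continuous_subspaceT.
by move=> t nt; apply: KP => Kt; apply: nt; exists (u t).
Qed.

Lemma cont_mull (t : G) : continuous (fun s : G => (t * s)%g).
Proof. exact: cont_mulg (@cont_cst _ _ t) (@cont_id _). Qed.
Lemma cont_mulr (t : G) : continuous (fun s : G => (s * t)%g).
Proof. exact: cont_mulg (@cont_id _) (@cont_cst _ _ t). Qed.

Lemma Cc_left (V : normedModType R[i]) t (f : G -> V) : Cc f -> Cc (fun s => f (t * s)%g).
Proof.
apply: (@Cc_trans _ _ _ (fun s => t^-1 * s)%g); [exact: cont_mull|exact: cont_mull|].
by move=> s; rewrite mulKg.
Qed.
Lemma Cc_right (V : normedModType R[i]) t (f : G -> V) : Cc f -> Cc (fun s => f (s * t)%g).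
Proof.
apply: (@Cc_trans _ _ _ (fun s => s * t^-1)%g); [exact: cont_mulr|exact: cont_mulr|].
by move=> s; rewrite mulgK.
Qed.
Lemma Cc_inv (V : normedModType R[i]) (f : G -> V) : Cc f -> Cc (fun s => f (s^-1)%g).
Proof.
apply: (@Cc_trans _ _ _ (fun s => s^-1)%g).
- exact: cont_invg (@cont_id _).
- exact: cont_invg (@cont_id _).
by move=> s; rewrite invgK.
Qed.

(** A partition of unity subordinate to the sets where [F] varies by less than [e]
    approximates [F t th] by the sums of [g x t * F x th], for all parameters [th]
    at once. The last estimate bounds the total mass of these sums independently
    of how fine the partition is. *)
Lemma riemann_sums (K : set G) : compact K -> exists k : G -> R,
  [/\ Ccr k, (forall t, 0 <= k t) &
  forall (T : Type) (V : normedModType R[i]) (F : G -> T -> V),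
   (forall s th, ~ K s -> F s th = 0) ->
   (forall s e, 0 < e -> \forall s' \near s, forall th, nrm (F s' th - F s th) < e) ->
   forall e, 0 < e -> exists (s : seq G) (g : G -> G -> R),
   [/\ (forall x, Ccr (g x)), (forall x t, 0 <= g x t),
       (forall t th, nrm (F t th - \sum_(x <- s) (g x t)%:C%C *: F x th) <= e * k t) &
       forall t th, \sum_(x <- s) g x t * nrm (F x th) <= nrm (F t th) + e * k t]].
Proof.
move=> cK; have [k [Ck k0 kP]] := partition_unity R hausG lcG cK.
exists k; split=> // T V F FK Fu e e0.
pose P (x : G) := [set t | forall th, nrm (F t th - F x th) < e].
have [|s [g [sK Cg g0 gP [gk gS]]]] := kP P.
  by move=> x Kx; exact: Fu.
have main t th : \sum_(x <- s) g x t * nrm (F t th - F x th) <= e * \sum_(x <- s) g x t.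
  rewrite mulr_sumr big_seq [leRHS]big_seq.
  apply: ler_sum => x xs; rewrite [leRHS]mulrC.
  have [->|gt] := eqVneq (g x t) 0; first by rewrite !mul0r.
  by rewrite ler_wpM2l // ltW //; exact: (gP x t (sK x xs) gt).
exists s, g; split=> // t th; last first.
  apply: (@le_trans _ _ (\sum_(x <- s) (g x t * nrm (F t th) + g x t * nrm (F t th - F x th)))).
    apply: ler_sum => x _; rewrite -mulrDr ler_wpM2l //.
    by have := nrmB (F t th) (F t th - F x th); rewrite opprB addrC subrK.
  rewrite big_split /=; apply: lerD; last first.
    by apply: (le_trans (main t th)); rewrite ler_pM2l.
  rewrite -mulr_suml; have [Kt|nKt] := pselect (K t); first by rewrite gS // mul1r.
  by rewrite FK // nrm0 mulr0.
have est : nrm (\sum_(x <- s) (g x t)%:C%C *: (F t th - F x th)) <= e * \sum_(x <- s) g x t.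
  apply: (le_trans (nrm_sum _ _ _)); apply: le_trans (main t th).
  by apply: ler_sum => x _; rewrite nrmZ cabs_real ger0_norm.
have E : \sum_(x <- s) (g x t)%:C%C *: (F t th - F x th) =
    (\sum_(x <- s) g x t)%:C%C *: F t th - \sum_(x <- s) (g x t)%:C%C *: F x th.
  rewrite rmorph_sum scaler_suml -sumrB; apply: eq_bigr => x _.
  by rewrite scalerBr.
have -> : F t th - \sum_(x <- s) (g x t)%:C%C *: F x th =
    \sum_(x <- s) (g x t)%:C%C *: (F t th - F x th).
  rewrite E; have [Kt|nKt] := pselect (K t); first by rewrite gS // scale1r.
  by rewrite FK // scaler0.
by apply: (le_trans est); rewrite ler_pM2l.
Qed.

(** The Haar functional, the integral of vector-valued functions and the maps
    g |-> om (f^* g) are of this kind. Having one notion for them yields continuity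
    under the integral and the exchange of integrals once and for all. *)
Definition L1_bounded (V V' : normedModType R[i]) (W : (G -> V) -> V') (M : R) :=
  [/\ forall c f g, Cc f -> Cc g -> W (fun t => c *: f t + g t) = c *: W f + W g,
      0 <= M & forall f, Cc f -> nrm (W f) <= M * L1 f].

Section Bounded.
Context (V V' : normedModType R[i]) (W : (G -> V) -> V') (M : R).
Hypothesis HW : L1_bounded W M.

Lemma bd_0 : W (fun=> 0) = 0.
Proof.
have [Wl _ _] := HW.
have : W (fun=> 0) = W (fun=> 0) + W (fun=> 0).
  rewrite -{2}[W _]scale1r -Wl ?Cc0 //; try exact: Cc0.
  by congr W; apply/funext => t; rewrite scaler0 addr0.
by rewrite -{1}[W _]addr0 => /addrI.
Qed.
Lemma bd_Z c f : Cc f -> W (fun t => c *: f t) = c *: W f.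
Proof.
move=> Cf; have [Wl _ _] := HW; have := Wl c f _ Cf (@Cc0 V); rewrite bd_0 addr0 => <-.
by congr W; apply/funext => t; rewrite addr0.
Qed.
Lemma bd_D f g : Cc f -> Cc g -> W (fun t => f t + g t) = W f + W g.
Proof.
move=> Cf Cg; have [Wl _ _] := HW; rewrite -[W f]scale1r -Wl //.
by congr W; apply/funext => t; rewrite scale1r.
Qed.
Lemma bd_B f g : Cc f -> Cc g -> W (fun t => f t - g t) = W f - W g.
Proof.
move=> Cf Cg; have [Wl _ _] := HW; have := Wl (-1) g f Cg Cf.
rewrite scaleN1r addrC => <-; congr W; apply/funext => t.
by rewrite scaleN1r addrC.
Qed.
Lemma bd_sum (T : eqType) (s : seq T) (f : T -> G -> V) :
  (forall x, x \in s -> Cc (f x)) ->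
  W (fun t => \sum_(x <- s) f x t) = \sum_(x <- s) W (f x).
Proof.
elim: s => [|x s IHs] P.
  transitivity (W (fun=> 0)); last by rewrite big_nil bd_0.
  by congr W; apply/funext => t; rewrite big_nil.
have P' y : y \in s -> Cc (f y) by move=> ys; apply: P; rewrite inE ys orbT.
rewrite big_cons -IHs // -bd_D //; [|exact: (P x (mem_head _ _))|exact: Cc_sum].
by congr W; apply/funext => t; rewrite big_cons.
Qed.
Lemma bd_le f g : Cc f -> Ccr g -> (forall t, nrm (f t) <= g t) -> nrm (W f) <= M * J g.
Proof.
move=> Cf Cg fg; have [_ M0 Wb] := HW; apply: (le_trans (Wb f Cf)).
by rewrite ler_wpM2l // L1_le.
Qed.

Lemma bd_cont (T : topologicalType) (H : G -> T -> V) K : compact K ->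
  continuous (fun z : G * T => H z.1 z.2) -> (forall s t, ~ K s -> H s t = 0) ->
  continuous (fun t => W (fun s => H s t)).
Proof.
move=> cK cH HK; apply/contP => t0 e e0.
have [k [Ck ck k01 kK]] := Urysohn_Cc R hausG lcG cK.
have k0 t : 0 <= k t by case/andP: (k01 t).
have [_ M0 _] := HW.
have MJ : 0 <= M * J k by rewrite mulr_ge0 // J_ge0.
have CH t : Cc (fun s => H s t).
  apply: (Cc_intro hausG (K := K)) => // [|s]; last exact: HK.
  exact: (cont_comp (cont_pair (@cont_id _) (@cont_cst _ _ t)) cH).
have d0 : 0 < e / 2 / (M * J k + 1) by rewrite !divr_gt0 //; lra.
apply: filterS (tube t0 cK cH HK d0) => t Ht.
rewrite -bd_B //; apply: (@le_lt_trans _ _ (M * J (fun s => e / 2 / (M * J k + 1) * k s))).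
  apply: bd_le; [exact: CcB|exact: CcrZ|].
  move=> s; have [Ks|nKs] := pselect (K s); first by rewrite kK // mulr1 ltW.
  by rewrite !HK // subrr nrm0 mulr_ge0 // ltW.
rewrite JZ // mulrCA; apply: (@le_lt_trans _ _ (e / 2)); last by lra.
rewrite mulrAC -mulrA ler_piMr //; first by lra.
by rewrite ler_pdivrMr ?mul1r; lra.
Qed.

Lemma bd_Cc (H : G -> G -> V) K1 K2 : compact K1 -> compact K2 ->
  continuous (fun z : G * G => H z.1 z.2) -> (forall s t, ~ K1 s -> H s t = 0) ->
  (forall s t, ~ K2 t -> H s t = 0) ->
  Cc (fun t => W (fun s => H s t)).
Proof.
move=> cK1 cK2 cH HK1 HK2; apply: (Cc_intro hausG (K := K2)) => //.
  exact: bd_cont cK1 cH HK1.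
move=> t nt; rewrite (_ : (fun s => H s t) = fun=> 0) ?bd_0 //.
by apply/funext => s; rewrite HK2.
Qed.
End Bounded.

Lemma I_bounded : @L1_bounded R[i]^o R[i]^o I 1.
Proof.
split=> // [c f g Cf Cg|f Cf]; first exact: I_lin.
by rewrite mul1r nrmc I_abs.
Qed.

Lemma small_eq (x y : R[i]) (M : R) : (forall e, 0 < e -> cabs (x - y) <= M * e) -> x = y.
Proof.
move=> P; apply/eqP; rewrite -subr_eq0 -cabs_eq0 eq_le cabs_ge0 andbT.
have M1 : 0 < `|M| + 1 by rewrite ltr_wpDl.
apply/ler_addgt0Pr => e e0; rewrite add0r.
have d0 : 0 < e / (`|M| + 1) by rewrite divr_gt0.
apply: (le_trans (P _ d0)).
apply: (@le_trans _ _ ((`|M| + 1) * (e / (`|M| + 1)))).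
  by rewrite ler_wpM2r ?(ltW d0) // (le_trans (ler_norm _)) // lerDl.
by rewrite mulrC divfK // gt_eqF.
Qed.

(** Fubini for an integral [W] and an arbitrary bounded functional [L]: both sides
    are approximated by the same finite sum over a Riemann subdivision in [t]. *)
Lemma integral_swap (V : normedModType R[i]) (W : (G -> V) -> V) (C : R)
    (L : (G -> V) -> R[i]^o) (M : R) (H : G -> G -> V) K1 K2 :
  L1_bounded W C -> (forall h v, Ccr h -> W (fun t => (h t)%:C%C *: v) = (J h)%:C%C *: v) ->
  L1_bounded L M -> compact K1 -> compact K2 ->
  continuous (fun z : G * G => H z.1 z.2) -> (forall s t, ~ K1 s -> H s t = 0) ->
  (forall s t, ~ K2 t -> H s t = 0) ->
  L (fun s => W (fun t => H s t)) = I (fun t => L (fun s => H s t)).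
Proof.
move=> HW Wv HL cK1 cK2 cH HK1 HK2.
have cH' : continuous (fun z : G * G => H z.2 z.1).
  exact: (cont_comp (cont_pair (@cont_snd _ _) (@cont_fst _ _)) cH).
have [k [Ck k0 kP]] := riemann_sums cK2.
have [k1 [Ck1 _ k101 k1K]] := Urysohn_Cc R hausG lcG cK1.
have k10 t : 0 <= k1 t by case/andP: (k101 t).
have [_ C0 _] := HW; have [_ M0 _] := HL.
have CH1 t : Cc (fun s => H s t).
  apply: (Cc_intro hausG (K := K1)) => // [|s]; last exact: HK1.
  exact: (cont_comp (cont_pair (@cont_id _) (@cont_cst _ _ t)) cH).
have CH2 s : Cc (H s).
  apply: (Cc_intro hausG (K := K2)) => // [|t]; last exact: HK2.
  exact: (cont_comp (cont_pair (@cont_cst _ _ s) (@cont_id _)) cH).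
have CW : Cc (fun s => W (fun t => H s t)).
  exact: (bd_Cc HW cK2 cK1 cH' (fun s t => HK2 t s) (fun s t => HK1 t s)).
have CL : Cc (fun t => L (fun s => H s t)) by exact: (bd_Cc HL cK1 cK2 cH HK1 HK2).
apply: (@small_eq _ _ (M * C * J k * J k1 + M * J k1 * J k)) => e e0.
have unif t0 e' : 0 < e' -> \forall t \near t0, forall s, nrm (H s t - H s t0) < e'.
  by move=> e'0; exact: (tube t0 cK1 cH HK1 e'0).
have [ts [g [Cg g0 gP _]]] := kP _ V (fun t s => H s t) (fun t s => HK2 s t) unif e e0.
have Jg x : 0 <= J (g x) by exact: J_ge0.
pose Sum := \sum_(x <- ts) (J (g x))%:C%C * L (fun s => H s x).
have e1 : cabs (L (fun s => W (fun t => H s t)) - Sum) <= M * C * J k * J k1 * e.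
  have -> : Sum = L (fun s => \sum_(x <- ts) (J (g x))%:C%C *: H s x).
    rewrite (bd_sum HL) => [|x _]; last exact: CcZ.
    by apply: eq_bigr => x _; rewrite (bd_Z HL).
  rewrite -(bd_B HL) //; last by apply: Cc_sum => x _; exact: CcZ.
  have -> : M * C * J k * J k1 * e = M * J (fun s => C * (e * J k) * k1 s).
    by rewrite JZ //; ring.
  apply: (bd_le HL); [|exact: CcrZ|].
    by apply: CcB => //; apply: Cc_sum => x _; exact: CcZ.
  move=> s; have [Ks|nKs] := pselect (K1 s); last first.
    rewrite (_ : (fun t => H s t) = fun=> 0); last by apply/funext => t; rewrite HK1.
    rewrite (bd_0 HW) big1 => [|x _]; last by rewrite HK1 // scaler0.
    by rewrite subrr nrm0 !mulr_ge0 // ?J_ge0 // ltW.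
  have -> : \sum_(x <- ts) (J (g x))%:C%C *: H s x =
      W (fun t => \sum_(x <- ts) (g x t)%:C%C *: H s x).
    rewrite (bd_sum HW) => [|x _]; last exact: Cc_scale.
    by apply: eq_bigr => x _; rewrite Wv.
  have CS : Cc (fun t => \sum_(x <- ts) (g x t)%:C%C *: H s x).
    by apply: Cc_sum => x _; exact: Cc_scale.
  rewrite -(bd_B HW) // k1K // mulr1 -JZ //.
  by apply: (bd_le HW); [exact: CcB|exact: CcrZ|].
have e2 : cabs (I (fun t => L (fun s => H s t)) - Sum) <= M * J k1 * J k * e.
  have Ct x : Cc (fun t => (g x t)%:C%C * L (fun s => H s x) : R[i]^o) by exact: (@Cc_scale R[i]^o).
  have -> : Sum = I (fun t => \sum_(x <- ts) (g x t)%:C%C * L (fun s => H s x)).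
    rewrite I_sum //; apply: eq_bigr => x _; rewrite I_Zr; last exact: Cg.
    by rewrite J_real //; exact: Cg.
  have CS : Cc (fun t => \sum_(x <- ts) (g x t)%:C%C * L (fun s => H s x) : R[i]^o).
    exact: (@Cc_sum R[i]^o).
  rewrite -I_B //; apply: (le_trans (I_abs (CcB CL CS))).
  have -> : M * J k1 * J k * e = J (fun t => M * J k1 * e * k t) by rewrite JZ //; ring.
  apply: L1_le; [exact: CcB|exact: CcrZ|].
  move=> t; have -> : M * J k1 * e * k t = M * J (fun s => (e * k t) * k1 s).
    by rewrite JZ //; ring.
  have -> : L (fun s => H s t) - \sum_(x <- ts) (g x t)%:C%C * L (fun s => H s x)
     = L (fun s => H s t - \sum_(x <- ts) (g x t)%:C%C *: H s x).
    rewrite (bd_B HL) //; last by apply: Cc_sum => x _; exact: CcZ.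
    rewrite (bd_sum HL) => [|x _]; last exact: CcZ.
    by congr (_ - _); apply: eq_bigr => x _; rewrite (bd_Z HL).
  apply: (bd_le HL); [|exact: CcrZ|].
    by apply: CcB => //; apply: Cc_sum => x _; exact: CcZ.
  move=> s; have [Ks|nKs] := pselect (K1 s); first by rewrite k1K // mulr1.
  rewrite HK1 // big1 => [|x _]; last by rewrite HK1 // scaler0.
  by rewrite subrr nrm0 !mulr_ge0 // ltW.
rewrite mulrDl; have := cabsB (L (fun s => W (fun t => H s t)) - Sum) (I (fun t => L (fun s => H s t)) - Sum).
by rewrite opprB addrA subrK; move: e1 e2; lra.
Qed.

Theorem fubini (H : G -> G -> R[i]^o) K1 K2 : compact K1 -> compact K2 ->
  continuous (fun z : G * G => H z.1 z.2) -> (forall s t, ~ K1 s -> H s t = 0) ->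
  (forall s t, ~ K2 t -> H s t = 0) ->
  I (fun s => I (fun t => H s t)) = I (fun t => I (fun s => H s t)).
Proof.
move=> cK1 cK2 cH HK1 HK2; apply: (@integral_swap R[i]^o I 1 I 1 H K1 K2) => //.
- exact: I_bounded.
- by move=> h v Ch; rewrite I_Zr // J_real.
- exact: I_bounded.
Qed.

End Haar.

(** * The modular function *)

Section Modular.
Context (R : realType) (G : topologicalGroupType).
Hypotheses (hausG : hausdorff_space G) (lcG : locally_compact [set: G]).
Context (I : (G -> R[i]) -> R[i]) (haarI : haar_integral I).
Context (Delta : G -> R) (modI : modular_function I Delta).

Notation Ccr := (@Ccr R G).
Notation J := (J I).

Definition mulset (K K' : set G) : set G := (fun z : G * G => (z.1 * z.2)%g) @` (K `*` K').
Lemma compact_mulset K K' : compact K -> compact K' -> compact (mulset K K').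
Proof.
move=> cK cK'; apply: continuous_compact; last exact: compact_setX.
by apply: continuous_subspaceT; exact: mulg_continuous.
Qed.
Lemma mulsetP K K' x y : K x -> K' y -> mulset K K' (x * y)%g.
Proof. by move=> Kx Ky; exists (x, y). Qed.
Definition invset (K : set G) : set G := (fun x : G => x^-1%g) @` K.
Lemma compact_invset K : compact K -> compact (invset K).
Proof.
move=> cK; apply: continuous_compact => //.
by apply: continuous_subspaceT; exact: invg_continuous.
Qed.
Lemma invsetP K x : K (x^-1)%g -> invset K x.
Proof. by move=> Kx; exists (x^-1)%g => //; rewrite invgK. Qed.

(** A function with nonzero integral can be replaced by its modulus. *)
Lemma haar_pos : exists f : G -> R, [/\ Ccr f, forall t, 0 <= f t & 0 < J f].
Proof.
have [_ _ _ [f Cf If]] := haarI; exists (fun t => nrm (f t)); split.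
- exact: Ccr_nrm.
- by move=> t; exact: nrm_ge0.
apply: lt_le_trans (I_abs hausG haarI Cf).
by rewrite lt_neqAle cabs_ge0 eq_sym cabs_eq0 If.
Qed.

Lemma J_mod t f : Ccr f -> Delta t * J (fun s => f (s * t)%g) = J f.
Proof.
move=> Cf; have := modI t Cf.
rewrite (J_real hausG haarI (Cc_right hausG t Cf : Ccr (fun s => f (s * t)%g))).
by rewrite (J_real hausG haarI Cf) -realcM => /realcI.
Qed.

Lemma Ccr_right t f : Ccr f -> Ccr (fun s => f (s * t)%g).
Proof. exact: Cc_right. Qed.

Lemma Delta_gt0 t : 0 < Delta t.
Proof.
have [f [Cf f0 Jf]] := haar_pos; have := J_mod t Cf => e.
have j0 : 0 <= J (fun s => f (s * t)%g) by apply: J_ge0 => //; exact: Ccr_right.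
rewrite ltNge; apply/negP => D0; move: Jf; rewrite -e.
by apply/negP; rewrite -leNgt mulr_le0_ge0.
Qed.

Lemma J_right_neq0 t f : J f != 0 -> Ccr f -> J (fun s => f (s * t)%g) != 0.
Proof.
move=> Jf Cf; have e := J_mod t Cf; apply: contraNneq Jf => j0.
by rewrite -e j0 mulr0.
Qed.

Lemma DeltaM s t : Delta (s * t)%g = Delta s * Delta t.
Proof.
have [f [Cf f0 Jf]] := haar_pos; have Jn : J f != 0 by rewrite gt_eqF.
have E : (fun x => f (x * (s * t))%g) = (fun x => f (x * s * t)%g).
  by apply/funext => x; rewrite mulgA.
have := J_mod (s * t)%g Cf; have := J_mod s (Ccr_right t Cf); have := J_mod t Cf.
have n0 := J_right_neq0 (s * t)%g Jn Cf; rewrite E in n0 *.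
move=> e1 e2 e3; apply: (mulIf n0); rewrite e3 -e1 -e2; ring.
Qed.

Lemma Delta1 : Delta 1%g = 1.
Proof.
have := DeltaM 1%g 1%g; rewrite mulg1 => e.
by apply: (mulfI (lt0r_neq0 (Delta_gt0 1%g))); rewrite -e mulr1.
Qed.

Lemma DeltaV t : Delta (t^-1)%g * Delta t = 1.
Proof. by rewrite -DeltaM mulVg Delta1. Qed.

(** Near t0, Delta is the quotient of the fixed integral of [f] by the integral of
    s |-> f (s t), which depends continuously on t. The cutoff [k] gives the
    integrands a common compact support. *)
Lemma Delta_continuous : continuous Delta.
Proof.
have [f [Cf f0 Jf]] := haar_pos; have Jn : J f != 0 by rewrite gt_eqF.
move=> t0.
have [|k [Ck ck k01 kt0]] := Urysohn_Cc R hausG lcG (K := [set t0]).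
  exact: compact_set1.
have k1 : k t0 = 1 by apply: kt0.
have [K [cK KP]] := Cc_elim Cf; have [K' [cK' K'P]] := Cc_elim Ck.
pose H s t : R[i]^o := (f (s * t)%g * k t)%:C%C.
have cf : continuous (fun t => (f t)%:C%C : R[i]^o) by case: Cf.
have cH : continuous (fun z : G * G => H z.1 z.2).
  have -> : (fun z : G * G => H z.1 z.2) =
     fun z => (((k z.2)%:C%C : R[i]^o) : R[i]) *: ((f (z.1 * z.2)%g)%:C%C : R[i]^o).
    by apply/funext => z; rewrite /H realcM mulrC.
  apply: cont_scale.
    exact: (cont_comp (@cont_snd _ _) (cont_real ck)).
  exact: (cont_comp (@mulg_continuous G) cf).
have HK s t : ~ mulset K (invset K') s -> H s t = 0.
  move=> ns; rewrite /H; have [Kt|nKt] := pselect (K' t); last first.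
    by rewrite (realcI (K'P t nKt)) mulr0.
  have [Ks|nKs] := pselect (K (s * t)%g); last by rewrite (realcI (KP _ nKs)) mul0r.
  exfalso; apply: ns; rewrite -[s](mulgK t); apply: mulsetP => //.
  by apply: invsetP; rewrite invgK.
have cMK := compact_mulset cK (compact_invset cK').
have cQ := bd_cont hausG lcG haarI (I_bounded hausG haarI) cMK cH HK.
pose Q t := J (fun s => f (s * t)%g * k t).
have QE t : Q t = k t * J (fun s => f (s * t)%g).
  rewrite -(JZ hausG haarI); last exact: Ccr_right.
  by congr J; apply/funext => s; rewrite mulrC.
have cQr : continuous Q.
  have : continuous (fun t => (Q t)%:C%C : R[i]^o).
    have -> : (fun t => (Q t)%:C%C : R[i]^o) = (fun t => I (fun s => H s t)).
      apply/funext => t.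
      have e : (fun s => f (s * t)%g * k t) = (fun s => k t * f (s * t)%g).
        by apply/funext => s; rewrite mulrC.
      rewrite /Q /H e -(J_real hausG haarI (CcrZ hausG (k t) (Ccr_right t Cf))).
      by congr I; apply/funext => s; rewrite [k t * _]mulrC.
    exact: cQ.
  move=> /contP c; apply/contrP => x e e0; apply: filterS (c x e e0) => y.
  by rewrite nrmc -realcN -realcD cabs_real.
have Qt0 : Q t0 != 0 by rewrite QE k1 mul1r J_right_neq0.
have cD : {for t0, continuous (fun t => k t * J f / Q t)}.
  apply: cvgM; first by apply: cvgM; [exact: ck|exact: cvg_cst].
  by apply: cvgV => //; exact: cQr.
have e0 : Delta t0 = k t0 * J f / Q t0.
  rewrite QE k1 !mul1r -(J_mod t0 Cf) mulfK // J_right_neq0 //.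
have near_k : \forall t \near t0, k t != 0.
  have /cvgrPdist_lt/(_ 1 ltr01) := ck t0; rewrite k1.
  apply: filterS => t; apply: contraTneq => ->; rewrite subr0 normr1.
  by rewrite ltxx.
change (Delta t @[t --> t0] --> Delta t0); rewrite e0; apply: cvg_trans cD; apply: near_eq_cvg.
apply: filterS near_k => t kt.
have jn := J_right_neq0 t Jn Cf; rewrite QE -(J_mod t Cf).
move: jn; set j := J _ => jn; rewrite [k t * _]mulrC -mulrA mulrAC -mulrA.
have -> : k t / (k t * j) * j = 1 by rewrite mulrAC divff ?mulf_neq0.
by rewrite mulr1.
Qed.

(** Both integrals, multiplied by the integral of [f], are the integral of
    f (s t) g (t^-1) over G x G: integrating first in s produces Delta (t^-1), and
    substituting t by s^-1 t first produces the translates of [g]. *)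
Theorem I_inv (g : G -> R[i]^o) : Cc g ->
  I (fun t => (Delta (t^-1)%g)%:C%C * g (t^-1)%g) = I g.
Proof.
move=> Cg; have [f [Cf f0 Jf]] := haar_pos.
have [K [cK KP]] := Cc_elim Cf; have [K' [cK' K'P]] := Cc_elim Cg.
have [cf _] := Cf; have [cg _] := Cg.
have cMK := compact_mulset cK cK'.
have F1 : I (fun s => I (fun t => (f (s * t)%g)%:C%C * g (t^-1)%g))
   = I (fun t => I (fun s => (f (s * t)%g)%:C%C * g (t^-1)%g)).
  apply: (fubini hausG lcG haarI (H := fun s t => (f (s * t)%g)%:C%C * g (t^-1)%g) cMK (compact_invset cK')).
  - apply: (@cont_scale _ _ R[i]^o (fun z : G * G => (f (z.1 * z.2)%g)%:C%C) (fun z => g (z.2^-1)%g)).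
      exact: (cont_comp (@mulg_continuous G) cf).
    by apply: (cont_comp _ cg); apply: cont_invg; exact: cont_snd.
  - move=> s t ns; have [Kt|nKt] := pselect (K' (t^-1)%g); last by rewrite K'P // mulr0.
    have [Ks|nKs] := pselect (K (s * t)%g); last by rewrite KP // mul0r.
    by exfalso; apply: ns; rewrite -[s](mulgK t); apply: mulsetP.
  - move=> s t nt; rewrite K'P ?mulr0 // => Kt; apply: nt; exact: invsetP.
have F2 : I (fun t => I (fun s => (f t)%:C%C * g (t^-1 * s)%g))
   = I (fun s => I (fun t => (f t)%:C%C * g (t^-1 * s)%g)).
  apply: (fubini hausG lcG haarI (H := fun t s => (f t)%:C%C * g (t^-1 * s)%g) cK cMK).
  - apply: (@cont_scale _ _ R[i]^o (fun z : G * G => (f z.1)%:C%C) (fun z => g (z.1^-1 * z.2)%g)).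
      exact: (cont_comp (@cont_fst _ _) cf).
    apply: (cont_comp _ cg); apply: cont_mulg; last exact: cont_snd.
    by apply: cont_invg; exact: cont_fst.
  - by move=> t s nt; rewrite KP // mul0r.
  - move=> t s ns; have [Kt|nKt] := pselect (K' (t^-1 * s)%g); last by rewrite K'P // mulr0.
    have [Ks|nKs] := pselect (K t); last by rewrite KP // mul0r.
    by exfalso; apply: ns; rewrite -[s](mulVKg t); apply: mulsetP.
have If0 : I (fun t => (f t)%:C%C) != 0.
  by rewrite (J_real hausG haarI Cf) -cabs_eq0 cabs_real normr_eq0 gt_eqF.
apply: (mulfI If0).
have CD : Cc (fun t => (Delta (t^-1)%g)%:C%C * g (t^-1)%g : R[i]^o).
  apply: (Cc_inv hausG (f := fun t => (Delta t)%:C%C * g t : R[i]^o)).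
  have z0 t : ~ K' t -> (Delta t)%:C%C * g t = 0 :> R[i]^o by move=> nt; rewrite K'P // mulr0.
  refine (Cc_intro hausG _ cK' z0).
  exact: (@cont_scale _ _ R[i]^o (fun t => (Delta t)%:C%C) g (cont_real Delta_continuous) cg).
rewrite -(I_Z hausG haarI) //.
transitivity (I (fun t => I (fun s => (f (s * t)%g)%:C%C * g (t^-1)%g))).
  congr I; apply/funext => t.
  have Ct := Ccr_right t Cf; rewrite (I_Zr hausG haarI) // -(modI t Cf).
  rewrite mulrA [_ * (Delta _)%:C%C]mulrC mulrA -realcM DeltaV mul1r //.
rewrite -F1; transitivity (I (fun s => I (fun t => (f t)%:C%C * g (t^-1 * s)%g))).
  congr I; apply/funext => s.
  have C2 : Cc (fun t => (f t)%:C%C * g (t^-1 * s)%g : R[i]^o).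
    have z0 t : ~ K t -> (f t)%:C%C * g (t^-1 * s)%g = 0 :> R[i]^o by move=> nt; rewrite KP // mul0r.
    refine (Cc_intro hausG _ cK z0).
    apply: (@cont_scale _ _ R[i]^o (fun t => (f t)%:C%C) (fun t => g (t^-1 * s)%g) cf).
    apply: (cont_comp _ cg); apply: cont_mulg; last exact: cont_cst.
    by apply: cont_invg; exact: cont_id.
  rewrite -(I_left haarI s C2); congr I; apply/funext => t.
  by rewrite invgM -mulgA mulVg mulg1.
rewrite -F2 -(I_Zr hausG haarI) //; congr I; apply/funext => t.
have Cgl := Cc_left hausG (t^-1)%g Cg.
by rewrite (I_Z hausG haarI) // (I_left haarI).
Qed.

End Modular.

(** * Integration of functions with values in a C*-algebra *)

Section VectorIntegral.
Context (R : realType) (G : topologicalGroupType).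
Hypotheses (hausG : hausdorff_space G) (lcG : locally_compact [set: G]).
Context (I : (G -> R[i]) -> R[i]) (haarI : haar_integral I).
Context (A : cstarAlgType R).

Notation Ccr := (@Ccr R G).
Notation J := (J I).
Notation L1 := (L1 I).

Lemma dual_bound (phi : A -> R[i]) : dual phi ->
  lin phi /\ exists2 M : R, 0 <= M & forall a, cabs (phi a) <= M * nrm a.
Proof.
move=> [phil phic]; have pl : lin phi by move=> c x y; rewrite phil.
split=> //; have /contP/(_ 0 1 ltr01) := phic.
rewrite (lin0 pl) => /nbhs_norm0P[e /= e0 eP].
have eE : e = (cabs e)%:C%C by apply: cabs_ge0_id; exact: ltW.
have e0' : 0 < cabs e by rewrite -ltcRE -eE.
exists (2 / cabs e); first by rewrite divr_ge0 // ltW.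
move=> a; have [->|a0] := eqVneq a 0; first by rewrite (lin0 pl) cabs0 nrm0 mulr0.
have na : 0 < nrm a by rewrite lt_neqAle eq_sym nrm_eq0 a0 nrm_ge0.
pose r := cabs e / 2 / nrm a.
have r0 : 0 < r by rewrite !divr_gt0.
have := eP (r%:C%C *: a); rewrite /= nrmE [X in _ < X]eE ltcRE nrmZ cabs_real gtr0_norm //.
rewrite {1}/r divfK ?gt_eqF // => H; have {H} := H (_ : _ < _).
move=> /(_ ltac:(lra)).
rewrite nrmc subr0 (linZ pl) cabsM cabs_real gtr0_norm // => le.
have : cabs (phi a) < r^-1 by rewrite -[r^-1]mulr1 -ltr_pdivrMl ?invr_gt0 // invrK.
move=> /ltW /le_trans; apply; rewrite /r !invfM !invrK.
by rewrite [_^-1 * 2]mulrC.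
Qed.

(** The functional om (z^* _), with om as in [exists_positive_functional] for z. *)
Lemma norming (z : A) : exists phi : A -> R[i],
  [/\ lin phi, (forall a, cabs (phi a) <= nrm z * nrm a) & nrm z ^+ 2 <= 11 * cabs (phi z)].
Proof.
have [om [oml omn _ omz]] := exists_positive_functional z (cseminorm_nrm A).
exists (fun a => om (amul (astar z) a)); split=> //.
- by move=> c a b; rewrite amulDr oml.
- by move=> a; rewrite (le_trans (omn _)) // (le_trans (nrm_amul _ _)) // nrm_astar.
Qed.

Lemma lin_Cc (phi : A -> R[i]) (M : R) (F : G -> A) : lin phi ->
  (forall a, cabs (phi a) <= M * nrm a) -> Cc F -> Cc (fun t => phi (F t) : R[i]^o).
Proof.
move=> pl pM CF; apply: (@Cc_comp _ _ hausG A R[i]^o phi) => //; first exact: lin0.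
apply: (@cont_lip _ _ A R[i]^o phi M); last by case: CF.
by move=> x y; rewrite -(linB pl) nrmc.
Qed.

Lemma small_eq0 (x M : R) : 0 <= x -> (forall e, 0 < e -> x <= M * e) -> x = 0.
Proof.
move=> x0 P; have := @small_eq R (x%:C%C) 0 M.
rewrite subr0 cabs_real ger0_norm // => /(_ P); exact: realcI.
Qed.

(** The Riemann sums converge weakly, uniformly over bounded sets of functionals;
    by [norming] they form a Cauchy sequence in norm. *)
Lemma vint_exists (F : G -> A) : Cc F ->
  exists x, forall phi, dual phi -> phi x = I (phi \o F).
Proof.
move=> CF; have [K [cK KP]] := Cc_elim CF; have [cF _] := CF.
have [k [Ck k0 kP]] := riemann_sums R hausG lcG cK.
have Jk : 0 <= J k by exact: J_ge0.
have seqP (n : nat) : exists x : A, forall phi (M : R), lin phi -> 0 <= M ->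
    (forall a, cabs (phi a) <= M * nrm a) ->
    cabs (phi x - I (phi \o F)) <= M * J k * (n.+1%:R)^-1.
  have e0 : 0 < (n.+1%:R : R)^-1 by rewrite invr_gt0.
  have [| |s [g [Cg g0 gP _]]] := kP unit A (fun t _ => F t) _ _ _ e0.
  - by move=> s _; exact: KP.
  - by move=> s e' e'0; move/contP: cF => /(_ s e' e'0); apply: filterS => s' ? _.
  exists (\sum_(x <- s) (J (g x))%:C%C *: F x) => phi M pl M0 pM.
  have CpF := lin_Cc pl pM CF.
  have -> : phi (\sum_(x <- s) (J (g x))%:C%C *: F x) =
      I (fun t => \sum_(x <- s) (g x t)%:C%C * phi (F x)).
    rewrite (lin_sum pl) (I_sum hausG haarI) => [|x _].
      apply: eq_bigr => x _; rewrite (linZ pl) (I_Zr hausG haarI); last exact: Cg.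
      by rewrite (J_real hausG haarI); last exact: Cg.
    by apply: (@Cc_scale _ _ hausG R[i]^o); exact: Cg.
  have CS : Cc (fun t => \sum_(x <- s) (g x t)%:C%C * phi (F x) : R[i]^o).
    apply: (@Cc_sum _ _ hausG R[i]^o) => x _.
    by apply: (@Cc_scale _ _ hausG R[i]^o); exact: Cg.
  rewrite -(I_B haarI) //; apply: (le_trans (I_abs hausG haarI (CcB hausG CS CpF))).
  have -> : M * J k * n.+1%:R^-1 = J (fun t => M / n.+1%:R * k t).
    by rewrite (JZ hausG haarI) //; ring.
  apply: (L1_le hausG haarI); [exact: CcB|exact: CcrZ|].
  move=> t; rewrite nrmc -cabsN opprB.
  have -> : phi (F t) - \sum_(x <- s) (g x t)%:C%C * phi (F x) =
     phi (F t - \sum_(x <- s) (g x t)%:C%C *: F x).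
    rewrite (linB pl) (lin_sum pl); congr (_ - _); apply: eq_bigr => x _.
    by rewrite (linZ pl).
  by apply: (le_trans (pM _)); rewrite -mulrA ler_wpM2l // (gP t tt).
have [x xP] := choice seqP.
have [|l lP] := @complete_seq R A x.
  move=> e e0; pose c := 22 * J k + 1; have c0 : 0 < c by rewrite /c; lra.
  have [N NP] : exists N : nat, c / e < N.+1%:R.
    by exists (Num.truncn (c / e)); exact: truncnS_gt.
  exists N => n m Nn Nm; set z := x n - x m.
  have [phi [pl pM pz]] := norming z.
  have z0 := nrm_ge0 z.
  have h1 := xP n phi _ pl z0 pM; have h2 := xP m phi _ pl z0 pM.
  have iN p : (N <= p)%N -> p.+1%:R^-1 <= N.+1%:R^-1 :> R.
    by move=> Np; rewrite lef_pV2 ?posrE // ler_nat.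
  have hz : cabs (phi z) <= nrm z * J k * (2 * N.+1%:R^-1).
    have := cabsB (phi (x n) - I (phi \o F)) (phi (x m) - I (phi \o F)).
    rewrite opprB addrA subrK -(linB pl) -/z.
    have : nrm z * J k * n.+1%:R^-1 <= nrm z * J k * N.+1%:R^-1 by rewrite ler_wpM2l ?mulr_ge0 ?iN.
    have : nrm z * J k * m.+1%:R^-1 <= nrm z * J k * N.+1%:R^-1 by rewrite ler_wpM2l ?mulr_ge0 ?iN.
    have -> : nrm z * J k * (2 / N.+1%:R) = nrm z * J k / N.+1%:R + nrm z * J k / N.+1%:R by ring.
    by move=> /(le_trans h2) a1 /(le_trans h1) a2 /le_trans; apply; exact: lerD.
  have [zz|zp] := leP (nrm z) 0; first by apply: le_lt_trans e0.
  have : nrm z <= 22 * J k / N.+1%:R.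
    rewrite -(ler_pM2l zp) -expr2; apply: (le_trans pz).
    have -> : nrm z * (22 * J k / N.+1%:R) = 11 * (nrm z * J k * (2 * N.+1%:R^-1)) by ring.
    by rewrite ler_pM2l.
  move=> /le_lt_trans; apply; rewrite ltr_pdivrMr //.
  by move: NP; rewrite ltr_pdivrMr // [e * _]mulrC /c; apply: lt_trans; rewrite ltrDl.
exists l => phi dphi; have [pl [M M0 pM]] := dual_bound dphi.
apply: (@small_eq _ _ _ (M + M * J k)) => e e0.
have [N NP] := lP e e0.
have [N' N'P] : exists N : nat, e^-1 < N.+1%:R :> R.
  by exists (Num.truncn e^-1); exact: truncnS_gt.
pose n := maxn N N'; have xn := NP n (leq_maxl _ _).
have := xP n phi M pl M0 pM.
have := cabsD (phi (l - x n)) (phi (x n) - I (phi \o F)).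
rewrite {1}(linB pl) addrA subrK.
have : cabs (phi (l - x n)) <= M * e.
  by apply: (le_trans (pM _)); rewrite ler_wpM2l // -nrmN opprB ltW.
have : M * J k * n.+1%:R^-1 <= M * J k * e.
  rewrite ler_wpM2l ?mulr_ge0 // -[leRHS]invrK lef_pV2 ?posrE ?invr_gt0 //.
  by apply: (le_trans (ltW N'P)); rewrite ler_nat ltnS leq_maxr.
move=> a1 a2 a3 /le_trans/(_ a1) a4; apply: (le_trans a3).
by rewrite mulrDl; exact: lerD.
Qed.

Lemma vintP (F : G -> A) phi : Cc F -> dual phi ->
  phi (vector_integral I F) = I (phi \o F).
Proof.
move=> CF; have [x xP] := vint_exists CF.
exact: (xgetPex 0 (ex_intro (fun x => forall phi, dual phi -> phi x = I (phi \o F)) x xP)).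
Qed.

Lemma vintP' (F : G -> A) phi M : Cc F -> lin phi -> (forall a, cabs (phi a) <= M * nrm a) ->
  phi (vector_integral I F) = I (fun t => phi (F t)).
Proof. by move=> CF pl pM; rewrite vintP //; exact: dual_bounded pl pM. Qed.

Lemma vint_uniq (F : G -> A) x : Cc F -> (forall phi, dual phi -> phi x = I (phi \o F)) ->
  vector_integral I F = x.
Proof. by move=> CF xP; apply: dual_separates => phi dphi; rewrite vintP // xP. Qed.

Lemma vint_bounded11 : L1_bounded I (@vector_integral R G I A) 11.
Proof.
split=> // [c f g Cf Cg|f Cf].
  apply: vint_uniq; first exact: Cc_lin.
  move=> phi dphi; have [pl [M M0 pM]] := dual_bound dphi.
  rewrite pl !vintP // -(I_lin haarI); [|exact: lin_Cc pl pM _|exact: lin_Cc pl pM _].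
  by congr I; apply/funext => t; rewrite /= pl.
set z := vector_integral I f.
have [phi [pl pM pz]] := norming z; have z0 := nrm_ge0 z.
have [zz|zp] := leP (nrm z) 0.
  by apply: (le_trans zz); rewrite mulr_ge0 // (L1_ge0 hausG haarI).
rewrite -(ler_pM2l zp) -expr2; apply: (le_trans pz).
rewrite mulrCA ler_pM2l // (vintP' Cf pl pM).
apply: (le_trans (I_abs hausG haarI (lin_Cc pl pM Cf))).
rewrite -(JZ hausG haarI); last exact: Ccr_nrm.
apply: (L1_le hausG haarI); [exact: lin_Cc pl pM _| |by move=> t; exact: pM].
by apply: CcrZ => //; exact: Ccr_nrm.
Qed.

Lemma vint_simple h (v : A) : Ccr h ->
  vector_integral I (fun t => (h t)%:C%C *: v) = (J h)%:C%C *: v.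
Proof.
move=> Ch; apply: vint_uniq; first exact: Cc_scale.
move=> phi dphi; have [pl _] := dual_bound dphi.
rewrite (linZ pl) -(J_real hausG haarI) // -(I_Zr hausG haarI); last exact: Ch.
by congr I; apply/funext => t; rewrite /= (linZ pl).
Qed.

(** The bound with constant 11 is applied to the difference between F and a Riemann
    sum, whose L1-norm is arbitrarily small; for the Riemann sum itself the
    triangle inequality has constant 1. *)
Theorem vint_bounded : L1_bounded I (@vector_integral R G I A) 1.
Proof.
have B := vint_bounded11; have [Bl _ _] := B.
split=> // F CF; rewrite mul1r.
have [K [cK KP]] := Cc_elim CF; have [cF _] := CF.
have [k [Ck k0 kP]] := riemann_sums R hausG lcG cK.
have Jk : 0 <= J k by exact: J_ge0.
apply/ler_addgt0Pr => e e0.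
have d0 : 0 < e / (12 * J k + 1) by rewrite divr_gt0 //; lra.
set d := e / _ in d0.
have [| |s [g [Cg g0 gP gN]]] := kP unit A (fun t _ => F t) _ _ _ d0.
- by move=> s _; exact: KP.
- by move=> s e' e'0; move/contP: cF => /(_ s e' e'0); apply: filterS => s' ? _.
have CS : Cc (fun t => \sum_(x <- s) (g x t)%:C%C *: F x).
  by apply: Cc_sum => // x _; apply: Cc_scale => //; exact: Cg.
have e1 : nrm (vector_integral I F - \sum_(x <- s) (J (g x))%:C%C *: F x) <= 11 * J (fun t => d * k t).
  have -> : \sum_(x <- s) (J (g x))%:C%C *: F x =
      vector_integral I (fun t => \sum_(x <- s) (g x t)%:C%C *: F x).
    rewrite (bd_sum hausG B) => [|x _]; last by apply: Cc_scale => //; exact: Cg.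
    by apply: eq_bigr => x _; rewrite vint_simple //; exact: Cg.
  rewrite -(bd_B B) //.
  by apply: (bd_le hausG haarI B); [exact: CcB|exact: CcrZ|move=> t; exact: (gP t tt)].
have e2 : nrm (\sum_(x <- s) (J (g x))%:C%C *: F x) <= L1 F + J (fun t => d * k t).
  apply: (le_trans (nrm_sum _ _ _)).
  have Cgn x : Ccr (fun t => nrm (F x) * g x t) by apply: CcrZ => //; exact: Cg.
  have -> : \sum_(x <- s) nrm ((J (g x))%:C%C *: F x) = J (fun t => \sum_(x <- s) nrm (F x) * g x t).
    apply: realcI; rewrite -(J_real hausG haarI); last first.
      have := @Cc_sum _ _ hausG R[i]^o G s (fun x t => (nrm (F x) * g x t)%:C%C) (fun x _ => Cgn x).
      by congr Cc; apply/funext => t; rewrite rmorph_sum.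
    rewrite rmorph_sum.
    have -> : (fun t => (\sum_(x <- s) nrm (F x) * g x t)%:C%C) =
        (fun t => \sum_(x <- s) (nrm (F x) * g x t)%:C%C).
      by apply/funext => t; rewrite rmorph_sum.
    rewrite (I_sum hausG haarI) => [|x _]; last exact: Cgn.
    apply: eq_bigr => x _; rewrite (J_real hausG haarI) // (JZ hausG haarI); last exact: Cg.
    rewrite nrmZ cabs_real ger0_norm; last by apply: J_ge0 => //; exact: Cg.
    by rewrite mulrC.
  rewrite -(JD haarI); [|exact: Ccr_nrm|exact: CcrZ].
  apply: (J_mono hausG haarI).
  - have := @Cc_sum _ _ hausG R[i]^o G s (fun x t => (nrm (F x) * g x t)%:C%C) (fun x _ => Cgn x).
    by congr Cc; apply/funext => t; rewrite rmorph_sum.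
  - by apply: CcrD => //; [exact: Ccr_nrm|exact: CcrZ].
  move=> t; apply: (le_trans _ (gN t tt)); rewrite le_eqVlt; apply/orP; left; apply/eqP.
  by apply: eq_bigr => x _; rewrite mulrC.
have := nrmD (vector_integral I F - \sum_(x <- s) (J (g x))%:C%C *: F x) (\sum_(x <- s) (J (g x))%:C%C *: F x).
rewrite subrK; have : 12 * J (fun t => d * k t) <= e.
  rewrite (JZ hausG haarI) // /d mulrCA mulrAC ler_pdivrMr; last lra.
  by rewrite ler_wpM2l ?(ltW e0) //; lra.
lra.
Qed.

End VectorIntegral.

(** * Positive semidefinite forms and the GNS seminorm *)

Lemma discriminant (R : realType) (a b t : R) : 0 <= a -> 0 <= b ->
  (forall r : R, 0 <= a ^+ 2 + 2 * r * t + r ^+ 2 * b ^+ 2) -> t <= a * b.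
Proof.
move=> a0 b0 key.
have [b00|b00] := eqVneq b 0.
  have := key (- (a ^+ 2 + 1) / 2 * t); rewrite b00 expr0n /= !mulr0 addr0.
  have -> : a ^+ 2 + 2 * (- (a ^+ 2 + 1) / 2 * t) * t = a ^+ 2 - (a ^+ 2 + 1) * t ^+ 2 by field.
  case: (leP t 0) => // t0 h.
  have := key (- (a ^+ 2 + 1) / t); rewrite b00 expr0n /= !mulr0 addr0.
  have -> : a ^+ 2 + 2 * (- (a ^+ 2 + 1) / t) * t = - a ^+ 2 - 2 by field; rewrite gt_eqF.
  by rewrite leNgt => /negP []; have := sqr_ge0 a; lra.
have bp : 0 < b by rewrite lt_neqAle eq_sym b00.
have := key (- a / b).
have -> : a ^+ 2 + 2 * (- a / b) * t + (- a / b) ^+ 2 * b ^+ 2 = (a * b - t) * (2 * (a / b)) by field.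
have [a00|a00] := eqVneq a 0.
  move=> _; rewrite a00 mul0r leNgt; apply/negP => t0.
  have := key (- (t / b ^+ 2)); rewrite a00 expr0n /= add0r.
  have -> : 2 * (- (t / b ^+ 2)) * t + (- (t / b ^+ 2)) ^+ 2 * b ^+ 2 = - (t / b) ^+ 2 by field.
  rewrite oppr_ge0 le_eqVlt ltNge sqr_ge0 orbF sqrf_eq0 mulf_eq0 gt_eqF //.
  by rewrite invr_eq0 gt_eqF.
have ap : 0 < a by rewrite lt_neqAle eq_sym a00.
by rewrite pmulr_lge0 ?subr_ge0 // mulr_gt0 // divr_gt0.
Qed.

Lemma cabs_le_phase (R : realType) (c : R[i]) (b : R) :
  (forall u, cabs u = 1 -> complex.Re (u * c) <= b) -> cabs c <= b.
Proof.
have [->|c0] := eqVneq c 0; first by move/(_ 1 (cabs1 R)); rewrite mulr0 cabs0.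
have cc0 : cabs c != 0 by rewrite cabs_eq0.
pose u : R[i] := c^* / (cabs c)%:C%C => /(_ u).
have -> : u * c = (cabs c)%:C%C.
  rewrite /u mulrAC -cabs_sqr expr2 realcM mulfK //.
  by apply: contra cc0 => /eqP/realcI ->.
apply; rewrite /u cabsM cabsV cabs_real ger0_norm ?cabs_ge0 // cabs_conj divff //.
Qed.

Section Forms.
Context (R : realType) (V : lmodType R[i]) (B : V -> V -> R[i]).
Implicit Types (x y z : V) (c : R[i]).

Record psd_form : Prop := PsdForm {
  psd_lin : forall x, lin (B x);
  psd_sym : forall x y, B x y = (B y x)^*;
  psd_ge0 : forall x, 0 <= B x x }.

Definition fnorm x : R := Num.sqrt (complex.Re (B x x)).

Hypothesis P : psd_form.

Lemma psd_re x : B x x = (complex.Re (B x x))%:C%C.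
Proof. by apply: ger0_complexE; exact: psd_ge0. Qed.
Lemma psd_re_ge0 x : 0 <= complex.Re (B x x).
Proof. by rewrite -lecRE -psd_re; exact: psd_ge0. Qed.
Lemma fnorm_ge0 x : 0 <= fnorm x. Proof. exact: sqrtr_ge0. Qed.
Lemma fnorm_sqr x : fnorm x ^+ 2 = complex.Re (B x x).
Proof. by rewrite sqr_sqrtr // psd_re_ge0. Qed.
Lemma fnorm_sqrc x : B x x = (fnorm x ^+ 2)%:C%C.
Proof. by rewrite fnorm_sqr -psd_re. Qed.
Lemma psdDl x y z : B (x + y) z = B x z + B y z.
Proof. by rewrite psd_sym // (linD (psd_lin P z)) conjcD -!(psd_sym P). Qed.
Lemma psdZl c x z : B (c *: x) z = c^* * B x z.
Proof. by rewrite psd_sym // (linZ (psd_lin P z)) conjcM -!(psd_sym P). Qed.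
Lemma psdDr x y z : B z (x + y) = B z x + B z y.
Proof. exact: (linD (psd_lin P z)). Qed.
Lemma psdZr c x z : B z (c *: x) = c * B z x.
Proof. exact: (linZ (psd_lin P z)). Qed.

Lemma fnormZ c x : fnorm (c *: x) = cabs c * fnorm x.
Proof.
rewrite /fnorm psdZl psdZr mulrA -cabs_sqr ReZ sqrtrM ?sqr_ge0 //.
by rewrite sqrtr_sqr ger0_norm // cabs_ge0.
Qed.

Lemma fnorm_expand x y (r : R) : fnorm (x + r%:C%C *: y) ^+ 2 =
  fnorm x ^+ 2 + 2 * r * complex.Re (B x y) + r ^+ 2 * fnorm y ^+ 2.
Proof.
rewrite !fnorm_sqr psdDl !psdDr psdZl !psdZr psdZl conj_real.
rewrite [B y x]psd_sym // !ReD !ReZ.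
have -> : complex.Re (B x y)^* = complex.Re (B x y) by case: (B x y).
ring.
Qed.

Lemma Re_schwarz x y : complex.Re (B x y) <= fnorm x * fnorm y.
Proof.
apply: discriminant; [exact: fnorm_ge0|exact: fnorm_ge0|] => r.
by rewrite -fnorm_expand sqr_ge0.
Qed.

Lemma schwarz x y : cabs (B x y) <= fnorm x * fnorm y.
Proof.
apply: cabs_le_phase => u cu.
by have := Re_schwarz x (u *: y); rewrite psdZr fnormZ cu mul1r.
Qed.

Lemma fnormD x y : fnorm (x + y) <= fnorm x + fnorm y.
Proof.
have nx := fnorm_ge0 x; have ny := fnorm_ge0 y.
rewrite -(ler_pXn2r (n := 2)) ?nnegrE ?addr_ge0 ?fnorm_ge0 //.
have := fnorm_expand x y 1; rewrite scale1r => ->.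
by have := Re_schwarz x y; rewrite expr1n mul1r mulr1 sqrrD -mulr_natl; lra.
Qed.

(** The spectral radius bound for a symmetric [H] without boundedness of [H]: by
    Schwarz, the powers of <x, H x> / <x, x> are bounded by those of [H], and a
    growth estimate along powers of 2 suffices. *)
Lemma form_power (H : V -> V) x (C rho : R) : 0 <= rho ->
  (forall y z, B (H y) z = B y (H z)) ->
  (forall k, cabs (B x (iter (2 ^ k) H x)) <= C * rho ^+ (2 ^ k)) ->
  complex.Re (B x (H x)) <= rho * fnorm x ^+ 2.
Proof.
move=> r0 Hs HP.
have Hn n y z : B (iter n H y) z = B y (iter n H z).
  by elim: n y z => // n IHn y z; rewrite iterS Hs IHn iterSr.
have [x0|x0] := eqVneq (fnorm x) 0.
  by rewrite x0 expr0n /= mulr0; have := Re_schwarz x (H x); rewrite x0 mul0r.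
have xp : 0 < fnorm x by rewrite lt_neqAle eq_sym x0 fnorm_ge0.
have xp2 : 0 < fnorm x ^+ 2 by rewrite exprn_gt0.
have [rz|rn] := eqVneq rho 0.
  have := HP 0; rewrite rz expr1 mulr0 mul0r => /(le_trans (Re_le_cabs _)).
  by [].
have rp : 0 < rho by rewrite lt_neqAle eq_sym rn.
pose b := cabs (B x (H x)) / fnorm x ^+ 2.
have b0 : 0 <= b by rewrite divr_ge0 ?cabs_ge0 ?sqr_ge0.
have step k : b ^+ (2 ^ k) * fnorm x ^+ 2 <= cabs (B x (iter (2 ^ k) H x)).
  elim: k => [|k IHk]; first by rewrite expr1 /b divfK // gt_eqF.
  set w := iter (2 ^ k) H x.
  have e : iter (2 ^ k.+1) H x = iter (2 ^ k) H w by rewrite expnS mul2n -addnn iterD.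
  rewrite e -Hn -/w fnorm_sqrc cabs_real ger0_norm ?sqr_ge0 //.
  have := le_trans IHk (schwarz x w); rewrite expr2 mulrA [b ^+ _ * _ * _]mulrC ler_pM2l //.
  move=> h; rewrite expnS mulnC exprM -exprMn ler_pXn2r ?nnegrE ?fnorm_ge0 //.
  by rewrite mulr_ge0 ?exprn_ge0 // ltW.
have : b / rho <= 1.
  apply: (@pow2_le1 _ _ (`|C| / fnorm x ^+ 2)) => k.
  rewrite expr_div_n ler_pdivrMr ?exprn_gt0 //.
  rewrite -(ler_pM2r xp2); apply: (le_trans (step k)); apply: (le_trans (HP k)).
  rewrite -mulrA [_ * fnorm x ^+ 2]mulrC mulrA ler_wpM2r ?exprn_ge0 //.
  rewrite mulrDl mul1r -mulrA divfK ?gt_eqF //.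
  apply: (le_trans (ler_norm C)); rewrite -[leLHS]add0r; apply: lerD; first exact: ltW.
  by rewrite -[leLHS]mul1r ler_wpM2r // ler1n expn_gt0.
rewrite ler_pdivrMr // mul1r /b ler_pdivrMr //; apply: le_trans; exact: Re_le_cabs.
Qed.

(** Riesz representation without completeness: [w] almost minimizes
    |w|^2 - 2 Re (L w), and the first variation at [w] is then small. *)
Lemma approx_riesz (L : V -> R[i]) (M e : R) : lin L -> 0 <= M ->
  (forall v, cabs (L v) <= M * fnorm v) -> 0 < e ->
  exists w, forall v, cabs (L v - B w v) <= e * fnorm v.
Proof.
move=> Ll M0 LM e0; pose Q w := fnorm w ^+ 2 - 2 * complex.Re (L w).
have Qlb w : - M ^+ 2 <= Q w.
  have h1 := LM w; have h2 := Re_le_cabs (L w); have := sqr_ge0 (fnorm w - M).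
  by rewrite /Q; nra.
pose E := [set Q w | w in setT].
have hE : has_inf E by split; [exists (Q 0), 0|exists (- M ^+ 2) => _ [w _ <-]].
have [_ [w _ <-] wE] : exists2 q, E q & q < inf E + e ^+ 2.
  by apply: inf_adherent => //; rewrite exprn_gt0.
have re v : complex.Re (L v - B w v) <= e * fnorm v.
  apply: discriminant; [exact: ltW|exact: fnorm_ge0|] => r.
  have : inf E <= Q (w + (- r)%:C%C *: v) by apply: ge_inf; [case: hE|exists (w + (- r)%:C%C *: v)].
  rewrite {1}/Q fnorm_expand (linD Ll) (linZ Ll) !ReD ReZ ReN sqrrN.
  by move: wE; rewrite /Q; move: (inf E) => q; lra.
exists w => v; apply: cabs_le_phase => u cu.
by have := re (u *: v); rewrite (linZ Ll) psdZr fnormZ cu mul1r -mulrBr.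
Qed.

Definition opnorm (T : V -> V) : R :=
  sup [set fnorm (T y) | y in [set y | fnorm y <= 1]].

Lemma fnorm0 : fnorm 0 = 0.
Proof. by rewrite -(scale0r 0) fnormZ cabs0 mul0r. Qed.

Lemma opnorm_le T (c : R) : 0 <= c -> (forall y, fnorm (T y) <= c * fnorm y) -> opnorm T <= c.
Proof.
move=> c0 Tc; apply: ge_sup; first by exists (fnorm (T 0)), 0 => //; rewrite /= fnorm0.
by move=> _ [y /= y1 <-]; apply: (le_trans (Tc y)); rewrite -[leRHS]mulr1 ler_wpM2l.
Qed.

Lemma opnormP T (c : R) : (forall a y, T (a *: y) = a *: T y) ->
  (forall y, fnorm (T y) <= c * fnorm y) ->
  forall y, fnorm (T y) <= opnorm T * fnorm y.
Proof.
move=> TZ Tc y; have [y0|y0] := eqVneq (fnorm y) 0.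
  by rewrite y0 mulr0; have := Tc y; rewrite y0 mulr0.
have yp : 0 < fnorm y by rewrite lt_neqAle eq_sym y0 fnorm_ge0.
rewrite -ler_pdivrMr //; apply: ub_le_sup.
  exists `|c| => _ [z /= z1 <-]; apply: (le_trans (Tc z)).
  apply: (@le_trans _ _ (`|c| * fnorm z)); first by rewrite ler_wpM2r ?fnorm_ge0 // ler_norm.
  by rewrite -[leRHS]mulr1 ler_wpM2l.
exists ((fnorm y)^-1%:C%C *: y); rewrite /= ?TZ fnormZ cabs_real ger0_norm ?invr_ge0 ?fnorm_ge0 //.
  by rewrite mulVf.
by rewrite mulrC.
Qed.

Lemma opnorm_ge0 T : 0 <= opnorm T.
Proof.
have [h|h] := pselect (has_sup [set fnorm (T y) | y in [set y | fnorm y <= 1]]); last first.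
  by rewrite /opnorm sup_out.
apply: (le_trans (fnorm_ge0 (T 0))); apply: ub_le_sup; first by case: h.
by exists 0 => //=; rewrite fnorm0.
Qed.
End Forms.

(** The GNS construction without the Hilbert space: left multiplication is bounded
    for the form Om (x^* y), and its operator norm is a C*-seminorm. *)
Section GNS.
Context (R : realType) (X : lmodType R[i]) (S : staralg X).
Local Notation "x ** y" := (smul S x y) (at level 40, left associativity).
Local Notation st := (sstar S).
Context (l : X -> R).
Hypotheses (l0 : forall x, 0 <= l x) (lM : forall x y, l (x ** y) <= l x * l y)
  (lst : forall x, l (st x) = l x).
Context (Om : X -> R[i]) (M : R).
Hypotheses (M0 : 0 <= M) (OmL : lin Om) (OmM : forall x, cabs (Om x) <= M * l x)
  (OmP : forall x, 0 <= Om (st x ** x)).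

(** Polarization, with the algebra possibly having no unit. *)
Lemma Om_herm x y : Om (st x ** y) = (Om (st y ** x))^*.
Proof.
have pos z : complex.Im (Om (st z ** z)) = 0.
  by have := OmP z; rewrite lecE => /andP[/eqP].
have h1 := pos (x + y); have h2 := pos (x + 'i *: y).
move: h1 h2.
rewrite !sstarD !smulAl !smulAr sstarZ !smulZl !smulZr !(linD OmL) !(linZ OmL).
have := pos x; have := pos y.
case: (Om (st x ** x)) => a1 b1; case: (Om (st y ** y)) => a2 b2.
case: (Om (st x ** y)) => a3 b3; case: (Om (st y ** x)) => a4 b4.
rewrite /= => -> -> h1 h2; apply/eqP; rewrite eq_complex /=; move: h1 h2.
by simpc => /= h1 h2; apply/andP; split; apply/eqP; lra.
Qed.

Definition gnsf x y := Om (st x ** y).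
Lemma gnsf_psd : psd_form gnsf.
Proof.
split=> [x|x y|x]; [|exact: Om_herm|exact: OmP].
by move=> c y z; rewrite /gnsf smulDr OmL.
Qed.
Local Notation fn := (fnorm gnsf).

Lemma gns_adj x y z : gnsf (x ** y) z = gnsf y (st x ** z).
Proof. by rewrite /gnsf sstarM smulA. Qed.

Lemma gns_bound x y : fn (x ** y) <= l x * fn y.
Proof.
have xy0 := fnorm_ge0 gnsf (x ** y); have y0 := fnorm_ge0 gnsf y.
rewrite -(ler_pXn2r (n := 2)) ?nnegrE ?mulr_ge0 // exprMn.
rewrite (fnorm_sqr gnsf_psd) gns_adj.
apply: (form_power gnsf_psd (H := fun z => st x ** (x ** z)) (C := M * l y * l y)).
- exact: sqr_ge0.
- by move=> u v; rewrite gns_adj sstarK gns_adj.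
move=> k; have ln n : l (iter n (fun z => st x ** (x ** z)) y) <= (l x ^+ 2) ^+ n * l y.
  elim: n => [|n IHn]; first by rewrite mul1r.
  rewrite iterS exprS -mulrA expr2 -mulrA; apply: (le_trans (lM _ _)); rewrite lst.
  rewrite ler_wpM2l //; apply: (le_trans (lM _ _)); rewrite ler_wpM2l //.
apply: (le_trans (OmM _)); rewrite -!mulrA ler_wpM2l //; apply: (le_trans (lM _ _)).
rewrite lst ler_wpM2l // mulrC; exact: ln.
Qed.

Definition gnsn x := opnorm gnsf (smul S x).

Lemma gnsP x y : fn (x ** y) <= gnsn x * fn y.
Proof.
apply: (opnormP gnsf_psd (c := l x)); last exact: gns_bound.
by move=> a z; rewrite smulZr.
Qed.

Lemma gnsn_ge0 x : 0 <= gnsn x. Proof. exact: (opnorm_ge0 gnsf_psd). Qed.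

Lemma gnsn_le x c : 0 <= c -> (forall y, fn (x ** y) <= c * fn y) -> gnsn x <= c.
Proof. exact: (opnorm_le gnsf_psd). Qed.

Lemma gnsn_l x : gnsn x <= l x.
Proof. by apply: gnsn_le => // y; exact: gns_bound. Qed.

Lemma gnsn_sq (a b c : R) : 0 <= a -> 0 <= b -> a ^+ 2 <= c * b * a -> 0 <= c -> a <= c * b.
Proof.
move=> a0 b0 h c0; have [->|an] := eqVneq a 0; first by rewrite mulr_ge0.
have ap : 0 < a by rewrite lt_neqAle eq_sym an.
by rewrite -(ler_pM2r ap) -expr2.
Qed.

Lemma gnsn_star_le x : gnsn (st x) <= gnsn x.
Proof.
apply: gnsn_le => [|y]; first exact: gnsn_ge0.
apply: gnsn_sq; rewrite ?gnsn_ge0 ?fnorm_ge0 // (fnorm_sqr gnsf_psd) gns_adj sstarK.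
apply: (le_trans (Re_schwarz gnsf_psd _ _)).
rewrite [_ * fn y]mulrC -mulrA ler_wpM2l ?fnorm_ge0 //; exact: gnsP.
Qed.

Lemma gnsn_star x : gnsn (st x) = gnsn x.
Proof. by apply/eqP; rewrite eq_le gnsn_star_le -{1}[x](sstarK S) gnsn_star_le. Qed.

Lemma gnsn_M x y : gnsn (x ** y) <= gnsn x * gnsn y.
Proof.
apply: gnsn_le => [|z]; first by rewrite mulr_ge0 ?gnsn_ge0.
rewrite -smulA; apply: (le_trans (gnsP _ _)); rewrite -mulrA ler_wpM2l ?gnsn_ge0 //.
exact: gnsP.
Qed.

Lemma gnsn_Zle c x : gnsn (c *: x) <= cabs c * gnsn x.
Proof.
apply: gnsn_le => [|z]; first by rewrite mulr_ge0 ?cabs_ge0 ?gnsn_ge0.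
by rewrite smulZl (fnormZ gnsf_psd) -mulrA ler_wpM2l ?cabs_ge0 // gnsP.
Qed.

Theorem gns_seminorm : cseminorm S gnsn.
Proof.
split=> [x y|c x|x y|x]; last first.
- apply/eqP; rewrite eq_le; apply/andP; split.
    by rewrite expr2 -{1}(gnsn_star x) gnsn_M.
  have q0 := gnsn_ge0 (st x ** x).
  rewrite -(sqr_sqrtr q0) ler_pXn2r ?nnegrE ?sqrtr_ge0 ?gnsn_ge0 //.
  apply: gnsn_le => [|y]; first exact: sqrtr_ge0.
  rewrite -(ler_pXn2r (n := 2)) ?nnegrE ?mulr_ge0 ?sqrtr_ge0 ?fnorm_ge0 // exprMn.
  rewrite (fnorm_sqr gnsf_psd) gns_adj sqr_sqrtr // smulA.
  apply: (le_trans (Re_schwarz gnsf_psd _ _)).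
  by rewrite expr2 mulrCA ler_wpM2l ?fnorm_ge0 // gnsP.
- exact: gnsn_M.
- apply/eqP; rewrite eq_le gnsn_Zle /=.
  have [->|c0] := eqVneq c 0; first by rewrite cabs0 mul0r gnsn_ge0.
  rewrite -{1}[x](scalerK c0) -[leRHS](mulVKf (x := cabs c)) ?cabs_eq0 //.
  rewrite ler_wpM2l ?cabs_ge0 // -cabsV; exact: gnsn_Zle.
- apply: gnsn_le => [|z]; first by rewrite addr_ge0 ?gnsn_ge0.
  rewrite smulAl mulrDl; apply: (le_trans (fnormD gnsf_psd _ _)).
  by apply: lerD; exact: gnsP.
Qed.
End GNS.

(** * The convolution algebra *)

Section CcType.
Context (R : realType) (G : topologicalGroupType) (V : normedModType R[i]).

Definition in_Cc : {pred G -> V} := fun f => `[< Cc f >].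

Lemma in_Cc_submod : submod_closed in_Cc.
Proof.
split=> [|c f g /asboolP[cf Kf] /asboolP[cg Kg]]; apply/asboolP.
  split; first exact: cont_cst.
  suff -> : [set t : G | (0 : G -> V) t != 0] = set0 by rewrite closure0; exact: compact0.
  by apply/seteqP; split=> t //=; rewrite eqxx.
split.
  by apply: cont_add => //; apply: (@cont_scale _ _ V (fun=> c)) => //; exact: cont_cst.
apply: (subclosed_compact (B := closure [set t | f t != 0] `|` closure [set t | g t != 0])).
- exact: closed_closure.
- exact: compactU.
rewrite -closureU; apply: closure_subset => t /=.
have [e|] := eqVneq (f t) 0; last by left.
have [e'|] := eqVneq (g t) 0; last by right.
by rewrite !fctE /= e e' scaler0 addr0 eqxx.
Qed.
HB.instance Definition _ := GRing.isSubmodClosed.Build _ _ in_Cc in_Cc_submod.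

(** The subtype of [Cc] functions: it makes the axioms of a *-algebra hold
    unconditionally. *)
Record ccT := CcT { ccval :> G -> V; _ : ccval \in in_Cc }.
HB.instance Definition _ := [isSub for ccval].
HB.instance Definition _ := [Choice of ccT by <:].
HB.instance Definition _ := [SubChoice_isSubLmodule of ccT by <:].

Lemma ccP (f : ccT) : Cc f. Proof. by case: f => f /= /asboolP. Qed.
Definition mkcc (f : G -> V) (Cf : Cc f) : ccT := CcT (introT (asboolP _) Cf).
Lemma ccI (f g : ccT) : (forall t, f t = g t) -> f = g.
Proof. by move=> e; apply: val_inj; apply/funext. Qed.
Lemma ccD (f g : ccT) t : (f + g) t = f t + g t. Proof. by []. Qed.
Lemma ccN (f : ccT) t : (- f) t = - f t. Proof. by []. Qed.
Lemma cc0 t : (0 : ccT) t = 0. Proof. by []. Qed.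
Lemma cc_sum (T : Type) (s : seq T) (F : T -> ccT) t :
  (\sum_(x <- s) F x) t = \sum_(x <- s) F x t.
Proof. by elim: s => [|x s IHs]; rewrite ?big_nil // !big_cons ccD IHs. Qed.
End CcType.

Section CcAlgebra.
Context (R : realType) (G : topologicalGroupType).
Hypotheses (hausG : hausdorff_space G) (lcG : locally_compact [set: G]).
Context (I : (G -> R[i]) -> R[i]) (haarI : haar_integral I).
Context (Delta : G -> R) (modI : modular_function I Delta).

Notation Ccr := (@Ccr R G).
Notation J := (J I).
Notation L1 := (L1 I).

(** [I] is real on real functions. *)
Lemma I_conj (f : G -> R[i]^o) : Cc f -> I (fun t => (f t)^*) = (I f)^*.
Proof.
move=> Cf; have Cu := Ccr_Re hausG Cf.
have Cv : Ccr (fun t => complex.Im (f t)).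
  have Ci : Cc (fun t => (- 'i) * f t : R[i]^o) by exact: (@CcZ _ _ hausG R[i]^o).
  have := Ccr_Re hausG Ci; congr Ccr; apply/funext => t.
  by case: (f t) => a b; rewrite -complexiE /= oppr0 mul0r sub0r mulN1r opprK.
have Ci c : Cc (fun t => c * (complex.Im (f t))%:C%C : R[i]^o).
  by exact: (@CcZ _ _ hausG R[i]^o c _ Cv).
have E c : I (fun t => (complex.Re (f t))%:C%C + c * (complex.Im (f t))%:C%C) =
    (J (fun t => complex.Re (f t)))%:C%C + c * (J (fun t => complex.Im (f t)))%:C%C.
  by rewrite -!(J_real hausG haarI) // -(I_Z hausG haarI) // -(I_D haarI).
have -> : I f = I (fun t => (complex.Re (f t))%:C%C + 'i * (complex.Im (f t))%:C%C).
  by congr I; apply/funext => t; rewrite {1}[f t]complexE -complexiE.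
rewrite E conjcD conjcM !conj_real conjCi -E; congr I; apply/funext => t.
by rewrite {1}[f t]complexE -complexiE conjcD conjcM !conj_real conjCi.
Qed.

Section Convolution.
Context (A : galgType R G).
Local Notation vint := (@vector_integral R G I A).
Local Notation conv := (@convolution R G I A).
Local Notation cstar := (@cc_star R G Delta A).
Implicit Types f g h : G -> A.

Lemma vintbd : L1_bounded I vint 1. Proof. exact: vint_bounded. Qed.

Definition cint f g (s t : G) : A := amul (f s) (gact s (g (s^-1 * t)%g)).

Lemma cont_cint f g : Cc f -> Cc g -> continuous (fun z : G * G => cint f g z.1 z.2).
Proof.
move=> [cf _] [cg _]; apply: cont_amul; first exact: (cont_comp (@cont_fst _ _) cf).
apply: cont_gact; first exact: cont_fst.
apply: (cont_comp _ cg); apply: cont_mulg; last exact: cont_snd.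
by apply: cont_invg; exact: cont_fst.
Qed.

Lemma cint_supp f g K K' : (forall t, ~ K t -> f t = 0) -> (forall t, ~ K' t -> g t = 0) ->
  (forall s t, ~ K s -> cint f g s t = 0) /\
  (forall s t, ~ mulset K K' t -> cint f g s t = 0).
Proof.
move=> fK gK; split=> [s t ns|s t nt]; first by rewrite /cint fK // amul0l.
rewrite /cint; have [Ks|nKs] := pselect (K s); last by rewrite fK // amul0l.
have [Kt|nKt] := pselect (K' (s^-1 * t)%g); last by rewrite gK // gact0 amul0r.
by exfalso; apply: nt; rewrite -[t](mulVKg s); apply: mulsetP.
Qed.

Lemma Cc_cint f g t : Cc f -> Cc g -> Cc (fun s => cint f g s t).
Proof.
move=> Cf Cg; have [K [cK KP]] := Cc_elim Cf; have [K' [cK' K'P]] := Cc_elim Cg.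
have [z _] := cint_supp KP K'P.
refine (Cc_intro hausG _ cK (fun s => z s t)).
exact: (cont_comp (cont_pair (@cont_id G) (@cont_cst _ _ t)) (cont_cint Cf Cg)).
Qed.

Lemma Cc_conv f g : Cc f -> Cc g -> Cc (conv f g).
Proof.
move=> Cf Cg; have [K [cK KP]] := Cc_elim Cf; have [K' [cK' K'P]] := Cc_elim Cg.
have [z1 z2] := cint_supp KP K'P.
exact: (bd_Cc hausG lcG haarI vintbd cK (compact_mulset cK cK') (cont_cint Cf Cg) z1 z2).
Qed.

Lemma Cc_star f : Cc f -> Cc (cstar f).
Proof.
move=> Cf; have [K [cK KP]] := Cc_elim Cf; have [cf _] := Cf.
have z t : ~ invset K t -> cstar f t = 0.
  move=> nt; rewrite /cc_star KP ?astar0 ?gact0 ?scaler0 // => Kt; apply: nt.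
  exact: invsetP.
refine (Cc_intro hausG _ (compact_invset cK) z).
have cV : continuous (fun t : G => t^-1%g) by apply: cont_invg; exact: cont_id.
apply: (@cont_scale _ _ A (fun t => (Delta (t^-1)%g)%:C%C)).
  exact: (cont_real (cont_comp cV (Delta_continuous hausG lcG haarI modI))).
apply: cont_gact; first exact: cont_id.
by apply: cont_astar; exact: (cont_comp cV cf).
Qed.

Lemma convl c f g h t : Cc f -> Cc g -> Cc h ->
  conv (fun s => c *: f s + g s) h t = c *: conv f h t + conv g h t.
Proof.
move=> Cf Cg Ch; have [bl _ _] := vintbd.
rewrite -[in RHS]bl; [|exact: Cc_cint|exact: Cc_cint].
by congr vint; apply/funext => s; rewrite amulDl.
Qed.

Lemma convr c f g h t : Cc f -> Cc g -> Cc h ->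
  conv h (fun s => c *: f s + g s) t = c *: conv h f t + conv h g t.
Proof.
move=> Cf Cg Ch; have [bl _ _] := vintbd.
rewrite -[in RHS]bl; [|exact: Cc_cint|exact: Cc_cint].
by congr vint; apply/funext => s; rewrite gactZD amulDr.
Qed.


(** Convolutions are only known through the functionals of the dual; identities
    between them are proved by applying a functional and comparing integrals. *)
Lemma conv_fun f g (L : A -> R[i]) M t : Cc f -> Cc g -> lin L ->
  (forall a, cabs (L a) <= M * nrm a) ->
  L (conv f g t) = I (fun s => L (cint f g s t)).
Proof.
by move=> Cf Cg Ll LM; apply: (vintP' hausG lcG haarI (Cc_cint t Cf Cg) Ll LM).
Qed.

Lemma lin_amulr (L : A -> R[i]) M (w : A) : lin L -> (forall a, cabs (L a) <= M * nrm a) ->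
  lin (fun x => L (amul x w)) /\
  (0 <= M -> forall a, cabs (L (amul a w)) <= M * nrm w * nrm a).
Proof.
move=> Ll LM; split=> [c x y|M0 a]; first by rewrite amulDl Ll.
apply: (le_trans (LM _)); rewrite -mulrA ler_wpM2l // mulrC; exact: nrm_amul.
Qed.

Lemma lin_amull (L : A -> R[i]) M (w : A) r : lin L -> (forall a, cabs (L a) <= M * nrm a) ->
  lin (fun x => L (amul w (gact r x))) /\
  (0 <= M -> forall a, cabs (L (amul w (gact r a))) <= M * nrm w * nrm a).
Proof.
move=> Ll LM; split=> [c x y|M0 a]; first by rewrite gactZD amulDr Ll.
apply: (le_trans (LM _)); rewrite -mulrA ler_wpM2l //.
by apply: (le_trans (nrm_amul _ _)); rewrite nrm_gact.
Qed.

Lemma cont_dual (T : topologicalType) (L : A -> R[i]) M (u : T -> A) : lin L ->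
  (forall a, cabs (L a) <= M * nrm a) -> continuous u ->
  continuous (fun t => L (u t) : R[i]^o).
Proof.
move=> Ll LM; apply: (@cont_lip _ _ A R[i]^o L M).
by move=> x y; rewrite -(linB Ll) nrmc.
Qed.

(** Fubini, after translating the inner variable by r. *)
Lemma convA f g h t : Cc f -> Cc g -> Cc h ->
  conv (conv f g) h t = conv f (conv g h) t.
Proof.
move=> Cf Cg Ch; apply: dual_separates => phi dphi.
have [pl [M M0 pM]] := dual_bound dphi.
rewrite (conv_fun t (Cc_conv Cf Cg) Ch pl pM) (conv_fun t Cf (Cc_conv Cg Ch) pl pM).
pose H s r : R[i]^o := phi (amul (cint f g r s) (gact s (h (s^-1 * t)%g))).
have -> : (fun s => phi (cint (conv f g) h s t)) = (fun s => I (fun r => H s r)).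
  apply/funext => s; have [l1 l2] := lin_amulr (gact s (h (s^-1 * t)%g)) pl pM.
  by rewrite /cint (conv_fun s Cf Cg l1 (l2 M0)).
have -> : (fun s => phi (cint f (conv g h) s t)) = (fun r => I (fun s => H s r)).
  apply/funext => r; have [l1 l2] := lin_amull (f r) r pl pM.
  rewrite {1}/cint (conv_fun (r^-1 * t)%g Cg Ch l1 (l2 M0)).
  have CL := lin_Cc hausG l1 (l2 M0) (Cc_cint (r^-1 * t)%g Cg Ch).
  rewrite -(I_left haarI r^-1%g CL); congr I; apply/funext => s.
  rewrite /H /cint gact_amul -gactM mulVKg amulA; congr (phi (amul _ (gact _ (h _)))).
  by rewrite invgM invgK -mulgA mulVKg.
have [K [cK KP]] := Cc_elim Cf; have [K' [cK' K'P]] := Cc_elim Cg.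
have [z1 z2] := cint_supp KP K'P.
apply: (fubini hausG lcG haarI (H := H) (compact_mulset cK cK') cK).
- apply: (cont_dual pl pM); apply: cont_amul.
    exact: (cont_comp (cont_pair (@cont_snd _ _) (@cont_fst _ _)) (cont_cint Cf Cg)).
  apply: cont_gact; first exact: cont_fst.
  have [ch _] := Ch; apply: (cont_comp _ ch); apply: cont_mulg; last exact: cont_cst.
  by apply: cont_invg; exact: cont_fst.
- by move=> s r ns; rewrite /H z2 // amul0l (lin0 pl).
- by move=> s r nr; rewrite /H z1 // amul0l (lin0 pl).
Qed.

Lemma cstar_anti c f g t :
  cstar (fun s => c *: f s + g s) t = c^* *: cstar f t + cstar g t.
Proof.
rewrite /cc_star astar_antilinear gactZD scalerDr !scalerA; congr (_ *: _ + _).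
by rewrite mulrC.
Qed.

Lemma cstarK f t : cstar (cstar f) t = f t.
Proof.
rewrite /cc_star invgK astarZ conj_real gactZ scalerA -realcM.
rewrite (DeltaV hausG haarI modI) scale1r -gact_astar gactKV astarK //.
Qed.

Lemma cstarM f g t : Cc f -> Cc g ->
  cstar (conv f g) t = conv (cstar g) (cstar f) t.
Proof.
move=> Cf Cg; apply: dual_separates => phi dphi.
have [pl [M M0 pM]] := dual_bound dphi.
rewrite (conv_fun t (Cc_star Cg) (Cc_star Cf) pl pM).
pose L (x : A) := (phi ((Delta (t^-1)%g)%:C%C *: gact t (astar x)))^*.
have Ll : lin L.
  move=> c x y; rewrite /L astar_antilinear gactZD scalerDr scalerA mulrC -scalerA.
  by rewrite pl conjcD conjcM conjCK.
have LM a : cabs (L a) <= M * Delta (t^-1)%g * nrm a.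
  rewrite /L cabs_conj (le_trans (pM _)) // -mulrA ler_wpM2l // nrmZ cabs_real.
  by rewrite ger0_norm ?nrm_gact ?nrm_astar // ltW // (Delta_gt0 hausG haarI modI).
have -> : phi (cstar (conv f g) t) = (L (conv f g t^-1%g))^* by rewrite /L conjCK.
rewrite (conv_fun _ Cf Cg Ll LM) -I_conj; last first.
  exact: (lin_Cc hausG Ll LM (Cc_cint _ Cf Cg)).
have Cs := lin_Cc hausG pl pM (Cc_cint t (Cc_star Cg) (Cc_star Cf)).
rewrite -(I_left haarI t Cs); congr I; apply/funext => s.
rewrite /L conjCK /cint /cc_star !invgM !invgK -!mulgA mulVg mulg1.
rewrite gactZ -gactM -!mulgA mulgV mulg1 mulKg amulZl amulZr scalerA.
congr (phi _); congr (_ *: _).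
  rewrite -realcM (DeltaM hausG haarI modI) mulrAC (DeltaV hausG haarI modI).
  by rewrite mul1r.
by rewrite astarM gact_amul gact_astar -gactM -[RHS]/(amul _ _) -gact_astar.
Qed.

(** The integrand of f^* g after the substitution s |-> s^-1, which removes the
    modular function: it turns f^* g into an integral of A-valued inner products. *)
Definition pint f g (s t : G) : A := gact s^-1%g (amul (astar (f s)) (g (s * t)%g)).

Lemma cint_star f g s t :
  cint (cstar f) g s t = (Delta (s^-1)%g)%:C%C *: pint f g (s^-1)%g t.
Proof. by rewrite /cint /cc_star /pint amulZl invgK gact_amul. Qed.

Lemma cont_pint f g : Cc f -> Cc g -> continuous (fun z : G * G => pint f g z.1 z.2).
Proof.
move=> [cf _] [cg _]; apply: cont_gact; first by apply: cont_invg; exact: cont_fst.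
apply: cont_amul; first by apply: cont_astar; exact: (cont_comp (@cont_fst _ _) cf).
by apply: (cont_comp _ cg); apply: cont_mulg; [exact: cont_fst|exact: cont_snd].
Qed.

Lemma Cc_pint f g t : Cc f -> Cc g -> Cc (fun s => pint f g s t).
Proof.
move=> Cf Cg; have [K [cK KP]] := Cc_elim Cf.
have z s : ~ K s -> pint f g s t = 0 by move=> ns; rewrite /pint KP // astar0 amul0l gact0.
refine (Cc_intro hausG _ cK z).
exact: (cont_comp (cont_pair (@cont_id G) (@cont_cst _ _ t)) (cont_pint Cf Cg)).
Qed.

Lemma conv_star_fun f g (L : A -> R[i]) M t : Cc f -> Cc g -> lin L ->
  (forall a, cabs (L a) <= M * nrm a) ->
  L (conv (cstar f) g t) = I (fun s => L (pint f g s t)).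
Proof.
move=> Cf Cg Ll LM; rewrite (conv_fun t (Cc_star Cf) Cg Ll LM).
have CL := lin_Cc hausG Ll LM (Cc_pint t Cf Cg).
rewrite -(I_inv hausG lcG haarI modI CL); congr I; apply/funext => s.
by rewrite cint_star (linZ Ll).
Qed.

Lemma L1_star f : Cc f -> L1 (cstar f) = L1 f.
Proof.
move=> Cf; have Cn := Ccr_nrm hausG Cf; apply: realcI.
rewrite -(J_real hausG haarI (Ccr_nrm hausG (Cc_star Cf))) -(J_real hausG haarI Cn).
rewrite -(I_inv hausG lcG haarI modI Cn); congr I; apply/funext => t.
rewrite /cc_star nrmZ cabs_real ger0_norm ?ltW ?(Delta_gt0 hausG haarI modI) //.
by rewrite nrm_gact nrm_astar realcM.
Qed.

Lemma L1_conv f g : Cc f -> Cc g -> L1 (conv f g) <= L1 f * L1 g.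
Proof.
move=> Cf Cg; have [K [cK KP]] := Cc_elim Cf; have [K' [cK' K'P]] := Cc_elim Cg.
have [cf _] := Cf; have [cg _] := Cg.
pose H s t : R[i]^o := (nrm (f s) * nrm (g (s^-1 * t)%g))%:C%C.
have cH : continuous (fun z : G * G => H z.1 z.2).
  have -> : (fun z : G * G => H z.1 z.2) =
     fun z => (((nrm (f z.1))%:C%C : R[i]^o) : R[i]) *: ((nrm (g (z.1^-1 * z.2)%g))%:C%C : R[i]^o).
    by apply/funext => z; rewrite /H realcM.
  apply: cont_scale; apply: cont_real; apply: cont_nrm.
    exact: (cont_comp (@cont_fst _ _) cf).
  apply: (cont_comp _ cg); apply: cont_mulg; last exact: cont_snd.
  by apply: cont_invg; exact: cont_fst.
have H1 s t : ~ K s -> H s t = 0 by move=> ns; rewrite /H KP // nrm0 mul0r.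
have H2 s t : ~ mulset K K' t -> H s t = 0.
  move=> nt; rewrite /H; have [Ks|nKs] := pselect (K s); last by rewrite KP // nrm0 mul0r.
  have [Kt|nKt] := pselect (K' (s^-1 * t)%g); last by rewrite K'P // nrm0 mulr0.
  by exfalso; apply: nt; rewrite -[t](mulVKg s); apply: mulsetP.
have cMK := compact_mulset cK cK'.
have Fu := fubini hausG lcG haarI (H := H) cK cMK cH H1 H2.
have CI := bd_Cc hausG lcG haarI (I_bounded hausG haarI) cK cMK cH H1 H2.
have CHs t : Ccr (fun s => nrm (f s) * nrm (g (s^-1 * t)%g)).
  refine (Cc_intro hausG _ cK (fun s => H1 s t)).
  exact: (cont_comp (cont_pair (@cont_id G) (@cont_cst _ _ t)) cH).
have E t : I (fun s => H s t) = (J (fun s => nrm (f s) * nrm (g (s^-1 * t)%g)))%:C%C.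
  exact: (J_real hausG haarI (CHs t)).
have CJ : Ccr (fun t => J (fun s => nrm (f s) * nrm (g (s^-1 * t)%g))).
  by have := CI; congr Cc; apply/funext => t; rewrite E.
have le : L1 (conv f g) <= J (fun t => J (fun s => nrm (f s) * nrm (g (s^-1 * t)%g))).
  apply: (L1_le hausG haarI (Cc_conv Cf Cg) CJ) => t.
  have := bd_le hausG haarI vintbd (Cc_cint t Cf Cg) (CHs t); rewrite mul1r; apply.
  by move=> s; rewrite (le_trans (nrm_amul _ _)) // nrm_gact.
apply: (le_trans le); rewrite le_eqVlt; apply/orP; left; apply/eqP; apply: realcI.
rewrite -(J_real hausG haarI CJ).
have -> : (fun t => (J (fun s => nrm (f s) * nrm (g (s^-1 * t)%g)))%:C%C) = (fun t => I (fun s => H s t)).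
  by apply/funext => t; rewrite E.
rewrite -Fu.
have -> : (fun s => I [eta H s]) = (fun s => (L1 g * nrm (f s))%:C%C).
  apply/funext => s; have Cn := Ccr_nrm hausG Cg.
  have Cl := Cc_left hausG s^-1%g Cn.
  rewrite /H.
  have -> : (fun t => (nrm (f s) * nrm (g (s^-1 * t)%g))%:C%C) =
      (fun t => (nrm (f s))%:C%C * (nrm (g (s^-1 * t)%g))%:C%C).
    by apply/funext => t; rewrite realcM.
  rewrite (I_Z hausG haarI (nrm (f s))%:C%C Cl).
  by rewrite (I_left haarI s^-1%g Cn) (J_real hausG haarI Cn) mulrC realcM.
rewrite (J_real hausG haarI (CcrZ hausG _ (Ccr_nrm hausG Cf))).
by rewrite (JZ hausG haarI _ (Ccr_nrm hausG Cf)) mulrC.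
Qed.


Definition ccmul (f g : ccT G A) : ccT G A := mkcc (Cc_conv (ccP f) (ccP g)).
Definition ccstar (f : ccT G A) : ccT G A := mkcc (Cc_star (ccP f)).

Definition cc_staralg : staralg (ccT G A).
Proof.
apply: (@StarAlg R (ccT G A) ccmul ccstar) => [f g h|c f g h|c f g h|f|c f g|f g];
  apply: ccI => t.
- by rewrite /= -(convA t (ccP f) (ccP g) (ccP h)).
- exact: (convl c t (ccP f) (ccP g) (ccP h)).
- exact: (convr c t (ccP f) (ccP g) (ccP h)).
- exact: cstarK.
- exact: cstar_anti.
- exact: (cstarM t (ccP f) (ccP g)).
Defined.

Lemma cc_of_seminorm (p : (G -> A) -> R) : cstar_seminorm I Delta p ->
  cseminorm cc_staralg (fun f : ccT G A => p f) /\ (forall f : ccT G A, p f <= L1 f).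
Proof.
move=> [pD pZ pM pC pL]; split=> [|f]; last by rewrite L1E pL //; exact: ccP.
split=> [f g|c f|f g|f].
- by apply: pD; exact: ccP.
- by apply: pZ; exact: ccP.
- by apply: pM; exact: ccP.
- by apply: pC; exact: ccP.
Qed.

Definition ext_cc (q : ccT G A -> R) (f : G -> A) : R :=
  if pselect (Cc f) is left Cf then q (mkcc Cf) else 0.

Lemma ext_ccE q (f : ccT G A) (F : G -> A) : (forall t, f t = F t) -> ext_cc q F = q f.
Proof.
move=> e; have -> : F = f by apply/funext => t; rewrite e.
rewrite /ext_cc; case: pselect => [Cf|]; last by move=> n; exfalso; apply: n; exact: ccP.
by congr q; apply: ccI.
Qed.

Lemma seminorm_of_cc (q : ccT G A -> R) : cseminorm cc_staralg q ->
  (forall f : ccT G A, q f <= L1 f) -> cstar_seminorm I Delta (ext_cc q).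
Proof.
move=> Q qL; split=> [f g Cf Cg|c f Cf|f g Cf Cg|f Cf|f Cf].
- rewrite (@ext_ccE q (mkcc Cf + mkcc Cg)) // (@ext_ccE q (mkcc Cf)) //.
  by rewrite (@ext_ccE q (mkcc Cg)) // (csD Q).
- by rewrite (@ext_ccE q (c *: mkcc Cf)) // (@ext_ccE q (mkcc Cf)) // (csZ Q).
- rewrite (@ext_ccE q (ccmul (mkcc Cf) (mkcc Cg))) // (@ext_ccE q (mkcc Cf)) //.
  by rewrite (@ext_ccE q (mkcc Cg)) // (csM Q).
- rewrite (@ext_ccE q (ccmul (ccstar (mkcc Cf)) (mkcc Cf))) // (@ext_ccE q (mkcc Cf)) //.
  by rewrite (csC Q).
- by have := qL (mkcc Cf); rewrite L1E -(@ext_ccE q (mkcc Cf) f).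
Qed.

End Convolution.
End CcAlgebra.

(** * The covariant pair acting on the convolution algebra *)

Section Covariant.
Context (R : realType) (G : topologicalGroupType).
Hypotheses (hausG : hausdorff_space G) (lcG : locally_compact [set: G]).
Context (I : (G -> R[i]) -> R[i]) (haarI : haar_integral I).
Context (Delta : G -> R) (modI : modular_function I Delta).
Context (A : galgType R G).

Notation J := (J I).
Notation L1 := (L1 I).
Notation V := (ccT G A).
Local Notation SA := (cc_staralg hausG lcG haarI modI A).
Local Notation conv := (@convolution R G I A).
Local Notation cstar := (@cc_star R G Delta A).
Implicit Types (a : A) (f g h : V) (s t : G).

Lemma Cc_act a f : Cc (fun t => amul a (f t)).
Proof.
apply: (@Cc_comp _ _ hausG A A (amul a)) (ccP f); first exact: amul0r.
by apply: cont_amul; [exact: cont_cst|case: (ccP f)].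
Qed.
(** [ccact] and [ccu] are the multipliers of the convolution algebra given by [A] and
    by [G]; they form the covariant pair that generates left convolution, see
    [form_conv]. *)
Definition ccact a f : V := mkcc (Cc_act a f).

Lemma Cc_u t f : Cc (fun s => gact t (f (t^-1 * s)%g)).
Proof.
have Cl := Cc_left hausG t^-1%g (ccP f).
apply: (@Cc_comp _ _ hausG A A (gact t) _ (gact0 A t) _ Cl).
by have [cl _] := Cl; apply: cont_gact => //; exact: cont_cst.
Qed.
Definition ccu t f : V := mkcc (Cc_u t f).

Definition tocc (F : G -> A) : V := if pselect (Cc F) is left CF then mkcc CF else 0.
Lemma toccE F (f : V) : (forall t, f t = F t) -> tocc F = f.
Proof.
move=> e; have -> : F = f by apply/funext => t; rewrite e.
rewrite /tocc; case: pselect => [Cf|n]; first exact: ccI.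
by exfalso; apply: n; exact: ccP.
Qed.

Lemma ccact_lin a c f g : ccact a (c *: f + g) = c *: ccact a f + ccact a g.
Proof. by apply: ccI => t; rewrite /= amulDr. Qed.
Lemma ccact_linl c a b f : ccact (c *: a + b) f = c *: ccact a f + ccact b f.
Proof. by apply: ccI => t; rewrite /= amulDl. Qed.
Lemma ccactM a b f : ccact a (ccact b f) = ccact (amul a b) f.
Proof. by apply: ccI => t; rewrite /= amulA. Qed.
Lemma ccuM s t f : ccu s (ccu t f) = ccu (s * t)%g f.
Proof. by apply: ccI => r; rewrite /= -gactM invgM mulgA. Qed.
Lemma ccu_act t a f : ccu t (ccact a f) = ccact (gact t a) (ccu t f).
Proof. by apply: ccI => s; rewrite /= gact_amul. Qed.

(** By left invariance of [I], products f^* g are unchanged when the integrands differ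
    by a translation. *)
Lemma star_mul_ext (r : G) f g f' g' :
  (forall s t, pint f g s t = pint f' g' (r * s)%g t) ->
  smul SA (sstar SA f) g = smul SA (sstar SA f') g'.
Proof.
move=> H; apply: ccI => t; apply: dual_separates => phi dphi.
have [pl [M M0 pM]] := dual_bound dphi.
rewrite (conv_star_fun hausG lcG haarI modI t (ccP f) (ccP g) pl pM).
rewrite (conv_star_fun hausG lcG haarI modI t (ccP f') (ccP g') pl pM).
have CL := lin_Cc hausG pl pM (Cc_pint hausG t (ccP f') (ccP g')).
by rewrite -(I_left haarI r CL); congr I; apply/funext => s; rewrite H.
Qed.

Lemma act_adj a f g : smul SA (sstar SA (ccact a f)) g = smul SA (sstar SA f) (ccact (astar a) g).
Proof.
apply: (@star_mul_ext 1%g) => s t.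
by rewrite mul1g /pint /= astarM amulA.
Qed.

Lemma u_adj r f g : smul SA (sstar SA (ccu r f)) (ccu r g) = smul SA (sstar SA f) g.
Proof.
apply: (@star_mul_ext r^-1%g) => s t.
by rewrite /pint /= -gact_astar -gact_amul -gactM invgM invgK mulgA.
Qed.

Lemma L1_act a f : L1 (ccact a f) <= nrm a * L1 f.
Proof.
rewrite -(JZ hausG haarI _ (Ccr_nrm hausG (ccP f))).
apply: (L1_le hausG haarI (ccP (ccact a f)) (CcrZ hausG _ (Ccr_nrm hausG (ccP f)))).
by move=> t; exact: nrm_amul.
Qed.

Lemma mul_star_l1 f : L1 (sstar SA f) = L1 f.
Proof. exact: (L1_star hausG lcG haarI modI (ccP f)). Qed.
Lemma mul_l1 f g : L1 (smul SA f g) <= L1 f * L1 g.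
Proof. exact: (L1_conv hausG lcG haarI (ccP f) (ccP g)). Qed.
Lemma cc_l1_ge0 f : 0 <= L1 f.
Proof. exact: (L1_ge0 hausG haarI (ccP f)). Qed.

(** Uniform continuity of [h]; the cutoff [k], equal to 1 at t0, gives a common compact
    support to the differences. *)
Lemma ccu_cont h t0 (e : R) : 0 < e -> \forall t \near t0, L1 (ccu t h - ccu t0 h : V) < e.
Proof.
move=> e0; have [k [Ck ck k01 kt0]] := Urysohn_Cc R hausG lcG (@compact_set1 _ t0).
have [K [cK KP]] := Cc_elim (ccP h); have [K' [cK' K'P]] := Cc_elim Ck.
have [ch _] := ccP h.
pose D s t : A := ccu t h s - ccu t0 h s.
pose H s t : R[i]^o := (k t * nrm (D s t))%:C%C.
pose KK := mulset (K' `|` [set t0]) K.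
have cKK : compact KK by apply: compact_mulset => //; apply: compactU => //; exact: compact_set1.
have cu : continuous (fun z : G * G => ccu z.2 h z.1).
  apply: cont_gact; first exact: cont_snd.
  apply: (cont_comp _ ch); apply: cont_mulg; last exact: cont_fst.
  by apply: cont_invg; exact: cont_snd.
have cu0 : continuous (fun z : G * G => ccu t0 h z.1).
  by have [c0 _] := ccP (ccu t0 h); exact: (cont_comp (@cont_fst _ _) c0).
have cH : continuous (fun z : G * G => H z.1 z.2).
  have -> : (fun z : G * G => H z.1 z.2) =
     fun z => (((k z.2)%:C%C : R[i]^o) : R[i]) *: ((nrm (D z.1 z.2))%:C%C : R[i]^o).
    by apply/funext => z; rewrite /H realcM.
  apply: cont_scale; first exact: (cont_comp (@cont_snd _ _) (cont_real ck)).
  apply: cont_real; apply: cont_nrm.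
  have -> : (fun z : G * G => D z.1 z.2) = (fun z => ccu z.2 h z.1 + (- 1) *: ccu t0 h z.1).
    by apply/funext => z; rewrite scaleN1r.
  by apply: cont_add => //; apply: (@cont_scale _ _ A (fun=> -1)) => //; exact: cont_cst.
have HK s t : ~ KK s -> H s t = 0.
  move=> ns; rewrite /H.
  have [Kt|nKt] := pselect (K' t); last by rewrite (realcI (K'P t nKt)) mul0r.
  rewrite /D /= KP; last first.
    by move=> Ks; apply: ns; rewrite -[s](mulVKg t); apply: mulsetP => //; left.
  rewrite KP; last first.
    by move=> Ks; apply: ns; rewrite -[s](mulVKg t0); apply: mulsetP => //; right.
  by rewrite !gact0 subr0 nrm0 mulr0.
have cQ := bd_cont hausG lcG haarI (I_bounded hausG haarI) cKK cH HK.
have CD t : Ccr (fun s => nrm (D s t)) by exact: (Ccr_nrm hausG (ccP (ccu t h - ccu t0 h))).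
have QE t : I (fun s => H s t) = (k t * L1 (ccu t h - ccu t0 h : V))%:C%C.
  by rewrite (J_real hausG haarI (CcrZ hausG (k t) (CD t))) (JZ hausG haarI _ (CD t)).
have /contP/(_ t0 (e / 2) ltac:(lra)) := cQ.
have k1 : k t0 = 1 by exact: kt0.
have nk : \forall t \near t0, 2^-1 < k t.
  have /contrP/(_ t0 2^-1 ltac:(lra)) := ck; rewrite k1; apply: filterS => t.
  by rewrite ltr_norml => /andP[h1 h2]; lra.
move: nk; apply: filterS2 => t kt.
rewrite !QE subrr.
have -> : L1 (0 : V) = 0.
  have := I_Z hausG haarI 0 (Ccr_nrm hausG (ccP (0 : V))).
  have C0 := Ccr_nrm hausG (ccP (0 : V)).
  rewrite /L1.
  have := JZ hausG haarI 0 C0; rewrite mul0r => <- _.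
  by congr J; apply/funext => s; rewrite nrm0 mulr0.
rewrite mulr0 nrmc subr0 cabs_real => lt.
have := cc_l1_ge0 (ccu t h - ccu t0 h); move: lt.
move: (L1 _) kt => x kt lt x0; rewrite ltNge; apply/negP => ex.
have : e / 2 <= k t * x.
  by rewrite mulrC; apply: ler_pM => //; [lra|exact: ltW].
rewrite leNgt => /negP; apply; apply: le_lt_trans lt; exact: ler_norm.
Qed.

Section State.
Context (om : V -> R[i]).
Hypotheses (omL : lin om) (omB : forall f, cabs (om f) <= L1 f)
  (omP : forall f, 0 <= om (smul SA (sstar SA f) f)).

Local Notation form := (gnsf SA om).
Local Notation N := (fnorm form).

Lemma form_psd : psd_form form. Proof. exact: gnsf_psd. Qed.

Lemma form_bound f g : cabs (form f g) <= L1 f * L1 g.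
Proof. by apply: (le_trans (omB _)); apply: (le_trans (mul_l1 _ _)); rewrite mul_star_l1. Qed.

Lemma fnorm_l1 f : N f <= L1 f.
Proof.
rewrite -(ler_pXn2r (n := 2)) ?nnegrE ?fnorm_ge0 ?cc_l1_ge0 // (fnorm_sqr form_psd).
by apply: (le_trans (Re_le_cabs _)); rewrite expr2 form_bound.
Qed.

Lemma form_act a f g : form (ccact a f) g = form f (ccact (astar a) g).
Proof. by rewrite /gnsf act_adj. Qed.
Lemma form_u r f g : form (ccu r f) (ccu r g) = form f g.
Proof. by rewrite /gnsf u_adj. Qed.
Lemma fnorm_u r f : N (ccu r f) = N f. Proof. by rewrite /fnorm form_u. Qed.

(** Multiplication by [a] is bounded for the form because it is so for the L1-norm,
    by the power argument of [form_power]. *)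
Lemma fnorm_act a f : N (ccact a f) <= nrm a * N f.
Proof.
have n0 := fnorm_ge0 form f; have a0 := nrm_ge0 a.
rewrite -(ler_pXn2r (n := 2)) ?nnegrE ?mulr_ge0 ?fnorm_ge0 // exprMn.
rewrite (fnorm_sqr form_psd) form_act.
apply: (form_power form_psd (H := fun g => ccact (astar a) (ccact a g)) (C := L1 f * L1 f)).
- exact: sqr_ge0.
- by move=> g g'; rewrite !form_act astarK.
move=> k; apply: (le_trans (form_bound _ _)); rewrite -mulrA ler_wpM2l ?cc_l1_ge0 //.
elim: (2 ^ k)%N => [|n IHn]; first by rewrite mulr1.
rewrite iterS exprS mulrCA expr2 -!mulrA.
apply: (le_trans (L1_act _ _)); rewrite nrm_astar ler_wpM2l //.
apply: (le_trans (L1_act _ _)); rewrite ler_wpM2l // -expr2; exact: IHn.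
Qed.

Lemma form_tocc_bd f : L1_bounded I (fun F : G -> A => form f (tocc F) : R[i]^o) (L1 f).
Proof.
split; last first.
- move=> F CF; rewrite (@toccE F (mkcc CF)) // nrmc; exact: form_bound.
- exact: cc_l1_ge0.
move=> c F F' CF CF'; rewrite (@toccE _ (c *: mkcc CF + mkcc CF')) //.
by rewrite (@toccE F (mkcc CF)) // (@toccE F' (mkcc CF')) // (psd_lin form_psd).
Qed.

(** Left convolution is the integrated form of the covariant pair. *)
Lemma form_conv f g h :
  form f (smul SA g h) = I (fun t => form f (ccact (g t) (ccu t h))).
Proof.
have [K [cK KP]] := Cc_elim (ccP g); have [K' [cK' K'P]] := Cc_elim (ccP h).
have [z1 z2] := cint_supp KP K'P.
have cH : continuous (fun z : G * G => cint g h z.2 z.1).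
  exact: (cont_comp (cont_pair (@cont_snd _ _) (@cont_fst _ _)) (cont_cint (ccP g) (ccP h))).
have := integral_swap hausG lcG haarI (H := fun s t => cint g h t s) (vint_bounded hausG lcG haarI A)
  (fun (h : G -> R) v Ch => vint_simple hausG lcG haarI v Ch) (form_tocc_bd f)
  (compact_mulset cK cK') cK cH (fun s t => z2 t s) (fun s t => z1 t s).
rewrite (@toccE _ (smul SA g h)) // => ->.
by congr I; apply/funext => t; rewrite (@toccE _ (ccact (g t) (ccu t h))).
Qed.

End State.
End Covariant.

(** * Completely positive maps into the bidual *)

Section Bidual.
Context (R : realType) (A : cstarAlgType R).
Implicit Types (Phi : functional A) (phi psi : A -> R[i]).

Lemma dual_norm_le phi (C : R) : 0 <= C -> (forall a, cabs (phi a) <= C * nrm a) ->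
  dual_norm phi <= C.
Proof.
move=> C0 pC; apply: ge_sup; first by exists (cabs (phi 0)), 0 => //=; rewrite normr0.
move=> _ [a /= a1 <-]; apply: (le_trans (pC a)); rewrite -[leRHS]mulr1 ler_wpM2l //.
by move: a1; rewrite nrmE -[1]/((1 : R)%:C%C) lecRE.
Qed.

Lemma dual_norm_ge0 phi : dual phi -> 0 <= dual_norm phi.
Proof.
move=> dphi; have [pl [K K0 pK]] := dual_bound dphi.
apply: ub_le_sup; last first.
  by exists 0; [rewrite /= normr0|rewrite (lin0 pl) normr0].
exists K => _ [a /= a1 <-]; apply: (le_trans (pK a)); rewrite -[leRHS]mulr1 ler_wpM2l //.
by move: a1; rewrite nrmE -[1]/((1 : R)%:C%C) lecRE.
Qed.

Lemma dual0 : dual (fun=> 0 : R[i]) (A := A).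
Proof. by apply: (dual_bounded (M := 0)) => [c x y|x]; rewrite ?mulr0 ?addr0 // cabs0 mul0r. Qed.

Lemma dualD phi psi : dual phi -> dual psi -> dual (fun a => phi a + psi a).
Proof.
move=> dp dq; have [pl [M _ pM]] := dual_bound dp; have [ql [M' _ qM]] := dual_bound dq.
apply: (dual_bounded (M := M + M')) => [c a b|a]; first by rewrite pl ql mulrDr addrACA.
by apply: (le_trans (cabsD _ _)); rewrite mulrDl lerD.
Qed.

Section One.
Context (Phi : functional A) (bP : bidual Phi).

Lemma bid_lin c phi psi : dual phi -> dual psi ->
  Phi (fun a => c * phi a + psi a) = c * Phi phi + Phi psi.
Proof. by case: bP => + _; apply. Qed.
Lemma bid0 : Phi (fun=> 0) = 0.
Proof.
have := bid_lin 1 dual0 dual0.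
have -> : (fun a : A => 1 * 0 + 0) = (fun=> 0 : R[i]) by apply/funext => a; rewrite mulr0 addr0.
by rewrite mul1r -{1}[Phi _]addr0 => /addrI.
Qed.
Lemma bidZ c phi : dual phi -> Phi (fun a => c * phi a) = c * Phi phi.
Proof.
move=> dp; have := bid_lin c dp dual0; rewrite bid0 addr0 => <-.
by congr Phi; apply/funext => a; rewrite addr0.
Qed.
Lemma bidD phi psi : dual phi -> dual psi -> Phi (fun a => phi a + psi a) = Phi phi + Phi psi.
Proof.
move=> dp dq; have := bid_lin 1 dp dq; rewrite mul1r => <-.
by congr Phi; apply/funext => a; rewrite mul1r.
Qed.
Lemma bid_bd : exists2 M : R, 0 <= M & forall phi C, lin phi -> 0 <= C ->
  (forall a, cabs (phi a) <= C * nrm a) -> cabs (Phi phi) <= M * C.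
Proof.
have [_ [M MP]] := bP; exists `|M|; first exact: normr_ge0.
move=> phi C pl C0 pC; have := MP phi (dual_bounded pl pC) => /le_trans; apply.
apply: (@le_trans _ _ (`|M| * dual_norm phi)).
  by rewrite ler_wpM2r ?ler_norm ?(dual_norm_ge0 (dual_bounded pl pC)).
by rewrite ler_wpM2l ?normr_ge0 // dual_norm_le.
Qed.

Lemma dual_sum (T : Type) (s : seq T) (F : T -> A -> R[i]) :
  (forall x, dual (F x)) -> dual (fun a => \sum_(x <- s) F x a).
Proof.
move=> dF; elim: s => [|x s IHs].
  by have := dual0; congr dual; apply/funext => a; rewrite big_nil.
have := dualD (dF x) IHs; congr dual; apply/funext => a; rewrite big_cons //.
Qed.

Lemma bid_sum (T : Type) (s : seq T) (F : T -> A -> R[i]) : (forall x, dual (F x)) ->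
  Phi (fun a => \sum_(x <- s) F x a) = \sum_(x <- s) Phi (F x).
Proof.
move=> dF; elim: s => [|x s IHs].
  by rewrite big_nil -[RHS]bid0; congr Phi; apply/funext => a; rewrite big_nil.
rewrite big_cons -IHs -bidD //; last exact: dual_sum.
by congr Phi; apply/funext => a; rewrite big_cons.
Qed.

Lemma bid_norm phi C : lin phi -> 0 <= C -> (forall a, cabs (phi a) <= C * nrm a) ->
  cabs (Phi phi) <= bidual_norm Phi * C.
Proof.
move=> pl C0 pC; have dp := dual_bounded pl pC.
have [C00|Cn] := eqVneq C 0.
  suff -> : phi = (fun=> 0) by rewrite bid0 cabs0 C00 mulr0.
  apply/funext => a; apply/eqP; rewrite -cabs_eq0 eq_le cabs_ge0 andbT.
  by have := pC a; rewrite C00 mul0r.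
have Cp : 0 < C by rewrite lt_neqAle eq_sym Cn.
rewrite -ler_pdivrMr //.
have pb a : cabs ((C^-1)%:C%C * phi a) <= 1 * nrm a.
  rewrite cabsM cabs_real ger0_norm ?invr_ge0 // mul1r mulrC ler_pdivrMr // mulrC.
  exact: pC.
have pl' : lin (fun a => (C^-1)%:C%C * phi a).
  by move=> c x y; rewrite pl mulrDr mulrCA.
have -> : cabs (Phi phi) / C = cabs (Phi (fun a => (C^-1)%:C%C * phi a)).
  by rewrite bidZ // cabsM cabs_real ger0_norm ?invr_ge0 // mulrC.
apply: ub_le_sup; last first.
  exists (fun a => (C^-1)%:C%C * phi a); last by [].
  by split; [exact: dual_bounded pl' pb|exact: dual_norm_le ler01 pb].
have [_ [M MP]] := bP.
exists `|M| => _ [psi /= [dpsi n1] <-]; apply: (le_trans (MP _ dpsi)).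
apply: (@le_trans _ _ (`|M| * dual_norm psi)); first by rewrite ler_wpM2r ?ler_norm ?dual_norm_ge0.
by rewrite -[leRHS]mulr1 ler_wpM2l.
Qed.
End One.
End Bidual.

Lemma ge0_approx (R : realType) (c : R[i]) (C : R) :
  (forall e, 0 < e -> exists2 r : R, 0 <= r & cabs (c - r%:C%C) <= C * e) -> 0 <= c.
Proof.
move=> H; have Ip (z : R[i]) : `|complex.Im z| <= cabs z.
  have e : complex.Re ((- 'i) * z) = complex.Im z.
    by case: z => a b; rewrite -complexiE /= oppr0 mul0r sub0r mulN1r opprK.
  rewrite ler_norml -e; have h1 := Re_le_cabs (- 'i * z); have h2 := Re_le_cabs (- (- 'i * z)).
  move: h1 h2; rewrite ReN !cabsN cabsM cabsN cabs_i mul1r => h1 h2.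
  by rewrite h1 lerNl h2.
have Im0 : `|complex.Im c| = 0.
  apply: (@small_eq0 _ _ C) => // e /H[r r0 h]; apply: le_trans h.
  have := Ip (c - r%:C%C); congr (`|_| <= _); case: (c) => a b /=.
  by rewrite subr0.
have m0 : Num.max (- complex.Re c) 0 = 0.
  apply: (@small_eq0 _ _ C); first by rewrite le_max lexx orbT.
  move=> e /H[r r0 h]; rewrite ge_max (le_trans (cabs_ge0 _) h) andbT.
  have := le_trans (Re_le_cabs (- (c - r%:C%C))) _; rewrite cabsN => /(_ _ h).
  rewrite ReN ReB ReC => h'; move: r0 h'; clear; move: (C * e) (complex.Re c) => x y; lra.
have Re0 : 0 <= complex.Re c by rewrite -oppr_le0 -m0 le_max lexx.
by move/eqP: Im0; rewrite normr_eq0 lecE Re0 andbT => /eqP ->.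
Qed.

(** For a module [V] over [A] with an invariant form, the coefficients
    a |-> <h, a h'> are functionals on [A]; applying elements of the bidual to them
    replaces the normal extension of a representation. *)
Section Kernel.
Context (R : realType) (A : cstarAlgType R) (V : lmodType R[i]).
Context (form : V -> V -> R[i]) (psd : psd_form form) (act : A -> V -> V).
Local Notation N := (fnorm form).
Hypotheses (actl : forall c a b v, act (c *: a + b) v = c *: act a v + act b v)
  (actr : forall c a v w, act a (c *: v + w) = c *: act a v + act a w)
  (actM : forall a b v, act a (act b v) = act (amul a b) v)
  (actS : forall a v w, form (act a v) w = form v (act (astar a) w))
  (actN : forall a v, N (act a v) <= nrm a * N v).

Definition mcoef h h' : A -> R[i] := fun a => form h (act a h').

Lemma mcoef_lin h h' : lin (mcoef h h').
Proof. by move=> c a b; rewrite /mcoef actl (psd_lin psd). Qed.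
Lemma mcoef_bound h h' a : cabs (mcoef h h' a) <= N h * N h' * nrm a.
Proof.
apply: (le_trans (schwarz psd _ _)); rewrite -mulrA ler_wpM2l ?fnorm_ge0 // mulrC.
exact: actN.
Qed.
Lemma mcoef_dual h h' : dual (mcoef h h').
Proof. exact: dual_bounded (mcoef_lin h h') (mcoef_bound h h'). Qed.
Lemma NN_ge0 h h' : 0 <= N h * N h'.
Proof. by rewrite mulr_ge0 ?fnorm_ge0. Qed.

Lemma mcoef_linr c h h1 h2 : mcoef h (c *: h1 + h2) = fun a => c * mcoef h h1 a + mcoef h h2 a.
Proof. by apply/funext => a; rewrite /mcoef actr (psd_lin psd). Qed.
Lemma mcoef_linl c h h1 h2 : mcoef (c *: h1 + h2) h = fun a => c^* * mcoef h1 h a + mcoef h2 h a.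
Proof. by apply/funext => a; rewrite /mcoef (psdDl psd) (psdZl psd). Qed.

(** The normal extension of a representation is a *-homomorphism on the bidual,
    applied to the sum of the y_i h_i: the sum is the squared norm of that vector,
    which need not exist in [V]. It is a limit of vectors [w] of [V]: the
    functional v |-> <sum of y_i h_i, v> is approximately v |-> <w, v>, and its value at
    [w] is approximately |w|^2. *)
Lemma bidual_pos n (Y : 'I_n -> functional A) (h : 'I_n -> V) : (forall i, bidual (Y i)) ->
  0 <= \sum_i \sum_j bidual_mul (bidual_star (Y i)) (Y j) (mcoef (h i) (h j)).
Proof.
move=> bY.
have bdY i : exists m : R, 0 <= m /\ forall phi C, lin phi -> 0 <= C ->
    (forall a : A, cabs (phi a) <= C * nrm a) -> cabs (Y i phi) <= m * C.
  by have [m m0 mP] := bid_bd (bY i); exists m.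
have [M MP] := choice bdY.
pose l v := \sum_j (Y j (mcoef v (h j)))^*.
pose K := \sum_j M j * N (h j).
have K0 : 0 <= K by apply: sumr_ge0 => j _; rewrite mulr_ge0 ?fnorm_ge0 //; case: (MP j).
have ll : lin l.
  move=> c v w; rewrite /l mulr_sumr -big_split; apply: eq_bigr => j _.
  rewrite mcoef_linl (bid_lin (bY j)); try exact: mcoef_dual.
  by rewrite conjcD conjcM conjCK.
have lb v : cabs (l v) <= K * N v.
  apply: (le_trans (cabs_sum _ _ _)); rewrite mulr_suml; apply: ler_sum => j _.
  rewrite cabs_conj; have [M0 bj] := MP j.
  have := bj _ _ (mcoef_lin v (h j)) (NN_ge0 v (h j)) (mcoef_bound v (h j)).
  by rewrite [N v * _]mulrC mulrA.
have lact i : lin (fun a => l (act a (h i))) /\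
    forall a, cabs (l (act a (h i))) <= K * N (h i) * nrm a.
  split=> [c a b|a]; first by rewrite actl ll.
  by apply: (le_trans (lb _)); rewrite -mulrA ler_wpM2l // mulrC actN.
have -> : \sum_i \sum_j bidual_mul (bidual_star (Y i)) (Y j) (mcoef (h i) (h j)) =
   \sum_i (Y i (fun a => l (act a (h i))))^*.
  apply: eq_bigr => i _; rewrite (bid_sum (bY i)) ?conjc_sum; last first.
    move=> j; have [M0 bj] := MP j.
    apply: (dual_bounded (M := M j * (N (h i) * N (h j)))) => [c a b|a].
      rewrite actl mcoef_linl (bid_lin (bY j)); try exact: mcoef_dual.
      by rewrite conjcD conjcM conjCK.
    rewrite cabs_conj.
    have := bj _ _ (mcoef_lin (act a (h i)) (h j)) (NN_ge0 _ (h j)) (mcoef_bound _ (h j)).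
    move=> /le_trans; apply; rewrite -mulrA ler_wpM2l // mulrAC ler_wpM2r ?fnorm_ge0 //.
    by rewrite mulrC actN.
  apply: eq_bigr => j _; rewrite /bidual_mul /bidual_star; congr ((Y i _)^*).
  apply/funext => a; congr ((Y j _)^*); apply/funext => b.
  by rewrite /mcoef actS actM.
apply: (@ge0_approx _ _ (K + 1 + K)) => e0 ep0.
pose e := Num.min e0 1; have ep : 0 < e by rewrite lt_min ep0 ltr01.
have [w wP] := approx_riesz psd ll K0 lb ep.
have e1 : e <= 1 by rewrite ge_min lexx orbT.
have Nw : N w <= K + 1.
  have := wP w; rewrite (fnorm_sqrc psd) => h1.
  have : N w ^+ 2 <= (K + 1) * N w.
    have := cabsB (l w) (l w - (N w ^+ 2)%:C%C); rewrite opprB addrC subrK.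
    rewrite cabs_real ger0_norm ?sqr_ge0 // => h2; apply: (le_trans h2).
    rewrite mulrDl mul1r; apply: lerD; first exact: lb.
    by apply: (le_trans h1); rewrite -[leRHS]mul1r ler_wpM2r ?fnorm_ge0.
  have [->|wn] := eqVneq (N w) 0; first by rewrite addr_ge0.
  by rewrite expr2 ler_pM2r // lt_neqAle eq_sym wn fnorm_ge0.
exists (N w ^+ 2); first exact: sqr_ge0.
apply: (@le_trans _ _ ((K + 1 + K) * e)); last by rewrite ler_wpM2l ?addr_ge0 // ge_min lexx.
have dD i : lin (fun a => l (act a (h i)) - form w (act a (h i))) /\
    forall a, cabs (l (act a (h i)) - form w (act a (h i))) <= e * N (h i) * nrm a.
  split=> [c a b|a]; first by rewrite actl ll (psd_lin psd) mulrBr opprD addrACA.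
  by apply: (le_trans (wP _)); rewrite -mulrA ler_wpM2l ?(ltW ep) // mulrC actN.
have E : \sum_i (Y i (fun a => l (act a (h i))))^* =
    \sum_i (Y i (fun a => l (act a (h i)) - form w (act a (h i))))^* + l w.
  rewrite -[l w]/(\sum_i (Y i (mcoef w (h i)))^*) -big_split /=.
  apply: eq_bigr => i _; have [dl dB] := dD i.
  rewrite -conjcD -(bidD (bY i)); [|exact: dual_bounded dl dB|exact: mcoef_dual].
  by congr ((Y i _)^*); apply/funext => a; rewrite subrK.
rewrite E -(fnorm_sqrc psd) -addrA mulrDl addrC; apply: (le_trans (cabsD _ _)).
apply: lerD.
  by apply: (le_trans (wP w)); rewrite mulrC ler_wpM2r ?(ltW ep).
apply: (le_trans (cabs_sum _ _ _)); rewrite mulr_suml; apply: ler_sum => i _.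
have [M0 bi] := MP i; have [dl dB] := dD i.
rewrite cabs_conj -mulrA [N (h i) * e]mulrC; apply: bi => //.
by rewrite mulr_ge0 ?fnorm_ge0 // ltW.
Qed.

Section CCP.
Context (B : cstarAlgType R) (P : B -> functional A) (ccpP : ccp P).

(** The inner product of the elementary tensors b (x) h and b' (x) h' in the
    Stinespring dilation of [P]. *)
Definition ker (b : B) (h : V) (b' : B) (h' : V) : R[i] :=
  P (amul (astar b) b') (mcoef h h').

Lemma ccp_bid b : bidual (P b). Proof. by case: ccpP. Qed.
Lemma ccp_lin phi c b b' : dual phi -> P (c *: b + b') phi = c * P b phi + P b' phi.
Proof. by case: ccpP => _ + _ _ dp => /(_ c b b' phi dp). Qed.
Lemma ccp_bound phi b C : lin phi -> 0 <= C -> (forall a, cabs (phi a) <= C * nrm a) ->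
  cabs (P b phi) <= nrm b * C.
Proof.
move=> pl C0 pC; apply: (le_trans (bid_norm (ccp_bid b) pl C0 pC)).
by rewrite ler_wpM2r //; case: ccpP.
Qed.

Lemma ker_bound b h b' h' : cabs (ker b h b' h') <= nrm b * nrm b' * (N h * N h').
Proof.
apply: (le_trans (ccp_bound _ (mcoef_lin h h') (NN_ge0 h h') (mcoef_bound h h'))).
rewrite ler_wpM2r ?NN_ge0 //; apply: (le_trans (nrm_amul _ _)).
by rewrite nrm_astar.
Qed.

Lemma ker_linb b h h' : lin (fun b' => ker b h b' h').
Proof. by move=> c x y; rewrite /ker amulDr ccp_lin //; exact: mcoef_dual. Qed.
Lemma ker_linh b h b' : lin (fun h' => ker b h b' h').
Proof.
by move=> c x y; rewrite /ker mcoef_linr (bid_lin (ccp_bid _)) //; exact: mcoef_dual.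
Qed.
Lemma ker_antib c x y h b' h' :
  ker (c *: x + y) h b' h' = c^* * ker x h b' h' + ker y h b' h'.
Proof.
by rewrite /ker astar_antilinear amulDl ccp_lin //; exact: mcoef_dual.
Qed.
Lemma ker_antih c x y b b' h' :
  ker b (c *: x + y) b' h' = c^* * ker b x b' h' + ker b y b' h'.
Proof. by rewrite /ker mcoef_linl (bid_lin (ccp_bid _)) //; exact: mcoef_dual. Qed.

(** The matrix b_i^* b_j is positive, hence so is its image under [P]; the
    coefficients turn the squares in the bidual into the sums of [bidual_pos]. *)
Lemma ker_pos_ord n (b : 'I_n -> B) (h : 'I_n -> V) :
  0 <= \sum_i \sum_j ker (b i) (h i) (b j) (h j).
Proof.
have [_ _ _ cp] := ccpP.
pose x : 'M[B]_n := \matrix_(i, j) amul (astar (b i)) (b j).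
have [|y [yb yP]] := cp n x.
  (* x is the square of the matrix with first row b and zeros below *)
  exists (\matrix_(k, i) if (k : nat) == 0 then b i else 0) => i j.
  have n0 : (0 < n)%N by apply: leq_trans (ltn_ord i).
  rewrite (bigD1 (Ordinal n0)) //= big1 ?addr0 ?mxE //= => k kn.
  rewrite !mxE; case: eqP => [k0|_]; last by rewrite amul0r.
  by case/eqP: kn; apply: val_inj.
have -> : \sum_i \sum_j ker (b i) (h i) (b j) (h j) =
    \sum_k \sum_i \sum_j bidual_mul (bidual_star (y k i)) (y k j) (mcoef (h i) (h j)).
  rewrite [RHS]exchange_big; apply: eq_bigr => i _; rewrite [RHS]exchange_big.
  apply: eq_bigr => j _; rewrite -(yP i j _ (mcoef_dual (h i) (h j))).
  by rewrite /ker !mxE.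
by apply: sumr_ge0 => k _; apply: bidual_pos => i; exact: yb.
Qed.

Lemma ker_pos (T : Type) (s : seq T) (b : T -> B) (h : T -> V) :
  0 <= \sum_(x <- s) \sum_(y <- s) ker (b x) (h x) (b y) (h y).
Proof.
rewrite big_tnth.
have -> : \sum_(i < size s) \sum_(y <- s)
     ker (b (tnth (in_tuple s) i)) (h (tnth (in_tuple s) i)) (b y) (h y) =
   \sum_(i < size s) \sum_(j < size s) ker (b (tnth (in_tuple s) i))
     (h (tnth (in_tuple s) i)) (b (tnth (in_tuple s) j)) (h (tnth (in_tuple s) j)).
  by apply: eq_bigr => i _; rewrite big_tnth.
exact: (ker_pos_ord (fun i => b (tnth (in_tuple s) i)) (fun i => h (tnth (in_tuple s) i))).
Qed.
End CCP.
End Kernel.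

(** * Integrals of positive definite kernels *)

Section PositiveKernels.
Context (R : realType) (G : topologicalGroupType).
Hypotheses (hausG : hausdorff_space G) (lcG : locally_compact [set: G]).
Context (I : (G -> R[i]) -> R[i]) (haarI : haar_integral I).
Notation Ccr := (@Ccr R G).
Notation J := (J I).

Lemma Cc_comb (T : eqType) (s : seq T) (g : T -> G -> R) (v : T -> R[i]^o) :
  (forall x, Ccr (g x)) -> Cc (fun t => \sum_(x <- s) (g x t)%:C%C * v x : R[i]^o).
Proof.
move=> Cg; apply: (@Cc_sum _ _ hausG R[i]^o) => x _.
by apply: (@Cc_scale _ _ hausG R[i]^o); exact: Cg.
Qed.

Lemma I_comb (T : eqType) (s : seq T) (g : T -> G -> R) (v : T -> R[i]^o) :
  (forall x, Ccr (g x)) ->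
  I (fun t => \sum_(x <- s) (g x t)%:C%C * v x) = \sum_(x <- s) (J (g x))%:C%C * v x.
Proof.
move=> Cg; rewrite (I_sum hausG haarI) => [|x _].
  apply: eq_bigr => x _; rewrite (I_Zr hausG haarI); last exact: Cg.
  by rewrite (J_real hausG haarI (Cg x)).
by apply: (@Cc_scale _ _ hausG R[i]^o); exact: Cg.
Qed.

Lemma I_dist (f g : G -> R[i]^o) (k : G -> R) : Cc f -> Cc g -> Ccr k ->
  (forall t, cabs (f t - g t) <= k t) -> cabs (I f - I g) <= J k.
Proof.
move=> Cf Cg Ck le; rewrite -(I_B haarI) //.
have := bd_le hausG haarI (I_bounded hausG haarI) (CcB hausG Cf Cg) Ck.
by rewrite mul1r; apply=> t; exact: le.
Qed.

Lemma Ccr_comb2 (a b : R) f g : Ccr f -> Ccr g -> Ccr (fun t => a * f t + b * g t).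
Proof. by move=> Cf Cg; exact: (CcrD hausG (CcrZ hausG a Cf) (CcrZ hausG b Cg)). Qed.

Lemma J_comb2 (a b : R) f g : Ccr f -> Ccr g ->
  J (fun t => a * f t + b * g t) = a * J f + b * J g.
Proof.
move=> Cf Cg; rewrite (JD haarI (CcrZ hausG a Cf) (CcrZ hausG b Cg)).
by rewrite (JZ hausG haarI a Cf) (JZ hausG haarI b Cg).
Qed.

(** The double integral is a limit of the sums of the hypothesis over Riemann
    subdivisions. One family of points serves both variables, which is what makes
    the sums positive. *)
Theorem pd_integral (kap : G -> G -> R[i]^o) (K : set G) : compact K ->
  continuous (fun z : G * G => kap z.1 z.2) ->
  (forall s r, ~ K s -> kap s r = 0) -> (forall s r, ~ K r -> kap s r = 0) ->
  (forall (l : seq G) (c : G -> R),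
     0 <= \sum_(x <- l) \sum_(y <- l) (c x * c y)%:C%C * kap x y) ->
  0 <= I (fun s => I (fun r => kap s r)).
Proof.
move=> cK ck k1 k2 pos.
have [u [Cu cu u01 uK]] := Urysohn_Cc R hausG lcG cK.
have [K' [cK' K'P]] := Cc_elim Cu.
have KK' s : K s -> K' s.
  by move=> Ks; apply: contrapT => /K'P/realcI; rewrite uK // => /eqP; rewrite oner_eq0.
have k1' s r : ~ K' s -> kap s r = 0 by move=> ns; apply: k1 => /KK'.
have k2' s r : ~ K' r -> kap s r = 0 by move=> ns; apply: k2 => /KK'.
have u0 t : 0 <= u t by have /andP[] := u01 t.
have [k [Ck kp kP]] := riemann_sums R hausG lcG cK'.
have Ju : 0 <= J u by exact: J_ge0.
have Jk : 0 <= J k by exact: J_ge0.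
(* the parameters (r, b) make one subdivision serve both variables; the parameter
   None bounds the total mass of the weights at points of K, where u is 1 *)
pose F (t : G) (th : option (G * bool)) : R[i]^o :=
  if th is Some (r, b) then (if b then kap t r else kap r t) else (u t)%:C%C.
have F0 s th : ~ K' s -> F s th = 0.
  by move=> ns; case: th => [[r []]|] /=; [exact: k1'|exact: k2'|exact: K'P].
have csw : continuous (fun z : G * G => kap z.2 z.1).
  exact: (cont_comp (cont_pair (@cont_snd _ _) (@cont_fst _ _)) ck).
have FE s e : 0 < e -> \forall s' \near s, forall th, nrm (F s' th - F s th) < e.
  move=> e0.
  have t1 := tube (H := fun r t => kap t r) s cK csw (fun r t => @k2 t r) e0.
  have t2 := tube (H := kap) s cK ck k1 e0.
  have /contP/(_ s e e0) := cont_real cu.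
  by move: t1 t2; apply: filterS3 => s' h1 h2 h3 [[r []]|] /=; [exact: h1|exact: h2|exact: h3].
have CIs s : Cc (fun r => kap s r : R[i]^o).
  refine (Cc_intro hausG _ cK (k2 s)).
  exact: (cont_comp (cont_pair (@cont_cst _ _ s) (@cont_id G)) ck).
have CI : Cc (fun s => I (fun r => kap s r) : R[i]^o).
  exact: (bd_Cc hausG lcG haarI (I_bounded hausG haarI) cK cK csw (fun r s => @k2 s r) (fun r s => @k1 s r)).
apply: (@ge0_approx _ _ (J k * J u + (J u + J k) * J k)) => e0 e00.
pose e := Num.min e0 1; have ep : 0 < e by rewrite lt_min e00 ltr01.
have e1 : e <= 1 by rewrite ge_min lexx orbT.
have [l [g [Cg g0 gP gN]]] := kP _ _ F F0 FE e ep.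
pose c x : R[i]^o := \sum_(y <- l) (J (g y))%:C%C * kap x y.
exists (complex.Re (\sum_(x <- l) \sum_(y <- l) (J (g x) * J (g y))%:C%C * kap x y)).
  by have := pos l (fun x => J (g x)); rewrite lecE => /andP[].
rewrite -(ger0_complexE (pos l (fun x => J (g x)))).
have -> : \sum_(x <- l) \sum_(y <- l) (J (g x) * J (g y))%:C%C * kap x y =
    I (fun s => \sum_(x <- l) (g x s)%:C%C * c x).
  rewrite (I_comb _ _ Cg); apply: eq_bigr => x _; rewrite mulr_sumr.
  by apply: eq_bigr => y _; rewrite realcM mulrA.
have Cb s : Ccr (fun r => e * k s * u r + (u s + e * k s) * e * k r).
  exact: (Ccr_comb2 _ _ Cu Ck).
have Cb2 : Ccr (fun s => e * (J u + e * J k) * k s + e * J k * u s).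
  exact: (Ccr_comb2 _ _ Ck Cu).
apply: (@le_trans _ _ (J (fun s => e * (J u + e * J k) * k s + e * J k * u s))); last first.
  rewrite (J_comb2 _ _ Ck Cu).
  have ee : e <= e0 by rewrite ge_min lexx.
  have h1 : 0 <= J k * J u by rewrite mulr_ge0.
  have h2 : 0 <= J k * J k by rewrite mulr_ge0.
  apply: (@le_trans _ _ ((J k * J u + (J u + J k) * J k) * e)); last first.
    by rewrite ler_wpM2l // addr_ge0 // mulr_ge0 // addr_ge0.
  have -> : e * (J u + e * J k) * J k + e * J k * J u =
     (J k * J u + (J u + e * J k) * J k) * e by ring.
  rewrite ler_wpM2r ?(ltW ep) // lerD2l ler_wpM2r // lerD2l -[leRHS]mul1r ler_wpM2r //.
apply: (I_dist CI (Cc_comb l c Cg) Cb2) => s.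
have -> : e * (J u + e * J k) * k s + e * J k * u s =
    J (fun r => e * k s * u r + (u s + e * k s) * e * k r).
  by rewrite (J_comb2 _ _ Cu Ck); ring.
pose S r : R[i]^o := \sum_(x <- l) (g x s)%:C%C * \sum_(y <- l) (g y r)%:C%C * kap x y.
have CS : Cc S.
  apply: (@Cc_sum _ _ hausG R[i]^o) => x _.
  apply: (@CcZ _ _ hausG R[i]^o); exact: Cc_comb.
have -> : \sum_(x <- l) (g x s)%:C%C * c x = I S.
  rewrite (I_sum hausG haarI) => [|x _]; last first.
    by apply: (@CcZ _ _ hausG R[i]^o); exact: Cc_comb.
  apply: eq_bigr => x _; rewrite (I_Z hausG haarI _ (Cc_comb l (kap x) Cg)).
  by congr (_ * _); exact/esym/(I_comb l (kap x) Cg).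
apply: (I_dist (CIs s) CS (Cb s)) => r.
have a1 : cabs (kap s r - \sum_(x <- l) (g x s)%:C%C * kap x r) <= e * k s * u r.
  have [Kr|nKr] := pselect (K r).
    by rewrite (uK _ Kr) mulr1; exact: (gP s (Some (r, true))).
  rewrite k2 // big1 ?subr0 ?cabs0 ?mulr_ge0 // ?(ltW ep) // => x _.
  by rewrite k2 // mulr0.
have a2 x : cabs (kap x r - \sum_(y <- l) (g y r)%:C%C * kap x y) <= u x * (e * k r).
  have [Kx|nKx] := pselect (K x).
    by rewrite (uK _ Kx) mul1r; exact: (gP r (Some (x, false))).
  rewrite k1 // big1 ?subr0 ?cabs0 ?mulr_ge0 // ?(ltW ep) // => y _.
  by rewrite k1 // mulr0.
have -> : kap s r - S r = (kap s r - \sum_(x <- l) (g x s)%:C%C * kap x r) +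
    \sum_(x <- l) (g x s)%:C%C * (kap x r - \sum_(y <- l) (g y r)%:C%C * kap x y).
  pose T x : R[i] := \sum_(y <- l) (g y r)%:C%C * kap x y.
  have E x : (g x s)%:C%C * (kap x r - T x) = (g x s)%:C%C * kap x r - (g x s)%:C%C * T x.
    exact: mulrBr.
  by rewrite (eq_bigr _ (fun x _ => E x)) sumrB addrA subrK.
apply: (le_trans (cabsD _ _)); apply: lerD => //.
apply: (le_trans (cabs_sum _ _ _)).
apply: (@le_trans _ _ (\sum_(x <- l) g x s * u x * (e * k r))).
  apply: ler_sum => x _; rewrite cabsM cabs_real ger0_norm // -mulrA ler_wpM2l //.
rewrite -mulr_suml -mulrA ler_wpM2r ?mulr_ge0 ?(ltW ep) //.
have := gN s None; rewrite nrmc cabs_real ger0_norm //; apply: le_trans.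
by apply: ler_sum => x _; rewrite nrmc cabs_real ger0_norm.
Qed.
End PositiveKernels.

(** * The dilated functionals on Cc(G, B) *)

Lemma cont_sum (R : realType) (V : normedModType R[i]) (T : topologicalType) (X : Type)
  (W : seq X) (f : X -> T -> V) :
  (forall x, continuous (f x)) -> continuous (fun z => \sum_(x <- W) f x z).
Proof.
move=> cf; elim: W => [|x W IHW].
  have -> : (fun z => \sum_(x <- [::]) f x z) = fun=> 0 by apply/funext => z; rewrite big_nil.
  exact: cont_cst.
have -> : (fun z => \sum_(x <- x :: W) f x z) = fun z => f x z + \sum_(x <- W) f x z.
  by apply/funext => z; rewrite big_cons.
exact: (@cont_add _ _ V (f x) _ (cf x) IHW).
Qed.

Section Extension.
Context (R : realType) (G : topologicalGroupType).
Hypotheses (hausG : hausdorff_space G) (lcG : locally_compact [set: G]).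
Context (I : (G -> R[i]) -> R[i]) (haarI : haar_integral I).
Context (Delta : G -> R) (modI : modular_function I Delta).
Context (A B : galgType R G).

Notation J := (J I).
Notation L1 := (L1 I).
Notation V := (ccT G A).
Local Notation SA := (cc_staralg hausG lcG haarI modI A).
Local Notation SB := (cc_staralg hausG lcG haarI modI B).
Local Notation act := (@ccact R G hausG A).
Local Notation u := (@ccu R G hausG A).

Context (om : V -> R[i]).
Hypotheses (omL : lin om) (omB : forall f : V, cabs (om f) <= L1 f)
  (omP : forall f, 0 <= om (smul SA (sstar SA f) f)).
Context (P : B -> functional A) (ccpP : ccp P)
  (eqP : forall t b, bidual_eq (P (gact t b)) (bidual_act t (P b))).

Local Notation form := (gnsf SA om).
Local Notation N := (fnorm form).
Local Notation mc := (@mcoef R A V form act).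
Local Notation K := (@ker R A V form act B P).
Implicit Types (b c : B) (h : V) (s t r : G).

Let psd : psd_form form := form_psd omL omP.
Let actl := @ccact_linl R G hausG A.
Let actr : forall (k : R[i]) (a : A) (v w : V), act a (k *: v + w) = k *: act a v + act a w :=
  fun k a v w => @ccact_lin R G hausG A a k v w.
Let actN := fnorm_act omL omB omP.
Let Kbd := ker_bound psd actl actN ccpP.
Let Klb := ker_linb psd actl actN ccpP.
Let Klh := ker_linh psd actl actr actN ccpP.
Let Kab := ker_antib psd actl actN ccpP.
Let Kah := ker_antih psd actl actN ccpP.

Lemma K_Bb x y h b h' : K (x - y) h b h' = K x h b h' - K y h b h'.
Proof.
have := Kab (-1) y x h b h'; rewrite scaleN1r addrC => ->.
by rewrite conjcN conjC1 mulN1r addrC.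
Qed.
Lemma K_Bh b x y b' h' : K b (x - y) b' h' = K b x b' h' - K b y b' h'.
Proof.
have := Kah (-1) y x b b' h'; rewrite scaleN1r addrC => ->.
by rewrite conjcN conjC1 mulN1r addrC.
Qed.
Lemma K_0b h b h' : K 0 h b h' = 0.
Proof. by rewrite -(subrr (0 : B)) K_Bb subrr. Qed.
Lemma K_realZ (x y : R) b h b' h' :
  K (x%:C%C *: b) h (y%:C%C *: b') h' = (x * y)%:C%C * K b h b' h'.
Proof.
rewrite (linZ (Klb _ _ _)) -[x%:C%C *: b]addr0 Kab K_0b addr0 conj_real mulrA.
by rewrite realcM [_ * x%:C%C]mulrC.
Qed.
Lemma K_amul b c h b' h' : K (amul c b) h b' h' = K b h (amul (astar c) b') h'.
Proof. by rewrite /ker astarM amulA. Qed.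

(** Translation is unitary on the dilation, because [P] is equivariant. *)
Lemma K_inv t b h b' h' : K (gact t b) (u t h) (gact t b') (u t h') = K b h b' h'.
Proof.
rewrite /ker -gact_astar -gact_amul eqP; last exact: (mcoef_dual psd actl actN).
rewrite /bidual_act; congr (P _ _); apply/funext => a.
by rewrite /mcoef /= -ccu_act form_u.
Qed.

Lemma u_near (T : topologicalType) (s : T -> G) h z0 (e : R) : continuous s -> 0 < e ->
  \forall z \near z0, N (u (s z) h - u (s z0) h) < e.
Proof.
move=> cs e0.
have H : \forall z \near z0, L1 (u (s z) h - u (s z0) h : V) < e.
  exact: cs z0 _ (ccu_cont hausG lcG haarI h (s z0) e0).
apply: filterS H => z /=; apply: le_lt_trans; exact: (fnorm_l1 omL omB omP).
Qed.

Lemma K_cont (T : topologicalType) (b b' : T -> B) (s s' : T -> G) h h' :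
  continuous b -> continuous b' -> continuous s -> continuous s' ->
  continuous (fun z => K (b z) (u (s z) h) (b' z) (u (s' z) h') : R[i]^o).
Proof.
move=> cb cb' cs cs'; apply/contP => z0 e e0.
have n0 := fnorm_ge0 form h; have n0' := fnorm_ge0 form h'.
have m0 := nrm_ge0 (b z0); have m0' := nrm_ge0 (b' z0).
(* the kernel varies by at most C * d when its four arguments vary by at most d <= 1 *)
pose C := (nrm (b' z0) + 1) * (N h * N h') + nrm (b z0) * (nrm (b' z0) + 1) * N h'
  + nrm (b z0) * (N h * N h') + nrm (b z0) * nrm (b' z0) * N h.
have C0 : 0 <= C by rewrite /C !addr_ge0 // !mulr_ge0 // addr_ge0.
pose d := Num.min 1 (e / (C + 1)).
have d0 : 0 < d by rewrite lt_min ltr01 divr_gt0 //; lra.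
have d1 : d <= 1 by rewrite ge_min lexx.
have Cd : C * d < e.
  apply: (@le_lt_trans _ _ (C * (e / (C + 1)))); first by rewrite ler_wpM2l // ge_min lexx orbT.
  rewrite mulrA ltr_pdivrMr; last lra.
  by rewrite mulrC ltr_pM2l // ltrDl.
have /contP/(_ z0 d d0) h1 := cb; have /contP/(_ z0 d d0) h2 := cb'.
have h3 := u_near h z0 cs d0; have h4 := u_near h' z0 cs' d0.
near=> z.
have e1 : nrm (b z - b z0) < d by near: z.
have e2 : nrm (b' z - b' z0) < d by near: z.
have e3 : N (u (s z) h - u (s z0) h) < d by near: z.
have e4 : N (u (s' z) h' - u (s' z0) h') < d by near: z.
have e5 : nrm (b' z) <= nrm (b' z0) + 1.
  have := nrmD (b' z - b' z0) (b' z0); rewrite subrK => /le_trans; apply.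
  by rewrite addrC lerD2l (le_trans (ltW e2)).
rewrite nrmc.
have -> : K (b z) (u (s z) h) (b' z) (u (s' z) h') - K (b z0) (u (s z0) h) (b' z0) (u (s' z0) h') =
  K (b z - b z0) (u (s z) h) (b' z) (u (s' z) h') +
  K (b z0) (u (s z) h - u (s z0) h) (b' z) (u (s' z) h') +
  K (b z0) (u (s z0) h) (b' z - b' z0) (u (s' z) h') +
  K (b z0) (u (s z0) h) (b' z0) (u (s' z) h' - u (s' z0) h').
  by rewrite K_Bb K_Bh (linB (Klb _ _ _)) (linB (Klh _ _ _)) !addrA !subrK.
apply: le_lt_trans Cd; rewrite /C 3!mulrDl.
apply: (le_trans (cabsD _ _)); apply: lerD.
  apply: (le_trans (cabsD _ _)); apply: lerD.
    apply: (le_trans (cabsD _ _)); apply: lerD.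
      apply: (le_trans (Kbd _ _ _ _)); rewrite !fnorm_u [leRHS]mulrC [leRHS]mulrA.
      by rewrite ler_wpM2r ?mulr_ge0 // ler_pM ?nrm_ge0 // ltW.
    apply: (le_trans (Kbd _ _ _ _)); rewrite !fnorm_u [N (_ - _) * _]mulrC -[leRHS]mulrA.
    apply: ler_pM; rewrite ?mulr_ge0 ?nrm_ge0 ?fnorm_ge0 // ler_wpM2l //.
    exact: ltW.
  apply: (le_trans (Kbd _ _ _ _)); rewrite !fnorm_u mulrAC.
  by rewrite ler_wpM2l ?mulr_ge0 // ltW.
apply: (le_trans (Kbd _ _ _ _)); rewrite !fnorm_u mulrA.
by rewrite ler_wpM2l ?mulr_ge0 // ltW.
Unshelve. all: by end_near.
Qed.

Section Functional.
Context (l : seq (B * V)).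

(** [dil] is the vector functional F |-> <x, F x> of the integrated form of the dilation,
    for the vector x that is the sum of the tensors b (x) h over [l]; only the
    kernel [K] is available, so it is written out by bilinearity. *)
Definition dil_coef (F : G -> B) (x y : B * V) (t : G) : R[i]^o :=
  K x.1 x.2 (amul (F t) (gact t y.1)) (u t y.2).
Definition dil (F : ccT G B) : R[i] := \sum_(x <- l) \sum_(y <- l) I (dil_coef F x y).

Lemma dil_coef_Cc (F : ccT G B) x y : Cc (dil_coef F x y).
Proof.
have [C [cC CP]] := Cc_elim (ccP F); have [cF _] := ccP F.
have z t : ~ C t -> dil_coef F x y t = 0.
  by move=> nt; rewrite /dil_coef CP // amul0l (lin0 (Klb _ _ _)).
refine (Cc_intro hausG _ cC z).
have u1 : u 1%g x.2 = x.2 by apply: ccI => t; rewrite /= invg1 mul1g gact1.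
rewrite /dil_coef -u1.
apply: (@K_cont G (fun=> x.1) _ (fun=> 1%g) id x.2 y.2); try exact: cont_cst; last exact: cont_id.
by apply: cont_amul => //; apply: cont_gact; [exact: cont_id|exact: cont_cst].
Qed.

Lemma dil_lin : lin dil.
Proof.
move=> c F F'; rewrite /dil mulr_sumr -big_split; apply: eq_bigr => x _ /=.
rewrite mulr_sumr -big_split; apply: eq_bigr => y _ /=.
rewrite -(I_lin haarI); [|exact: dil_coef_Cc|exact: dil_coef_Cc].
by congr I; apply/funext => t; rewrite /dil_coef /= amulDl (Klb _ _ _).
Qed.

Definition dil_bound := \sum_(x <- l) \sum_(y <- l) nrm x.1 * nrm y.1 * (N x.2 * N y.2).
Lemma dil_bound_ge0 : 0 <= dil_bound.
Proof.
apply: sumr_ge0 => x _; apply: sumr_ge0 => y _.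
by rewrite !mulr_ge0 ?nrm_ge0 ?fnorm_ge0.
Qed.

Lemma dil_le F : cabs (dil F) <= dil_bound * L1 F.
Proof.
rewrite /dil /dil_bound mulr_suml; apply: (le_trans (cabs_sum _ _ _)); apply: ler_sum => x _.
rewrite mulr_suml; apply: (le_trans (cabs_sum _ _ _)); apply: ler_sum => y _.
have CN := Ccr_nrm hausG (ccP F).
have := bd_le hausG haarI (I_bounded hausG haarI) (dil_coef_Cc F x y)
  (CcrZ hausG (nrm x.1 * nrm y.1 * (N x.2 * N y.2)) CN).
rewrite mul1r (JZ hausG haarI _ CN); apply => t.
apply: (le_trans (Kbd _ _ _ _)); rewrite fnorm_u [leRHS]mulrAC.
rewrite ler_wpM2r ?mulr_ge0 ?fnorm_ge0 // -mulrA ler_wpM2l ?nrm_ge0 // mulrC.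
by apply: (le_trans (nrm_amul _ _)); rewrite nrm_gact.
Qed.

(** The inner product of the vectors F(s) u_s x and F(r) u_r y of the dilation. *)
Definition orbit_kernel (F : G -> B) (x y : B * V) (s r : G) : R[i]^o :=
  K (amul (F s) (gact s x.1)) (u s x.2) (amul (F r) (gact r y.1)) (u r y.2).

Lemma orbit_kernel_cont (F : ccT G B) x y : continuous (fun z : G * G => orbit_kernel F x y z.1 z.2).
Proof.
have [cF _] := ccP F.
apply: (@K_cont (G * G)%type (fun z => amul (F z.1) (gact z.1 x.1))
  (fun z => amul (F z.2) (gact z.2 y.1)) fst snd x.2 y.2);
  try (exact: cont_fst); try (exact: cont_snd).
- apply: cont_amul; first exact: (cont_comp (@cont_fst _ _) cF).
  by apply: cont_gact; [exact: cont_fst|exact: cont_cst].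
- apply: cont_amul; first exact: (cont_comp (@cont_snd _ _) cF).
  by apply: cont_gact; [exact: cont_snd|exact: cont_cst].
Qed.

Lemma orbit_kernel0 (F : ccT G B) (C : set G) x y : (forall t, ~ C t -> F t = 0) ->
  (forall s r, ~ C s -> orbit_kernel F x y s r = 0) /\ (forall s r, ~ C r -> orbit_kernel F x y s r = 0).
Proof.
move=> CP; split=> s r n; rewrite /orbit_kernel; first by rewrite CP // amul0l K_0b.
by rewrite (CP r) // amul0l (lin0 (Klb _ _ _)).
Qed.

(** <x, (F^* F) x> is the squared norm of F x, the integral of the F(s) u_s x; this
    follows from the formula for f^* g, the invariance [K_inv] and Fubini. *)
Lemma dil_star_mul F x y : I (dil_coef (smul SB (sstar SB F) F) x y) =
  I (fun s => I (fun r => orbit_kernel F x y s r)).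
Proof.
have [C [cC CP]] := Cc_elim (ccP F); have [cF _] := ccP F.
pose H s t := orbit_kernel F x y s (s * t)%g.
have [k1 k2] := orbit_kernel0 x y CP.
have -> : dil_coef (smul SB (sstar SB F) F) x y = (fun t => I (fun s => H s t)).
  apply/funext => t; pose L c := K x.1 x.2 (amul c (gact t y.1)) (u t y.2).
  have Ll : lin L by move=> a c c'; rewrite /L amulDl (Klb _ _ _).
  have LM c : cabs (L c) <= nrm x.1 * (N x.2 * N y.2) * nrm y.1 * nrm c.
    apply: (le_trans (Kbd _ _ _ _)); rewrite fnorm_u -!mulrA ler_wpM2l ?nrm_ge0 //.
    rewrite mulrC -!mulrA ler_wpM2l ?fnorm_ge0 // ler_wpM2l ?fnorm_ge0 // mulrC.
    by apply: (le_trans (nrm_amul _ _)); rewrite nrm_gact.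
  rewrite -[LHS]/(L _) (conv_star_fun hausG lcG haarI modI t (ccP F) (ccP F) Ll LM).
  congr I; apply/funext => s; rewrite /L /pint -(K_inv s) gact_amul gactKV.
  by rewrite -amulA -gactM ccuM -K_amul.
have cH : continuous (fun z : G * G => H z.1 z.2).
  have c1 := cont_pair (@cont_fst _ _) (@mulg_continuous G).
  exact: (cont_comp c1 (@orbit_kernel_cont F x y)).
rewrite -(fubini hausG lcG haarI (H := H) cC (compact_mulset (compact_invset cC) cC) cH).
- congr I; apply/funext => s.
  have CI : Cc (fun r => orbit_kernel F x y s r : R[i]^o).
    refine (Cc_intro hausG _ cC (k2 s)).
    exact: (cont_comp (cont_pair (@cont_cst _ _ s) (@cont_id G)) (@orbit_kernel_cont F x y)).
  by rewrite -(I_left haarI s CI).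
- by move=> s t ns; apply: k1.
- move=> s t nt; rewrite /H.
  have [Cs|nCs] := pselect (C s); last by apply: k1.
  apply: k2 => Cst; apply: nt; rewrite -[t](mulKg s); apply: mulsetP => //.
  by apply: invsetP; rewrite invgK.
Qed.

Lemma dil_pos F : 0 <= dil (smul SB (sstar SB F) F).
Proof.
have [C [cC CP]] := Cc_elim (ccP F).
pose kp s r : R[i]^o := \sum_(x <- l) \sum_(y <- l) orbit_kernel F x y s r.
have CI x y s : Cc (fun r => orbit_kernel F x y s r : R[i]^o).
  have [k1 k2] := orbit_kernel0 x y CP.
  refine (Cc_intro hausG _ cC (k2 s)).
  exact: (cont_comp (cont_pair (@cont_cst _ _ s) (@cont_id G)) (@orbit_kernel_cont F x y)).
have CII x y : Cc (fun s => I (fun r => orbit_kernel F x y s r) : R[i]^o).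
  have [k1 k2] := orbit_kernel0 x y CP.
  have csw : continuous (fun z : G * G => orbit_kernel F x y z.2 z.1).
    exact: (cont_comp (cont_pair (@cont_snd _ _) (@cont_fst _ _)) (@orbit_kernel_cont F x y)).
  exact: (bd_Cc hausG lcG haarI (I_bounded hausG haarI) cC cC csw
    (fun r s => k2 s r) (fun r s => k1 s r)).
have -> : dil (smul SB (sstar SB F) F) = I (fun s => I (fun r => kp s r)).
  rewrite /dil.
  have -> : (fun s => I (fun r => kp s r)) =
      (fun s => \sum_(x <- l) \sum_(y <- l) I (fun r => orbit_kernel F x y s r)).
    apply/funext => s; rewrite (I_sum hausG haarI) => [|x _]; last exact: (@Cc_sum _ _ hausG R[i]^o).
    by apply: eq_bigr => x _; rewrite (I_sum hausG haarI).
  rewrite (I_sum hausG haarI) => [|x _]; last exact: (@Cc_sum _ _ hausG R[i]^o).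
  apply: eq_bigr => x _; rewrite (I_sum hausG haarI) //.
  by apply: eq_bigr => y _; exact: dil_star_mul.
apply: (pd_integral hausG lcG haarI cC).
- apply: (@cont_sum _ R[i]^o) => x; apply: (@cont_sum _ R[i]^o) => y; exact: orbit_kernel_cont.
- move=> s r ns; rewrite /kp big1 // => x _; rewrite big1 // => y _.
  by have [k1 _] := orbit_kernel0 x y CP; exact: k1.
- move=> s r nr; rewrite /kp big1 // => x _; rewrite big1 // => y _.
  by have [_ k2] := orbit_kernel0 x y CP; exact: k2.
move=> pts c.
have := ker_pos psd actl (@ccactM R G hausG A) (@form_act R G hausG lcG I haarI Delta modI A om) actN ccpP
  [seq (p, x) | p <- pts, x <- l]
  (fun z : G * (B * V) => (c z.1)%:C%C *: amul (F z.1) (gact z.1 z.2.1))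
  (fun z : G * (B * V) => u z.1 z.2.2).
rewrite big_allpairs_dep /=; congr (0 <= _); apply: eq_bigr => s _.
under eq_bigr => x _ do rewrite big_allpairs_dep /=.
rewrite exchange_big /=; apply: eq_bigr => r _; rewrite mulr_sumr; apply: eq_bigr => x _.
by rewrite mulr_sumr; apply: eq_bigr => y _; rewrite K_realZ.
Qed.
End Functional.

Section Embedding.
Context (iota : A -> B) (iE : equivariant_embedding iota)
  (Piota : forall a, bidual_eq (P (iota a)) (bidual_inj a)).

Let ihom : star_homomorphism iota. Proof. by case: iE. Qed.

Lemma iota_cont : continuous iota.
Proof.
apply: (@cont_lip _ _ A B iota 1); last exact: cont_id.
move=> x y; rewrite mul1r -(star_homB ihom); exact: (star_hom_contractive ihom).
Qed.

Lemma Cc_iota (f : G -> A) : Cc f -> Cc (iota \o f).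
Proof.
move=> Cf; apply: (@Cc_comp _ _ hausG A B iota _ (star_hom0 ihom) _ Cf).
by case: Cf => cf _; exact: (cont_comp cf iota_cont).
Qed.

Definition pushcc (f : V) : ccT G B := mkcc (Cc_iota (ccP f)).

Lemma pushcc_mul f g : pushcc (smul SA f g) = smul SB (pushcc f) (pushcc g).
Proof.
apply: ccI => t; apply: dual_separates => phi dphi.
have [pl [M M0 pM]] := dual_bound dphi.
have [il im _] := ihom; have [_ _ ig] := iE.
have Ll : lin (phi \o iota) by move=> c x y; rewrite /= il pl.
have LM a : cabs ((phi \o iota) a) <= M * nrm a.
  by apply: (le_trans (pM _)); rewrite ler_wpM2l // star_hom_contractive.
rewrite (conv_fun hausG lcG haarI t (ccP (pushcc f)) (ccP (pushcc g)) pl pM).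
rewrite -[LHS]/((phi \o iota) _) (conv_fun hausG lcG haarI t (ccP f) (ccP g) Ll LM).
by congr I; apply/funext => s; rewrite /cint /= im ig.
Qed.

Lemma pushcc_star f : pushcc (sstar SA f) = sstar SB (pushcc f).
Proof.
have [_ _ ist] := ihom; have [_ _ ig] := iE.
by apply: ccI => t; rewrite /= /cc_star (star_homZ ihom) ig ist.
Qed.

Definition spanV (l : seq (A * V)) : V := \sum_(x <- l) act x.1 x.2.
Definition lift (l : seq (A * V)) : seq (B * V) := [seq (iota x.1, x.2) | x <- l].

Lemma K_iota a h a' h' : K (iota a) h (iota a') h' = form (act a h) (act a' h').
Proof.
have [_ im ist] := ihom.
rewrite /ker -ist -im Piota; last exact: (mcoef_dual psd actl actN).
by rewrite /bidual_inj /mcoef -ccactM -form_act.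
Qed.

Lemma form_suml (T : Type) (s : seq T) (F : T -> V) g :
  form (\sum_(x <- s) F x) g = \sum_(x <- s) form (F x) g.
Proof.
elim: s => [|x s IHs]; last by rewrite !big_cons (psdDl psd) IHs.
by rewrite !big_nil -(scale0r (0 : V)) (psdZl psd) conjC0 mul0r.
Qed.
Lemma form_sumr (T : Type) (s : seq T) (F : T -> V) g :
  form g (\sum_(x <- s) F x) = \sum_(x <- s) form g (F x).
Proof. exact: (lin_sum (psd_lin psd g)). Qed.

(** On tensors iota a (x) h the dilation restricts to the form on Cc(G, A) itself, as
    [P] extends the inclusion of [A] in its bidual. This is where the weak
    expectation property identifies the original representation inside the
    dilation. *)
Lemma dil_iota (l : seq (A * V)) f :
  dil (lift l) (pushcc f) = form (spanV l) (smul SA f (spanV l)).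
Proof.
have [_ im _] := ihom; have [_ _ ig] := iE.
rewrite /dil /lift big_map form_suml; apply: eq_bigr => x _.
have -> : smul SA f (spanV l) = \sum_(y <- l) smul SA f (act y.1 y.2).
  rewrite /spanV; elim: (l) => [|y l' IHl]; first by rewrite !big_nil smul0r.
  by rewrite !big_cons smulAr IHl.
rewrite big_map form_sumr; apply: eq_bigr => y _.
rewrite (form_conv omL omB omP); congr I; apply/funext => t.
rewrite /dil_coef /= -ig -im K_iota -ccactM; congr (form _ (act _ _)).
by rewrite ccu_act.
Qed.

(** The GNS seminorm of [dil] on Cc(G, B) bounds convolution by iota f on all
    vectors iota E x; for x in the image of Cc(G, A) these are E x. *)
Lemma left_conv_le (Q : R) (f E : V) (l : seq (A * V)) :
  (forall q : ccT G B -> R, cseminorm SB q -> (forall F : ccT G B, q F <= L1 F) ->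
     q (pushcc f) <= Q) ->
  N (smul SA f (smul SA E (spanV l))) <= Q * N (smul SA E (spanV l)).
Proof.
move=> HQ.
have L0 (F : ccT G B) : 0 <= L1 F by exact: (cc_l1_ge0 hausG haarI).
have LMul := mul_l1 hausG lcG haarI modI (A := B).
have LSt := mul_star_l1 hausG lcG haarI modI (A := B).
pose o := dil (lift l).
have oL : lin o by exact: dil_lin.
have oB F : cabs (o F) <= dil_bound (lift l) * L1 F by exact: dil_le.
have oP F : 0 <= o (smul SB (sstar SB F) F) by exact: dil_pos.
have M0 := dil_bound_ge0 (lift l).
have qs := gns_seminorm L0 LMul LSt M0 oL oB oP.
have := HQ _ qs (gnsn_l L0 LMul LSt M0 oL oB oP).
have NE g : fnorm (gnsf SB o) (pushcc g) = N (smul SA g (spanV l)).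
  rewrite /fnorm /gnsf -pushcc_star -pushcc_mul /o dil_iota.
  by rewrite /gnsf -!smulA (sstarM SA) -!smulA.
have := gnsP L0 LMul LSt M0 oL oB oP (pushcc f) (pushcc E).
rewrite -pushcc_mul !NE -!smulA => h1 h2; apply: (le_trans h1).
by rewrite ler_wpM2r ?fnorm_ge0.
Qed.
End Embedding.
End Extension.

(** * Comparison of the norms *)

Section Main.
Context (R : realType) (G : topologicalGroupType).
Hypotheses (hausG : hausdorff_space G) (lcG : locally_compact [set: G]).
Context (I : (G -> R[i]) -> R[i]) (haarI : haar_integral I).
Context (Delta : G -> R) (modI : modular_function I Delta).
Context (A : galgType R G).

Notation J := (J I).
Notation L1 := (L1 I).
Notation V := (ccT G A).
Local Notation SA := (cc_staralg hausG lcG haarI modI A).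
Local Notation act := (@ccact R G hausG A).
Local Notation u := (@ccu R G hausG A).

(** The convolution e h is the integral of the e(s) u_s h; Riemann sums of it have the
    form of [spanV]. The values e(s) in [A] are what makes the vectors e h, unlike
    arbitrary ones, accessible to [left_conv_le]. *)
Lemma conv_approx (e h : V) (d : R) : 0 < d ->
  exists l : seq (A * V), L1 (smul SA e h - spanV hausG l : V) <= d.
Proof.
move=> d0; have [K [cK KP]] := Cc_elim (ccP e); have [K' [cK' K'P]] := Cc_elim (ccP h).
have [z1 z2] := cint_supp KP K'P; have cMK := compact_mulset cK cK'.
have [k [Ck kp kP]] := riemann_sums R hausG lcG cK.
have [w [Cw cw w01 wK]] := Urysohn_Cc R hausG lcG cMK.
have Jk : 0 <= J k by exact: J_ge0.
have w0 t : 0 <= w t by have /andP[] := w01 t.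
have Jw : 0 <= J w by exact: J_ge0.
have csw : continuous (fun z : G * G => cint e h z.2 z.1).
  exact: (cont_comp (cont_pair (@cont_snd _ _) (@cont_fst _ _)) (cont_cint (ccP e) (ccP h))).
pose C := J k * J w + 1; have C0 : 0 < C by rewrite ltr_pwDr // mulr_ge0.
have dC : 0 < d / C by rewrite divr_gt0.
have [| |s [g [Cg g0 gP _]]] := kP G A (fun t r => cint e h t r) _ _ _ dC.
- by move=> t r; exact: z1.
- by move=> t e' e'0; exact: (tube (H := fun r t => cint e h t r) t cMK csw (fun r t => @z2 t r) e'0).
exists [seq ((J (g x))%:C%C *: e x, u x h) | x <- s].
have bd := vint_bounded hausG lcG haarI A.
have E r : spanV hausG [seq ((J (g x))%:C%C *: e x, u x h) | x <- s] r =
    vector_integral I (fun t => \sum_(x <- s) (g x t)%:C%C *: cint e h x r).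
  rewrite /spanV big_map cc_sum (bd_sum hausG bd) => [|x _]; last first.
    by apply: (Cc_scale hausG); exact: Cg.
  apply: eq_bigr => x _; rewrite (vint_simple hausG lcG haarI _ (Cg x)) /=.
  by rewrite amulZl.
have CS r : Cc (fun t => \sum_(x <- s) (g x t)%:C%C *: cint e h x r).
  by apply: (Cc_sum hausG) => x _; apply: (Cc_scale hausG); exact: Cg.
apply: (@le_trans _ _ (J (fun r => d / C * J k * w r))); last first.
  rewrite (JZ hausG haarI _ Cw) mulrAC -[leRHS]mulr1 -!mulrA ler_wpM2l ?(ltW d0) //.
  by rewrite mulrC ler_pdivrMr // mul1r [J w * _]mulrC lerDl.
apply: (L1_le hausG haarI (ccP _) (CcrZ hausG _ Cw)) => r.
rewrite ccD ccN E -[smul SA e h r]/(vector_integral I (fun t => cint e h t r)).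
have CI := Cc_cint hausG r (ccP e) (ccP h).
rewrite -(bd_B bd CI (CS r)) mulrAC.
have := bd_le hausG haarI bd (CcB hausG CI (CS r)) (CcrZ hausG (d / C * w r) Ck).
rewrite mul1r (JZ hausG haarI _ Ck); apply => t.
have [Kr|nKr] := pselect (mulset K K' r); first by rewrite (wK _ Kr) mulr1; exact: gP.
rewrite z2 // big1 ?subr0 => [|x _]; last by rewrite z2 // scaler0.
by rewrite nrm0 mulr_ge0 // mulr_ge0 // ltW.
Qed.

Lemma iterate_square (X : lmodType R[i]) (S : staralg X) (q : X -> R) x k : cseminorm S q ->
  q (iter k (fun y => smul S (sstar S y) y) x) = q x ^+ (2 ^ k).
Proof.
move=> Q; elim: k => [|k IHk]; first by rewrite expr1.
by rewrite iterS (csC Q) IHk -exprM expnS mulnC.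
Qed.

Section Compare.
Context (wepA : GWEP A) (p : (G -> A) -> R) (pP : cstar_seminorm I Delta p).
Context (B : galgType R G) (iota : A -> B) (iE : equivariant_embedding iota).
Local Notation SB := (cc_staralg hausG lcG haarI modI B).

(** [Q] is an upper bound for the maximal norm of iota f. *)
Definition dominated (f : V) (Q : R) := forall q : ccT G B -> R, cseminorm SB q ->
  (forall F : ccT G B, q F <= L1 F) -> q (pushcc hausG iE f) <= Q.

(** The functional om is chosen to see the norm of z = (f f^* )^2 up to the constant
    11 < 16. Writing z = f (f^* (f f^* )), the inequality of [left_conv_le] with E = f^*
    extends by [conv_approx] from [spanV] to f f^*, and bounds the norm of the vector z
    by Q times that of f^* f f^*, at most Q (p f)^3; on the other side p z = (p f)^4. *)
Lemma dominated_le4 (f : V) (Q : R) : 0 <= Q -> dominated f Q -> p f <= 4 * Q.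
Proof.
move=> Q0 HQ; have [pS pL] := cc_of_seminorm hausG lcG haarI modI pP.
pose pc (g : V) := p g.
have [P [ccpP eqP Piota]] := wepA iE.
pose fs := sstar SA f; pose y := smul SA fs (smul SA f fs); pose z := smul SA f y.
have [om [omL omp omP omz]] := exists_positive_functional z pS.
have omB (g : V) : cabs (om g) <= L1 g by apply: (le_trans (omp g)); exact: pL.
pose N := fnorm (gnsf SA om).
have psd := form_psd omL omP.
have Np (g : V) : N g <= pc g.
  have g0 : 0 <= pc g := cs_ge0 pS g.
  rewrite -(ler_pXn2r (n := 2)) ?nnegrE ?fnorm_ge0 // (fnorm_sqr psd).
  apply: (le_trans (Re_le_cabs _)); apply: (le_trans (omp _)).
  by rewrite (csC pS).
have L0 (g : V) : 0 <= L1 g := cc_l1_ge0 hausG haarI g.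
have key : N z <= Q * N y.
  apply/ler_addgt0Pr => d d0.
  pose C := (L1 f + Q) * L1 fs + 1.
  have C0 : 0 < C by rewrite ltr_pwDr // mulr_ge0 // addr_ge0.
  have dC : 0 < d / C by rewrite divr_gt0.
  have [l lP] := conv_approx f fs dC.
  set s := spanV hausG l in lP; set v := smul SA f fs - s in lP.
  have cmp := left_conv_le omL omB omP ccpP eqP Piota fs l HQ.
  rewrite -/s -/N in cmp.
  have sv : smul SA f fs = v + s by rewrite /v subrK.
  have v1 : N (smul SA fs v) <= L1 fs * (d / C).
    apply: (le_trans (fnorm_l1 omL omB omP _)); apply: (le_trans (mul_l1 _ _ _ _ _ _)).
    by rewrite ler_wpM2l.
  have v2 : N (smul SA f (smul SA fs v)) <= L1 f * (L1 fs * (d / C)).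
    apply: (le_trans (fnorm_l1 omL omB omP _)); apply: (le_trans (mul_l1 _ _ _ _ _ _)).
    rewrite ler_wpM2l //; apply: (le_trans (mul_l1 _ _ _ _ _ _)).
    by rewrite ler_wpM2l.
  have h1 : N z <= N (smul SA f (smul SA fs v)) + N (smul SA f (smul SA fs s)).
    by rewrite /z /y sv !smulAr; exact: (fnormD psd).
  have h2 : N (smul SA fs s) <= N y + N (smul SA fs v).
    have -> : smul SA fs s = y - smul SA fs v by rewrite /y sv smulAr addrC addKr.
    apply: (le_trans (fnormD psd _ _)).
    by rewrite -[- smul SA fs v]scaleN1r (fnormZ psd) cabsN cabs1 mul1r.
  have h3 : Q * N (smul SA fs s) <= Q * N y + Q * (L1 fs * (d / C)).
    by rewrite -mulrDr ler_wpM2l // (le_trans h2) // lerD2l.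
  apply: (le_trans h1); apply: (le_trans (lerD v2 (le_trans cmp h3))).
  rewrite addrCA lerD2l -mulrDl mulrA [_ * (d / C)]mulrC -mulrA.
  rewrite -[leRHS]mulr1 ler_wpM2l ?(ltW d0) // mulrC ler_pdivrMr // mul1r /C lerDl.
  by [].
have f0 : 0 <= pc f := cs_ge0 pS f.
have fsp : pc fs = pc f := cs_star pS f.
have py : pc y <= pc f ^+ 3.
  apply: (le_trans (csM pS _ _)); rewrite -/(pc fs) fsp exprS ler_wpM2l //.
  by apply: (le_trans (csM pS _ _)); rewrite -/(pc fs) -/(pc f) fsp expr2.
have pz : pc z = pc f ^+ 4.
  have e : z = smul SA (sstar SA (smul SA f fs)) (smul SA f fs).
    by rewrite sstarM sstarK /z /y -/fs !smulA.
  have e' : smul SA f fs = smul SA (sstar SA fs) fs by rewrite sstarK.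
  by rewrite /pc e (csC pS) e' (csC pS) -/(pc fs) fsp -exprM.
have Nz : pc z ^+ 2 <= 11 * N z ^+ 2.
  apply: (le_trans omz); rewrite -[om _]/(gnsf SA om z z) (fnorm_sqrc psd) cabs_real.
  by rewrite ger0_norm ?sqr_ge0.
have zQ : N z <= Q * pc f ^+ 3.
  by apply: (le_trans key); rewrite ler_wpM2l // (le_trans (Np y)).
have [fz|fn] := eqVneq (pc f) 0; first by rewrite -/(pc f) fz mulr_ge0.
have fp : 0 < pc f by rewrite lt_neqAle eq_sym fn.
rewrite -(ler_pXn2r (n := 2)) ?nnegrE ?mulr_ge0 //.
rewrite -(ler_pM2r (exprn_gt0 6 fp)) -exprD.
have -> : p f ^+ (2 + 6) = pc z ^+ 2 by rewrite pz -exprM.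
apply: (le_trans Nz); apply: (@le_trans _ _ (11 * (Q * pc f ^+ 3) ^+ 2)).
  by rewrite ler_wpM2l // ler_pXn2r ?nnegrE ?fnorm_ge0 ?mulr_ge0 ?exprn_ge0.
have := mulr_ge0 (sqr_ge0 Q) (sqr_ge0 (pc f ^+ 3)).
have -> : (4 * Q) ^+ 2 * pc f ^+ 6 = 16 * (Q ^+ 2 * pc f ^+ 3 ^+ 2) by ring.
rewrite exprMn; lra.
Qed.

(** The elements x_(k+1) = x_k^* x_k starting from f have p x_k = (p f)^(2^k) for every
    C*-seminorm, so the constant 4 disappears by [pow2_le1]. *)
Theorem dominated_le (f : V) (Q : R) : 0 <= Q -> dominated f Q -> p f <= Q.
Proof.
move=> Q0 HQ; have [pS pL] := cc_of_seminorm hausG lcG haarI modI pP.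
pose x k := iter k (fun y => smul SA (sstar SA y) y) f.
have px k : p (x k) = p f ^+ (2 ^ k) := iterate_square f k pS.
have dom k : dominated (x k) (Q ^+ (2 ^ k)).
  move=> q qS qL.
  have -> : pushcc hausG iE (x k) = iter k (fun y => smul SB (sstar SB y) y) (pushcc hausG iE f).
    by elim: k => // k IHk; rewrite /x !iterS -/(x k) pushcc_mul pushcc_star IHk.
  rewrite (iterate_square _ _ qS) ler_pXn2r ?nnegrE ?(cs_ge0 qS) ?expn_gt0 //.
  exact: HQ.
have bound k : p f ^+ (2 ^ k) <= 4 * Q ^+ (2 ^ k).
  by rewrite -px; apply: dominated_le4; [exact: exprn_ge0|exact: dom].
have [Qz|Qn] := eqVneq Q 0.
  by have := bound 0; rewrite !expr1 Qz mulr0.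
have Qp : 0 < Q by rewrite lt_neqAle eq_sym Qn.
rewrite -[leRHS]mul1r -ler_pdivrMr //; apply: (@pow2_le1 _ _ 3) => k.
rewrite expr_div_n ler_pdivrMr ?exprn_gt0 //; apply: (le_trans (bound k)).
rewrite ler_wpM2r ?exprn_ge0 //.
have : 1 <= (2 ^ k)%:R :> R by rewrite ler1n expn_gt0.
lra.
Qed.
End Compare.

Lemma max_set0 (B : galgType R G) : cstar_seminorm I Delta (ext_cc (fun _ : ccT G B => 0)).
Proof.
apply: seminorm_of_cc => [|f]; last exact: (cc_l1_ge0 hausG haarI).
by split=> *; rewrite ?addr0 ?mulr0 ?expr0n.
Qed.

Lemma ext_cc0 (B : galgType R G) (F : G -> B) : ext_cc (fun _ : ccT G B => 0 : R) F = 0.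
Proof. by rewrite /ext_cc; case: pselect. Qed.

Lemma max_norm_ub (B : galgType R G) (F : G -> B) : Cc F ->
  has_ubound [set q F | q in [set q | cstar_seminorm I Delta q]].
Proof. by move=> CF; exists (L1_norm I F) => _ [q [_ _ _ _ qL] <-]; exact: qL. Qed.

Lemma max_norm_ge (B : galgType R G) (F : G -> B) (q : (G -> B) -> R) : Cc F ->
  cstar_seminorm I Delta q -> q F <= max_norm I Delta F.
Proof. by move=> CF qP; apply: ub_le_sup; [exact: max_norm_ub|exists q]. Qed.

Theorem seminorm_le_max_norm (wepA : GWEP A) (p : (G -> A) -> R) (B : galgType R G)
  (iota : A -> B) (f : G -> A) : cstar_seminorm I Delta p -> equivariant_embedding iota ->
  Cc f -> p f <= max_norm I Delta (iota \o f).
Proof.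
move=> pP iE Cf; have CF := Cc_iota hausG iE Cf.
apply: (dominated_le wepA pP (iE := iE) (f := mkcc Cf)) => [|q qS qL].
  by have := max_norm_ge CF (max_set0 B); rewrite ext_cc0.
have := max_norm_ge CF (seminorm_of_cc qS qL).
by rewrite (@ext_ccE _ _ _ q (pushcc hausG iE (mkcc Cf))).
Qed.

End Main.

Theorem proposition3p12 (R : realType) (G : topologicalGroupType)
    (hausG : hausdorff_space G) (lcG : locally_compact [set: G])
    (I : (G -> R[i]) -> R[i]) (haarI : haar_integral I)
    (Delta : G -> R) (modI : modular_function I Delta)
    (A : galgType R G) (wepA : GWEP A) (f : G -> A) (ccf : Cc f) :
  inj_norm I Delta f = max_norm I Delta f.
Proof.
have iid : equivariant_embedding (id : A -> A) by split.
have lb : lbound [set r : R | exists (B : galgType R G) (iota : A -> B),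
    equivariant_embedding iota /\ r = max_norm I Delta (iota \o f)] (max_norm I Delta f).
  move=> _ [B [iota [iE ->]]]; apply: ge_sup.
    by eexists; eexists; first exact: (max_set0 hausG lcG haarI modI A).
  by move=> _ [p pP <-]; exact: (seminorm_le_max_norm hausG lcG haarI modI).
apply/eqP; rewrite eq_le; apply/andP; split.
  by apply: ge_inf; [exists (max_norm I Delta f)|exists A, id].
apply: lb_le_inf => //; by exists (max_norm I Delta f), A, id.
Qed.
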